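(* Let $X_1,X_2,\ldots$ be iid complex-valued random variables with common distribution $\mu$, fix $s\in\mathbb{N}$, and suppose $\xi_1,\ldots,\xi_s\in\mathbb{C}$ are distinct, fixed deterministic values with $\xi_1,\ldots,\xi_s\notin\operatorname{supp}(\mu)\cup \mathrm{M}_\mu$, where $\mathrm{M}_\mu := \{z\in\mathbb{C}:m_\mu(z)=0\}$. Then there exist constants $C,c_{\mu,\vec\xi},C_{\mu,\vec\xi}>0$ so that with probability at least $1-C\exp(-c_{\mu,\vec\xi}\,n)$, the polynomial $$p_n(z)=\prod_{l=1}^s(z-\xi_l)\prod_{j=1}^{n+1-s}(z-X_j)$$ has $s$ critical points $w_1^{(n)},\ldots,w_s^{(n)}$ such that for $1\le l\le s$, $w_l^{(n)}$ is the unique critical point of $p_n$ that is within a distance of $\frac{3}{|m_\mu(\xi_l)|n}$ of $\xi_l$, and $$\left|w_l^{(n)}-\xi_l+\frac{1}{n+1}\,\frac{n}{\sum_{j\ne l}\frac{1}{\xi_l-\xi_j}+\sum_{j=1}^{n+1-s}\frac{1}{\xi_l-X_j}}\right| < \frac{C_{\mu,\vec\xi}}{n^2}.$$ In addition, $$\left(n^{3/2}\cdot m_\mu(\xi_l)^2\cdot\left(w_l^{(n)}-\xi_l+\frac{1}{n+1}\frac{1}{m_\mu(\xi_l)}\right)\right)_{l=1}^s\longrightarrow(N_1,\ldots,N_s)$$ in distribution as $n\to\infty$, where $(N_1,\ldots,N_s)$ is a vector of complex random variables such that $(\operatorname{Re}N_1,\operatorname{Im}N_1,\ldots,\operatorname{Re}N_s,\operatorname{Im}N_s)$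 has a (possibly degenerate) multivariate normal distribution with mean zero and covariances, for all $1\le j,l\le s$, $$\operatorname{Cov}(\operatorname{Re}N_j,\operatorname{Re}N_l)=\operatorname{Cov}\left(\operatorname{Re}\tfrac{1}{\xi_j-X_1},\operatorname{Re}\tfrac{1}{\xi_l-X_1}\right),$$ $$\operatorname{Cov}(\operatorname{Im}N_j,\operatorname{Im}N_l)=\operatorname{Cov}\left(\operatorname{Im}\tfrac{1}{\xi_j-X_1},\operatorname{Im}\tfrac{1}{\xi_l-X_1}\right),$$ $$\operatorname{Cov}(\operatorname{Re}N_j,\operatorname{Im}N_l)=\operatorname{Cov}\left(\operatorname{Re}\tfrac{1}{\xi_j-X_1},\operatorname{Im}\tfrac{1}{\xi_l-X_1}\right).$$
   Context: The Cauchy--Stieltjes transform of a probability measure $\mu$ on $\mathbb{C}$ is $m_\mu(z) := \int_{\mathbb{C}} \frac{d\mu(x)}{z-x}$, defined for those $z$ for which the integral exists. Subscripts on constants indicate the parameters on which they may depend; $\vec\xi=(\xi_1,\ldots,\xi_s)$. The variables $w_l^{(n)}$ are defined on an event of probability tending to one; their values off that event are immaterial for the convergence in distribution. *)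

(* Defs.v *)
From HB Require Import structures.
From mathcomp Require Import all_boot all_order all_algebra finmap complex.
From mathcomp Require Import all_classical all_reals all_analysis.

Set Implicit Arguments.
Unset Strict Implicit.
Unset Printing Implicit Defensive.

Import Order.TTheory GRing.Theory Num.Theory.
Import numFieldNormedType.Exports.

Local Open Scope classical_set_scope.
Local Open Scope ring_scope.
Local Open Scope complex_scope.

(* R[i] with the topology of its modulus and the corresponding Borel
   sigma-algebra. *)
HB.instance Definition _ (R : realType) :=
  NormedModule.copy R[i] (R[i] : numFieldType)^o.

HB.instance Definition _ (R : realType) :=
  Measurable.copy R[i] (g_sigma_algebraType (@open R[i])).

Section law_on_complex_plane.
Context {R : realType} (mu : probability R[i] R).

Definition measure_support : set R[i] :=
  [set z | forall U : set R[i], open_nbhs z U -> (0 < mu U)%E].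

(* Since 0^-1 = 0 in R[i], an atom of mu at z has to be excluded explicitly. *)
Definition cauchy_stieltjes_exists (z : R[i]) : Prop :=
  [/\ mu [set z] = 0%E,
      mu.-integrable setT (fun x => (complex.Re (z - x)^-1)%:E)
    & mu.-integrable setT (fun x => (complex.Im (z - x)^-1)%:E)].

Definition cauchy_stieltjes (z : R[i]) : R[i] :=
  (\int[mu]_x complex.Re (z - x)^-1) +i* (\int[mu]_x complex.Im (z - x)^-1).

Definition cauchy_stieltjes_zeros : set R[i] :=
  [set z | cauchy_stieltjes_exists z /\ cauchy_stieltjes z = 0].

End law_on_complex_plane.

Section random_variables.
Context {R : realType} {d : measure_display} {T : measurableType d}.
Context (P : probability T R).

Definition mutually_independent {d' : measure_display}
    {T' : measurableType d'} {I : choiceType} (X : I -> {RV P >-> T'}) : Prop :=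
  forall (J : {fset I}) (B : I -> set T'),
    (forall j, j \in J -> measurable (B j)) ->
    P (\bigcap_(j in [set` J]) (X j @^-1` B j)) =
    (\prod_(j <- J) P (X j @^-1` B j))%E.

(* Laws are compared on measurable sets only: the value of a measure on other
   sets is irrelevant. *)
Definition has_law {d' : measure_display} {T' : measurableType d'}
    (X : T -> T') (nu : set T' -> \bar R) : Prop :=
  forall A : set T', measurable A -> P (X @^-1` A) = nu A.

Definition iid_with_law {d' : measure_display} {T' : measurableType d'}
    (nu : probability T' R) (X : nat -> {RV P >-> T'}) : Prop :=
  mutually_independent X /\ forall j, has_law (X j) nu.

(* normal_prob m 0 is not the point mass at m, hence the separate degenerate
   case. *)
Definition univariate_normal (Y : T -> R) : Prop :=
  exists m : R, has_law Y (dirac m) \/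
    exists2 sigma : R, 0 < sigma & has_law Y (normal_prob m sigma).

Definition multivariate_normal {I : finType} (Y : I -> T -> R) : Prop :=
  forall a : I -> R, univariate_normal (fun t => \sum_i a i * Y i t).

Definition Re_Im_coordinates {s : nat} (N : 'I_s -> T -> R[i])
    (i : 'I_s * bool) (t : T) : R :=
  if i.2 then complex.Im (N i.1 t) else complex.Re (N i.1 t).

Definition cvg_in_distribution {V : topologicalType}
    (Z : nat -> T -> V)
    {d' : measure_display} {T' : measurableType d'} (P' : probability T' R)
    (Y : T' -> V) : Prop :=
  forall f : V -> R, continuous f -> (exists M : R, forall v, `|f v| <= M) ->
    'E_P[f \o Z n]%E @[n --> \oo] --> 'E_P'[f \o Y]%E.

End random_variables.

Section polynomial.
Context {R : realType} {s : nat} (xi : 'I_s -> R[i]) (x : nat -> R[i]).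

(* The roots X_1, X_2, ... are indexed from 0. *)
Definition poly_of_roots (n : nat) : {poly R[i]} :=
  \prod_(l < s) ('X - (xi l)%:P) * \prod_(j < n.+1 - s) ('X - (x j)%:P).

Definition critical_point (p : {poly R[i]}) (z : R[i]) : Prop := root p^`() z.

Definition reciprocal_sum (n : nat) (l : 'I_s) : R[i] :=
  \sum_(j < s | j != l) (xi l - xi j)^-1
  + \sum_(j < n.+1 - s) (xi l - x j)^-1.

(* w lists s distinct points, each the only critical point in the closed disk
   of radius 3 / (|m_l| n) around xi_l; the conditions x_j <> xi_l and
   reciprocal_sum <> 0 say that the quotients in the last bound are genuine. *)
Definition paired_critical_points (m : 'I_s -> R[i]) (C' : R) (n : nat)
    (w : 'I_s -> R[i]) : Prop :=
  injective w /\
  forall l : 'I_s,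
    let r := 3%:R / (`|m l| * n%:R) in
    [/\ critical_point (poly_of_roots n) (w l) /\ `|w l - xi l| <= r,
        forall z, critical_point (poly_of_roots n) z -> `|z - xi l| <= r ->
          z = w l,
        (forall j : nat, (j < n.+1 - s)%N -> x j != xi l) /\
          reciprocal_sum n l != 0
      & `|w l - xi l + n.+1%:R^-1 * (n%:R / reciprocal_sum n l)|
          < (C' / n%:R ^+ 2)%:C].

Definition rescaled_fluctuations (m : 'I_s -> R[i]) (n : nat)
    (w : 'I_s -> R[i]) : 'rV[R[i]]_s :=
  \row_l ((n%:R `^ (3%:R / 2%:R))%:C * m l ^+ 2 *
          (w l - xi l + n.+1%:R^-1 * (m l)^-1)).

End polynomial.

(* Main.v *)
Require Import Defs.
From HB Require Import structures.
From mathcomp Require Import all_boot all_order all_algebra finmap complex.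
From mathcomp Require Import all_classical all_reals all_analysis.
From mathcomp Require Import measurable_realfun ring lra.

Set Implicit Arguments.
Unset Strict Implicit.
Unset Printing Implicit Defensive.

Import Order.TTheory GRing.Theory Num.Theory.
Import numFieldNormedType.Exports.

Local Open Scope classical_set_scope.
Local Open Scope ring_scope.
Local Open Scope complex_scope.

(* Write m_l for the Cauchy-Stieltjes transform at xi_l and S_l(z) for the sum
   of 1 / (z - a) over the roots a <> xi_l of p_n. Near xi_l the critical points
   are the fixed points of z |-> xi_l - 1 / S_l(z). On the event that no X_j is
   close to a xi_l (which has probability 1, as xi_l is off the support) and
   that the bounded centred sums of 1 / (xi_l - X_j) are at most a small
   multiple of n (an exponential Markov bound), |S_l(xi_l)| is of order n and
   this map contracts the disk of radius 3 / (|m_l| n): the fixed point w_l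
   exists, is unique, and is xi_l - 1 / S_l(xi_l) up to O(n^-2). Expanding
   1 / S_l(xi_l) around 1 / (n m_l), the rescaled w_l differs by O(n^-1/2) in
   mean from the normalised centred sum of the 1 / (xi_l - X_j), to which the
   multivariate central limit theorem applies. The latter is proved by
   Lindeberg's replacement method for a class of test functions with bounded
   second-order Taylor expansions; it contains the spline interpolants
   approximating a bounded continuous function from below, which extends the
   convergence to all bounded continuous functions. *)

(** * Bounded random variables *)

(** The constants [c] and [C'] are fixed before the probability space, so they may depend only on
    [mu] and [xi]. They do so through two numbers: [de], such that the [xi l] are [de] apart and the
    disks of radius [de] around them are null for [mu], and [mu0], a common lower bound of the
    |m_l|. Beyond a threshold depending on [de], [mu0] and the number of fixed roots, the analysis
    of critical points is deterministic.

    Poles are truncated inside these disks. This changes them on a null set only and makes all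
    summands bounded, as the exponential bound and Lindeberg's method require.

    Conditioning is replaced by Fubini's theorem on a product whose first factor is [T] with the
    sigma-algebra of the past. The Gaussian vector is constructed together with its stability under
    convolution; besides its moments, the replacement argument needs nothing else about it. No
    calculus in several variables occurs: having a Taylor expansion with bounded coefficients is
    preserved by sums and products, so products of one-dimensional splines are admissible test
    functions. *)

Section expectations.
Context {R : realType} {d : measure_display} {T : measurableType d}.
Variable P : probability T R.

Lemma bounded_integrable (f : T -> R) : measurable_fun setT f ->
  (exists M : R, forall x, `|f x| <= M) -> P.-integrable setT (EFin \o f).
Proof.
move=> mf [M fM]; apply: measurable_bounded_integrable => //.
  exact: fin_num_fun_lty.
exists M; split; first exact: num_real.
by move=> y My x _; exact: le_trans (fM x) (ltW My).
Qed.

Lemma Rintegral_cst1 (c : R) : \int[P]_x c = c.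
Proof. by rewrite Rintegral_cst// [X in fine X](probability_setT P) mulr1. Qed.

Lemma Rintegral_le_cst (f : T -> R) (M : R) : measurable_fun setT f ->
  (forall x, `|f x| <= M) -> `|\int[P]_x f x| <= M.
Proof.
move=> mf fM.
have intf : P.-integrable setT (EFin \o f).
  by apply: bounded_integrable => //; exists M.
apply: le_trans (le_normr_Rintegral _ intf) _ => //.
rewrite -[leRHS]Rintegral_cst1; apply: le_Rintegral => //.
- apply: bounded_integrable; first exact: measurableT_comp.
  by exists M => x; rewrite normr_id.
- by apply: bounded_integrable; [exact: measurable_cst | exists `|M|].
Qed.

Lemma EFin_Rintegral (f : T -> R) : P.-integrable setT (EFin \o f) ->
  (\int[P]_x f x)%:E = (\int[P]_x (f x)%:E)%E.
Proof. by move=> intf; rewrite fineK//; exact: integrable_fin_num. Qed.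

Lemma RintegralZ (c : R) (f : T -> R) : P.-integrable setT (EFin \o f) ->
  \int[P]_x (c * f x) = c * \int[P]_x f x.
Proof. by move=> intf; rewrite RintegralZl. Qed.

(** Integrability and value are proved together: additivity at each step of the induction needs the
    integrability of the tail. *)
Lemma Rintegral_sum {I : Type} (s : seq I) (F : I -> T -> R) :
  (forall i, P.-integrable setT (EFin \o F i)) ->
  P.-integrable setT (EFin \o (fun x => \sum_(i <- s) F i x)) /\
  \int[P]_x (\sum_(i <- s) F i x) = \sum_(i <- s) \int[P]_x F i x.
Proof.
move=> iF; elim: s => [|i s [ih1 ih2]].
  split; last by under eq_Rintegral do rewrite big_nil; rewrite Rintegral_cst1 big_nil.
  apply: bounded_integrable.
    by under eq_fun do rewrite big_nil; exact: measurable_cst.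
  by exists 0 => x; rewrite big_nil normr0.
have E : (fun x => \sum_(j <- i :: s) F j x) = (fun x => F i x + \sum_(j <- s) F j x).
  by apply/funext => x; rewrite big_cons.
rewrite E big_cons; split; last by rewrite RintegralD// ih2.
exact: (integrableD measurableT (iF i) ih1).
Qed.

End expectations.

Section product_probability.
Context {R : realType} {d1 d2 : measure_display}.
Context {T1 : measurableType d1} {T2 : measurableType d2}.
Variables (P1 : probability T1 R) (P2 : probability T2 R).

(** A name for the product measure to which the structure of a probability can be attached, so that
    results on probabilities apply to products. *)
Definition product_prob : set (T1 * T2) -> \bar R := (P1 \x P2)%E.

HB.instance Definition _ := Measure.on product_prob.

Let product_prob_setT : product_prob setT = 1%E.
Proof.
rewrite -setXTT [LHS]product_measure1E//.
by rewrite [X in (X * _)%E](probability_setT P1)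
           [X in (_ * X)%E](probability_setT P2) mule1.
Qed.

HB.instance Definition _ :=
  Measure_isProbability.Build _ _ R product_prob product_prob_setT.

End product_probability.

Section fubini_bounded.
Context {R : realType} {d1 d2 : measure_display}.
Context {T1 : measurableType d1} {T2 : measurableType d2}.
Variables (P1 : probability T1 R) (P2 : probability T2 R) (f : T1 * T2 -> R).
Hypothesis mf : measurable_fun setT f.
Hypothesis bf : exists M : R, forall x, `|f x| <= M.

Let mf1 x : measurable_fun setT (fun y => f (x, y)).
Proof. exact: measurableT_comp. Qed.

Let mf2 y : measurable_fun setT (fun x => f (x, y)).
Proof. exact: measurableT_comp. Qed.

Let int_f : (P1 \x P2)%E.-integrable setT (EFin \o f).
Proof. exact: (@bounded_integrable _ _ _ (product_prob P1 P2)). Qed.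

Let FE1 x : (\int[P2]_y f (x, y))%:E = (\int[P2]_y (f (x, y))%:E)%E.
Proof.
rewrite EFin_Rintegral//; apply: bounded_integrable; first exact: mf1.
by have [M fM] := bf; exists M.
Qed.

Let FE2 y : (\int[P1]_x f (x, y))%:E = (\int[P1]_x (f (x, y))%:E)%E.
Proof.
rewrite EFin_Rintegral//; apply: bounded_integrable; first exact: mf2.
by have [M fM] := bf; exists M.
Qed.

Lemma measurable_Rintegral2 : measurable_fun setT (fun x => \int[P2]_y f (x, y)).
Proof.
apply/measurable_EFinP; rewrite (_ : _ \o _ = fubini_F P2 (EFin \o f)).
  exact: (measurable_fubini_F (m1 := P1)).
by apply/funext => x /=; rewrite FE1.
Qed.

Lemma Rfubini1 :
  \int[P1]_x \int[P2]_y f (x, y) = \int[product_prob P1 P2]_z f z.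
Proof.
transitivity (fine (\int[P1]_x fubini_F P2 (EFin \o f) x)%E).
  by congr fine; apply: eq_integral => x _; rewrite FE1.
by rewrite (integral12_prod_meas1 int_f).
Qed.

Lemma Rfubini :
  \int[P1]_x \int[P2]_y f (x, y) = \int[P2]_y \int[P1]_x f (x, y).
Proof.
rewrite Rfubini1; transitivity (fine (\int[P2]_y fubini_G P1 (EFin \o f) y)%E).
  by rewrite (integral21_prod_meas1 int_f).
by congr fine; apply: eq_integral => x _; rewrite FE2.
Qed.

End fubini_bounded.

(** * Laws, and independence of a variable from the past *)

Section law.
Context {R : realType} {d d' : measure_display}.
Context {T : measurableType d} {T' : measurableType d'}.
Variables (P : probability T R) (nu : {measure set T' -> \bar R}) (X : T -> T').
Hypothesis mX : measurable_fun setT X.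
Hypothesis lawX : has_law P X nu.

Let ge0_integral_law (f : T' -> \bar R) : measurable_fun setT f ->
  (forall y, 0 <= f y)%E -> (\int[P]_t f (X t) = \int[nu]_y f y)%E.
Proof.
move=> mf f0; transitivity (\int[pushforward P X]_y f y)%E.
  by rewrite ge0_integral_pushforward.
by apply: eq_measure_integral => A mA _; exact: lawX.
Qed.

Lemma integral_law (f : T' -> \bar R) : measurable_fun setT f ->
  (\int[P]_t f (X t) = \int[nu]_y f y)%E.
Proof.
move=> mf; rewrite [LHS]integralE [RHS]integralE.
rewrite -(ge0_integral_law (measurable_funepos mf))//.
rewrite -(ge0_integral_law (measurable_funeneg mf))//.
by congr (_ - _)%E; apply: eq_integral => t _; rewrite ?funeposE ?funenegE.
Qed.

Lemma Rintegral_law (f : T' -> R) : measurable_fun setT f ->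
  \int[P]_t f (X t) = \int[nu]_y f y.
Proof.
move=> mf; rewrite /Rintegral (integral_law (f := fun y => (f y)%:E))//.
exact/measurable_EFinP.
Qed.

Lemma integrable_law (f : T' -> R) : measurable_fun setT f ->
  P.-integrable setT (EFin \o (f \o X)) <-> nu.-integrable setT (EFin \o f).
Proof.
move=> mf; split => /integrableP[m i]; apply/integrableP; split.
- exact/measurable_EFinP.
- move: i; rewrite -(integral_law (f := fun y => `|(f y)%:E|%E))//.
  by apply: measurableT_comp => //; exact/measurable_EFinP.
- by apply/measurable_EFinP; exact: measurableT_comp.
- move: i; rewrite -(integral_law (f := fun y => `|(f y)%:E|%E))//.
  by apply: measurableT_comp => //; exact/measurable_EFinP.
Qed.

End law.

Section independence.
Context {R : realType} {d d' : measure_display}.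
Context {T : measurableType d} {T' : measurableType d'}.
Variables (P : probability T R) (nu : probability T' R).
Variable X : nat -> {RV P >-> T'}.
Hypothesis iidX : iid_with_law nu X.

Lemma iid_bigcap (n : nat) (B : nat -> set T') :
  (forall j, measurable (B j)) ->
  P (\bigcap_(j in `I_n) (X j @^-1` B j)) = (\prod_(j < n) nu (B j))%E.
Proof.
move=> mB; have [indX lawX] := iidX.
have := indX [fset x | x in iota 0 n]%fset B (fun j _ => mB j).
have -> : [set` [fset x | x in iota 0 n]%fset] = `I_n.
  by apply/seteqP; split => x /=; rewrite !inE mem_iota add0n.
move=> ->; rewrite -(big_mkord xpredT (fun j => nu (B j))) /index_iota subn0.
rewrite (perm_big (iota 0 n)) /=.
  by apply: eq_bigr => j _; rewrite lawX.
by apply: uniq_perm; rewrite ?fset_uniq ?iota_uniq// => x; rewrite !inE.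
Qed.

(** Cylinder sets over the first [k] variables: a pi-system that generates their joint sigma-algebra
    and on which independence is a product formula. *)
Definition past (k : nat) : set (set T) :=
  [set A | exists2 B : nat -> set T', (forall j, measurable (B j)) &
    A = \bigcap_(j in `I_k) (X j @^-1` B j)].

Lemma past_setI k : setI_closed (past k).
Proof.
move=> _ _ [B mB ->] [C mC ->]; exists (fun j => B j `&` C j).
  by move=> j; exact: measurableI.
by rewrite -bigcapI; apply: eq_bigcapr.
Qed.

Lemma past_measurable k : <<s past k>> `<=` @measurable _ T.
Proof.
apply: smallest_sub; first exact: sigma_algebra_measurable.
move=> _ [B mB ->]; apply: bigcap_measurableType => j _.
by rewrite -[X in measurable X]setTI; exact: measurable_funP.
Qed.

Let PX k B : measurable B -> measurable (X k @^-1` B).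
Proof. by move=> mB; rewrite -[X in measurable X]setTI; exact: measurable_funP. Qed.

(** Dynkin's theorem: for fixed [B] the events [A] satisfying the product formula are closed under
    complements and countable disjoint unions, and they contain the cylinder sets. *)
Lemma past_indep k (A : set T) (B : set T') : <<s past k>> A -> measurable B ->
  P (A `&` X k @^-1` B) = (P A * nu B)%E.
Proof.
move=> sA mB; move: A sA.
have mXB := PX k mB.
have PXB : P (X k @^-1` B) = nu B by have [_ ->] := iidX.
have fB : nu B \is a fin_num by exact: fin_num_measure.
apply: (@dynkin_induction _ (g_sigma_algebraType (past k))) => //.
- exact: past_setI.
- by rewrite setTI PXB [X in (X * _)%E](probability_setT P) mul1e.
- move=> _ [C mC ->].
  have := @iid_bigcap k C mC => ->.
  (* Intersecting with the event on [X k] gives a cylinder set over [k.+1] variables. *)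
  pose D j := if (j < k)%N then C j else B.
  have mD j : measurable (D j) by rewrite /D; case: ifP.
  have := @iid_bigcap k.+1 D mD.
  have -> : \bigcap_(j in `I_k.+1) (X j @^-1` D j) =
    \bigcap_(j in `I_k) (X j @^-1` C j) `&` X k @^-1` B.
    apply/seteqP; split => [t h|t [h1 h2] j /=].
      split; last by have := h k (ltnSn k); rewrite /D /= ltnn.
      by move=> j /= jk; have := h j (ltnW jk); rewrite /D /= jk.
    rewrite ltnS leq_eqVlt => /orP[/eqP ->|jk]; rewrite /D.
      by rewrite ltnn.
    by rewrite jk; exact: h1.
  move=> ->; rewrite big_ord_recr /= {2}/D ltnn; congr (_ * _)%E.
  by apply: eq_bigr => j _; rewrite /D ltn_ord.
- move=> S /past_measurable mS ih.
  rewrite setIC -setDE measureD//; last by rewrite ltey_eq fin_num_measure.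
  rewrite (setIC (X k @^-1` B) S) [X in (_ - X)%E]ih probability_setC//.
  rewrite [X in (X - _)%E]PXB muleBl ?mul1e// ?fin_num_measure//.
- move=> F mF tF ih.
  have mF' n : measurable (F n : set T) by apply: (@past_measurable k); exact: mF.
  rewrite setI_bigcupl [LHS]measure_bigcup//=; last 2 first.
  - by move=> n _; exact: measurableI.
  - apply/trivIsetP => i j _ _ ij; rewrite setIACA setIid.
    by move/trivIsetP : tF => /(_ i j I I ij) ->; rewrite set0I.
  rewrite [X in (X * _)%E]measure_bigcup//= muleC.
  rewrite -[X in (X * _)%E](fineK fB) -[RHS]nneseriesZl//.
  by apply: eq_eseriesr => n _; rewrite ih muleC fineK.
Qed.

Local Notation pastT k := (g_sigma_algebraType (past k)).

Let pastX k (t : T) : pastT k * T' := (t, X k t).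

Let mpast k : measurable_fun setT (id : T -> pastT k).
Proof. by move=> _ A mA; rewrite setTI; exact: past_measurable mA. Qed.

Let mpastX k : measurable_fun setT (pastX k).
Proof. by apply/measurable_fun_pairP; split; [exact: mpast|exact: measurable_funP]. Qed.

(** Integration over [X k] with the past frozen. The pair of the past and [X k] has a product law,
    since [past_indep] gives it the right values on rectangles; Fubini's theorem does the rest. *)
Lemma past_Rintegral k (F : pastT k * T' -> R) : measurable_fun setT F ->
  (exists M : R, forall z, `|F z| <= M) ->
  \int[P]_t F (t, X k t) = \int[P]_t \int[nu]_y F (t, y).
Proof.
move=> mF bF.
(* The law of the identity, seen as a map into the coarser space, is [P] restricted to the past. *)
pose idRV : {RV P >-> pastT k} := HB.pack (id : T -> pastT k)
  (isMeasurableFun.Build _ _ _ _ _ (@mpast k)).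
pose P0 : probability (pastT k) R := distribution P idRV.
have lawid : has_law P (id : T -> pastT k) P0 by [].
have lawX : has_law P (pastX k) (P0 \x nu)%E.
  pose Q : {measure set (pastT k * T') -> \bar R} := pushforward P (pastX k).
  move=> A mA; rewrite (product_measure_unique (m' := Q (@mpastX k)))// => B C mB mC.
  exact: (past_indep mB mC).
rewrite (Rintegral_law (@mpastX k) lawX mF).
rewrite -Rfubini1//.
by rewrite -(Rintegral_law (@mpast k) lawid (measurable_Rintegral2 P0 nu mF bF)).
Qed.

End independence.

(** * Sums of independent identically distributed variables *)

Lemma sumr_measurable {R : realType} {d : measure_display} {T : measurableType d}
    {J : Type} (s : seq J) (Q : pred J) (f : J -> T -> R) :
  (forall j, measurable_fun setT (f j)) ->
  measurable_fun setT (fun t => \sum_(j <- s | Q j) f j t).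
Proof.
move=> mf; elim: s => [|j s ih].
  by under eq_fun do rewrite big_nil; exact: measurable_cst.
under eq_fun do rewrite big_cons; case: (Q j) => //.
exact: measurable_funD.
Qed.

Section partial_sums.
Context {R : realType} {d d' : measure_display}.
Context {T : measurableType d} {T' : measurableType d'}.
Variables (P : probability T R) (nu : probability T' R).
Variable X : nat -> {RV P >-> T'}.
Hypothesis iidX : iid_with_law nu X.
Variables (I : Type) (h : T' -> I -> R).
Hypothesis mh : forall i, measurable_fun setT (h ^~ i).

Definition partial_sum (k : nat) (t : T) (i : I) : R := \sum_(j < k) h (X j t) i.

Lemma partial_sumS k t i : partial_sum k.+1 t i = partial_sum k t i + h (X k t) i.
Proof. by rewrite /partial_sum big_ord_recr. Qed.

Lemma measurable_partial_sum k i : measurable_fun setT (fun t => partial_sum k t i).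
Proof.
apply: sumr_measurable => j.
by apply: (@measurableT_comp _ _ _ _ _ _ (h ^~ i)).
Qed.

Lemma measurable_past_sum k i :
  measurable_fun setT (fun t : g_sigma_algebraType (past X k) => partial_sum k t i).
Proof.
apply: sumr_measurable => j.
apply: (@measurableT_comp _ _ _ _ _ _ (h ^~ i)) => //.
move=> _ B mB; rewrite setTI; apply: sub_sigma_algebra.
(* An event on [X j] alone is a cylinder set with no constraint on the other variables. *)
exists (fun l => if l == j :> nat then B else setT).
  by move=> l; case: ifP.
apply/seteqP; split => [t Xt l _|t /(_ j (ltn_ord j))]; last by rewrite /= eqxx.
by case: eqP => [->|_].
Qed.

(** The measurability hypothesis ranges over all spaces [T0] because it is used for [T] with the
    sigma-algebra of the past, while [I -> R] carries no sigma-algebra. *)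
Lemma partial_sum_step k (Psi : (I -> R) -> T' -> R) :
  (forall d0 (T0 : measurableType d0) (c : T0 -> I -> R),
    (forall i, measurable_fun setT (c ^~ i)) ->
    measurable_fun setT (fun z : T0 * T' => Psi (c z.1) z.2)) ->
  (exists M : R, forall t y, `|Psi (partial_sum k t) y| <= M) ->
  \int[P]_t Psi (partial_sum k t) (X k t) =
  \int[P]_t \int[nu]_y Psi (partial_sum k t) y.
Proof.
move=> mPsi [M PsiM].
apply: (past_Rintegral iidX (F := fun z => Psi (partial_sum k z.1) z.2)).
  by apply: (mPsi _ (g_sigma_algebraType (past X k)) (partial_sum k)) => i; exact: measurable_past_sum.
by exists M => -[t y]; exact: PsiM.
Qed.

End partial_sums.

(** * Exponential moments and tails of bounded centred sums *)

Section exponential_bounds.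
Context {R : realType}.
Implicit Types x : R.

(** Compare (1 - x) e^x <= 1 with (1 - x)(1 + x + 2x^2) = 1 + x^2 (1 - 2x) >= 1. *)
Lemma expR_le_quad x : `|x| <= 2^-1 -> expR x <= 1 + x + 2 * x ^+ 2.
Proof.
move=> /ler_normlP [xl xr].
have h := expR_ge1Dx (- x).
have e0 := expR_gt0 x.
have : (1 - x) * expR x <= 1.
  by rewrite -[leRHS](expRxMexpNx_1 x) mulrC ler_pM2l.
nra.
Qed.

Lemma sqr_le_expR x : x ^+ 2 <= 4 * (expR x + expR (- x)).
Proof.
have key (y : R) : 0 <= y -> y ^+ 2 <= 4 * expR y.
  move=> y0; have -> : expR y = expR (y / 2) ^+ 2 by rewrite -expRM_natl; congr expR; field.
  have := expR_ge1Dx (y / 2); have := expR_gt0 (y / 2); nra.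
have := expR_gt0 x; have := expR_gt0 (- x); have [x0|x0] := leP 0 x.
  have := key x x0; lra.
by have := key (- x); rewrite sqrrN; lra.
Qed.

End exponential_bounds.

Section exponential_moment.
Context {R : realType} {d d' : measure_display}.
Context {T : measurableType d} {T' : measurableType d'}.
Variables (P : probability T R) (nu : probability T' R).
Variable X : nat -> {RV P >-> T'}.
Hypothesis iidX : iid_with_law nu X.
Variables (h : T' -> R) (B : R).
Hypothesis mh : measurable_fun setT h.
Hypothesis hB : forall y, `|h y| <= B.
Hypothesis h0 : \int[nu]_y h y = 0.

Let S n t := \sum_(j < n) h (X j t).

Let mS n : measurable_fun setT (S n).
Proof.
by apply: sumr_measurable => j; apply: measurableT_comp.
Qed.

Let SB n t : `|S n t| <= n%:R * B.
Proof.
apply: le_trans (ler_norm_sum _ _ _) _.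
by apply: le_trans (ler_sum _ (fun i _ => hB _)) _; rewrite sumr_const card_ord mulr_natl.
Qed.

Let ieS n l : P.-integrable setT (EFin \o (fun t => expR (l * S n t))).
Proof.
apply: bounded_integrable.
  by apply: measurableT_comp => //; exact: measurable_funM.
exists (expR (`|l| * (n%:R * B))) => t; rewrite ger0_norm ?expR_ge0// ler_expR.
apply: le_trans (ler_norm _) _; rewrite normrM ler_wpM2l//.
Qed.

(** Each independent factor has mean at most 1 + 2(lB)^2: the linear term of [expR_le_quad]
    integrates to zero by centring. *)
Lemma exp_moment n l : `|l| * B <= 2^-1 ->
  \int[P]_t expR (l * S n t) <= expR (n%:R * (2 * (l * B) ^+ 2)).
Proof.
move=> lB; elim: n => [|n ih].
  under eq_Rintegral do rewrite /S big_ord0 mulr0 expR0.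
  by rewrite Rintegral_cst1 mul0r expR0.
pose Psi (s : unit -> R) y := expR (l * s tt) * expR (l * h y).
have mexp d0 (T0 : measurableType d0) (g : T0 -> R) : measurable_fun setT g ->
    measurable_fun setT (fun t => expR (l * g t)).
  by move=> mg; apply: measurableT_comp => //; exact: measurable_funM.
have ilh : nu.-integrable setT (EFin \o (fun y => expR (l * h y))).
  apply: bounded_integrable; first exact: mexp.
  exists (expR (2^-1)) => y; rewrite ger0_norm ?expR_ge0// ler_expR.
  apply: le_trans (ler_norm _) _; rewrite normrM; apply: le_trans lB.
  by rewrite ler_wpM2l.
have ih1 : nu.-integrable setT (EFin \o h) by apply: bounded_integrable => //; exists B.
have ih2 : nu.-integrable setT (EFin \o (fun=> 1 + 2 * (l * B) ^+ 2)).
  by apply: bounded_integrable; [exact: measurable_cst|exists `|1 + 2 * (l * B) ^+ 2|].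
have step : \int[nu]_y expR (l * h y) <= expR (2 * (l * B) ^+ 2).
  have ih3 : nu.-integrable setT (EFin \o (fun y => l * h y)).
    apply: bounded_integrable; first exact: measurable_funM.
    by exists (`|l| * B) => y; rewrite normrM ler_wpM2l.
  apply: (@le_trans _ _ (\int[nu]_y ((1 + 2 * (l * B) ^+ 2) + l * h y))).
    apply: le_Rintegral => //; first exact: (integrableD measurableT ih2 ih3).
    move=> y _; apply: (@le_trans _ _ (1 + l * h y + 2 * (l * h y) ^+ 2)).
      apply: expR_le_quad; rewrite normrM; apply: le_trans lB.
      by rewrite ler_wpM2l.
    have : (l * h y) ^+ 2 <= (l * B) ^+ 2.
      rewrite !exprMn ler_wpM2l ?sqr_ge0//.
      by have := hB y => /ler_normlP [? ?]; nra.
    lra.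
  rewrite RintegralD// Rintegral_cst1 RintegralZ// h0 mulr0 addr0.
  exact: expR_ge1Dx.
have -> : \int[P]_t expR (l * S n.+1 t) = \int[P]_t Psi (fun=> S n t) (X n t).
  by apply: eq_Rintegral => t _; rewrite /Psi -expRD -mulrDr /S big_ord_recr.
rewrite (partial_sum_step iidX (h := fun y (_ : unit) => h y) (fun=> mh) (k := n) (Psi := Psi)).
- apply: (@le_trans _ _ (\int[P]_t (expR (2 * (l * B) ^+ 2) * expR (l * S n t)))).
    have E t : \int[nu]_y Psi (fun=> S n t) y = (\int[nu]_y expR (l * h y)) * expR (l * S n t).
      by rewrite RintegralZ// mulrC.
    under eq_Rintegral do rewrite E.
    apply: le_Rintegral => //.
    - exact: (integrableZl measurableT _ (ieS n l)).
    - exact: (integrableZl measurableT _ (ieS n l)).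
    - by move=> t _; rewrite ler_pM2r ?expR_gt0.
  have -> : n.+1%:R * (2 * (l * B) ^+ 2) =
      2 * (l * B) ^+ 2 + n%:R * (2 * (l * B) ^+ 2) by rewrite -natr1; ring.
  by rewrite RintegralZ// expRD ler_pM2l ?expR_gt0.
- move=> d0 T0 c mc; apply: measurable_funM.
    by apply: mexp; apply: (measurableT_comp (mc tt)).
  by apply: mexp; apply: (measurableT_comp mh).
- exists (expR (`|l| * (n%:R * B)) * expR (2^-1)) => t y.
  rewrite normrM ler_pM// ger0_norm ?expR_ge0// ler_expR.
    apply: le_trans (ler_norm _) _; rewrite normrM ler_wpM2l//.
    exact: SB.
  apply: le_trans (ler_norm _) _; rewrite normrM; apply: le_trans lB.
  by rewrite ler_wpM2l.
Qed.

(** Chernoff's bound. The last hypothesis makes the cost 2 n (lB)^2 of the exponential moment at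
    most half of the gain l e n. *)
Lemma sum_tail (n : nat) (e l : R) : 0 < l -> l * B <= 2^-1 -> 0 < e -> 4 * l * B ^+ 2 <= e ->
  (P [set t | (e * n%:R <= S n t)%R] <= (expR (- (l * e / 2 * n%:R)))%:E)%E.
Proof.
move=> l0 lB e0 le.
have B0 : 0 <= B by exact: le_trans (hB point).
have mA : measurable [set t | e * n%:R <= S n t].
  rewrite -[X in measurable X]setTI.
  rewrite (_ : [set t | _] = S n @^-1` [set` `[e * n%:R, +oo[%R]).
    by apply: (mS n) => //; exact: measurable_itv.
  by apply/seteqP; split => t /=; rewrite in_itv /= andbT.
pose A := [set t | e * n%:R <= S n t].
rewrite -(expectation_indic P mA) unlock -EFin_Rintegral; last first.
  by apply: bounded_integrable => //; exists 1 => t; rewrite indicE; case: (_ \in _) => /=; rewrite ?normr1 ?normr0.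
rewrite lee_fin.
apply: (@le_trans _ _ (\int[P]_t (expR (- (l * (e * n%:R))) * expR (l * S n t)))).
  apply: le_Rintegral => //.
  - by apply: bounded_integrable => //; exists 1 => t; rewrite indicE; case: (_ \in _) => /=; rewrite ?normr1 ?normr0.
  - exact: (integrableZl measurableT _ (ieS n l)).
  - move=> t _; rewrite indicE; case: (boolP (t \in _)) => [|_] /=.
      rewrite inE /= => St; rewrite -expRD -[leLHS]expR0 ler_expR.
      by rewrite addrC subr_ge0 ler_wpM2l// ltW.
    by rewrite mulr_ge0 ?expR_ge0.
rewrite RintegralZ//; apply: (@le_trans _ _ (expR (- (l * (e * n%:R))) * expR (n%:R * (2 * (l * B) ^+ 2)))).
  rewrite ler_pM2l ?expR_gt0//; apply: exp_moment.
  by rewrite gtr0_norm.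
rewrite -expRD ler_expR.
have n0 : 0 <= n%:R :> R by [].
have : 4 * l * B ^+ 2 * (l * n%:R) <= e * (l * n%:R) by rewrite ler_wpM2r// mulr_ge0// ltW.
nra.
Qed.

(** A bound uniform in [n] is all that is needed, so the exponential moments at l = n^(-1/2) and -l
    are reused: the exponent 2 n (lB)^2 is then 2 B^2, and the hypothesis says lB <= 1/2. *)
Lemma sum_sqr_moment n : n%:R^-1 * B ^+ 2 <= 4^-1 ->
  \int[P]_t (n%:R^-1 * (S n t) ^+ 2) <= 8 * expR (2 * B ^+ 2).
Proof.
have B0 : 0 <= B by exact: le_trans (hB point).
case: n => [|n] nB.
  (* For n = 0 the integrand vanishes by the convention 0^-1 = 0. *)
  by under eq_Rintegral do rewrite invr0 mul0r; rewrite Rintegral_cst1 mulr_ge0 ?expR_ge0.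
pose l : R := (Num.sqrt n.+1%:R)^-1.
have l0 : 0 < l by rewrite invr_gt0 sqrtr_gt0 ltr0n.
have l2 : l ^+ 2 = n.+1%:R^-1 by rewrite exprVn sqr_sqrtr ?ler0n.
have lB : l * B <= 2^-1.
  have : (l * B) ^+ 2 <= 4^-1 by rewrite exprMn l2.
  have : 0 <= l * B by rewrite mulr_ge0// ltW.
  nra.
have E : n.+1%:R * (2 * (l * B) ^+ 2) = 2 * B ^+ 2.
  by rewrite exprMn l2 mulrCA mulVKf// pnatr_eq0.
have i1 := ieS n.+1 l; have i2 := ieS n.+1 (- l).
apply: (@le_trans _ _ (\int[P]_t (4 * (expR (l * S n.+1 t) + expR (- l * S n.+1 t))))).
  apply: le_Rintegral => //.
  - apply: bounded_integrable.
      by apply: measurable_funM => //; exact: measurable_funX.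
    exists (n.+1%:R^-1 * (n.+1%:R * B) ^+ 2) => t; rewrite normrM ger0_norm ?invr_ge0//.
    rewrite ler_wpM2l ?invr_ge0// normrX lerXn2r ?nnegrE ?normr_ge0//.
      by rewrite mulr_ge0.
  - exact: (integrableZl measurableT 4 (integrableD measurableT i1 i2)).
  - by move=> t _; rewrite -l2 -exprMn mulNr; exact: sqr_le_expR.
rewrite RintegralZ; last exact: (integrableD measurableT i1 i2).
rewrite RintegralD//.
have := @exp_moment n.+1 l; rewrite gtr0_norm// => /(_ lB).
have := @exp_moment n.+1 (- l); rewrite normrN gtr0_norm// => /(_ lB).
rewrite mulNr sqrrN E; lra.
Qed.

End exponential_moment.

(** * Gaussian vectors *)

Section affine_substitution.
Context {R : realType}.
Local Notation leb := (@lebesgue_measure R).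

Let aff (c b : R) : measurableTypeR R -> measurableTypeR R := fun x => c * x + b.

Let maff c b : measurable_fun setT (aff c b).
Proof. by apply: measurable_funD => //; exact: measurable_funM. Qed.

Lemma lebesgue_measure_affine (c b : R) (A : set R) : 0 < c -> measurable A ->
  leb A = (c%:E * leb ((fun x => (c * x + b)%R) @^-1` A))%E.
Proof.
move=> c0 mA; pose nc : {nonneg R} := NngNum (ltW c0).
pose Q : {measure set (measurableTypeR R) -> \bar R} := pushforward leb (aff c b).
apply: (@lebesgue_measure_unique R (mscale nc (Q (maff c b)))) => //.
move=> _ [[a1 a2] _ <-]; pose J : set R := `](a1 - b) / c, (a2 - b) / c]%classic.
have E : (fun x => c * x + b) @^-1` `]a1, a2] = J.
  apply/seteqP; split => x /=; rewrite /J /= !in_itv /= ltr_pdivrMr// ler_pdivlMr//.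
    by rewrite ltrBlDr lerBrDr mulrC.
  by rewrite ltrBlDr lerBrDr mulrC.
transitivity (c%:E * leb J)%E; last by rewrite -E.
rewrite /J !lebesgue_measure_itv /= !lte_fin ltr_pM2r ?invr_gt0// ltrD2r.
case: ifP => _; last by rewrite mule0.
rewrite -!EFinD -EFinM -mulNr -mulrDl mulrC divfK ?gt_eqF//; congr EFin; ring.
Qed.

Lemma ge0_integral_affine (c b : R) (f : R -> \bar R) : 0 < c ->
  measurable_fun setT f -> (forall x, 0 <= f x)%E ->
  (\int[leb]_x f x = c%:E * \int[leb]_x f (c * x + b)%R)%E.
Proof.
move=> c0 mf f0; pose nc : {nonneg R} := NngNum (ltW c0).
pose Q : {measure set (measurableTypeR R) -> \bar R} := pushforward leb (aff c b).
transitivity (\int[mscale nc (Q (maff c b))]_x f x)%E.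
  by apply: eq_measure_integral => A mA _; exact: (lebesgue_measure_affine b c0 mA).
rewrite ge0_integral_mscale//; congr (_ * _)%E.
by rewrite (ge0_integral_pushforward (maff c b)).
Qed.

End affine_substitution.

Section normal_density_integral.
Context {R : realType}.
Local Notation leb := (@lebesgue_measure R).
Implicit Types f : R -> \bar R.

(** Change of variables is available for the Radon-Nikodym derivative, which agrees almost
    everywhere with the density since both have the same integral over every measurable set. *)
Lemma ge0_integral_normal_prob (m s : R) f : measurable_fun setT f ->
  (forall x, 0 <= f x)%E ->
  (\int[normal_prob m s]_x f x = \int[leb]_x (f x * (normal_pdf m s x)%:E))%E.
Proof.
move=> mf f0; have dom := normal_prob_dominates m s.
rewrite -(Radon_Nikodym_SigmaFinite.change_of_variables dom)//=.
apply: ae_eq_integral => //.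
- apply: emeasurable_funM => //; apply: (measurable_int leb).
  exact: Radon_Nikodym_SigmaFinite.f_integrable.
- apply: emeasurable_funM => //; apply/measurable_EFinP.
  exact: measurable_normal_pdf.
- apply: ae_eqe_mul2l; apply: integral_ae_eq => //.
  + exact: Radon_Nikodym_SigmaFinite.f_integrable.
  + by apply/measurable_EFinP; exact: measurable_normal_pdf.
  + by move=> E _ mE; rewrite -Radon_Nikodym_SigmaFinite.f_integral.
Qed.

End normal_density_integral.

(** The parameter is the variance, so that convolution adds parameters. *)
HB.lock Definition gaussian_density {R : realType} (v x : R) : R :=
  (Num.sqrt (v * pi *+ 2))^-1 * expR (- x ^+ 2 / (v *+ 2)).
Canonical gaussian_density_unlockable := Unlockable gaussian_density.unlock.

(* normal_prob 0 0 is not the point mass at 0, hence the case distinction. *)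
HB.lock Definition gaussian {R : realType} (v : R) :
    probability (measurableTypeR R) R :=
  if v == 0 then (dirac (0 : measurableTypeR R) : probability _ R)
  else (normal_prob 0 (Num.sqrt v) : probability _ R).
Canonical gaussian_unlockable := Unlockable gaussian.unlock.

Section centered_gaussian.
Context {R : realType}.
Local Notation leb := (@lebesgue_measure R).
Implicit Types (f : R -> \bar R) (v w z c : R).

Lemma gaussian0 : gaussian 0 = (dirac (0 : measurableTypeR R) : probability _ R).
Proof. by rewrite unlock eqxx. Qed.

Lemma gaussianE v : v != 0 -> gaussian v = (normal_prob 0 (Num.sqrt v) : probability _ R).
Proof. by move=> v0; rewrite unlock (negbTE v0). Qed.

Lemma gaussian_densityE v x :
  gaussian_density v x = (Num.sqrt (v * pi *+ 2))^-1 * expR (- x ^+ 2 / (v *+ 2)).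
Proof. by rewrite unlock. Qed.

Lemma gaussian_density_ge0 v x : 0 <= gaussian_density v x.
Proof. by rewrite unlock mulr_ge0 ?expR_ge0// invr_ge0. Qed.

Lemma measurable_gaussian_density v : measurable_fun setT (gaussian_density v).
Proof.
rewrite unlock; apply: measurable_funM => //; apply: measurableT_comp => //.
by apply: measurable_funM => //; apply: measurableT_comp.
Qed.

Let mdens : forall v, measurable_fun setT (gaussian_density v) := measurable_gaussian_density.

Let dens_ge0 : forall v x, 0 <= gaussian_density v x := gaussian_density_ge0.

Let sqrt_neq0 v : 0 < v -> Num.sqrt v != 0.
Proof. by move=> v0; rewrite gt_eqF// sqrtr_gt0. Qed.

Lemma ge0_integral_gaussian v f : 0 < v -> measurable_fun setT f ->
  (forall x, 0 <= f x)%E ->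
  (\int[gaussian v]_x f x =
   \int[leb]_x (f x * (gaussian_density v x)%:E))%E.
Proof.
move=> v0 mf f0; rewrite gaussianE ?gt_eqF// ge0_integral_normal_prob//.
apply: eq_integral => x _; rewrite normal_pdfE ?sqrt_neq0// !gaussian_densityE.
by rewrite /normal_fun /normal_peak sqr_sqrtr ?ltW// subr0.
Qed.

Lemma ge0_integral_gaussian0 f : measurable_fun setT f ->
  (\int[gaussian 0]_x f x)%E = f 0.
Proof. by move=> mf; rewrite gaussian0 integral_dirac// diracT mul1e. Qed.

Lemma gaussian_density_total v c : 0 < v ->
  (\int[leb]_x (gaussian_density v (x - c))%:E = 1)%E.
Proof.
move=> v0; rewrite -(integral_normal_pdf c (Num.sqrt v)).
apply: eq_integral => x _; rewrite normal_pdfE ?sqrt_neq0// !gaussian_densityE.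
by rewrite /normal_fun /normal_peak sqr_sqrtr ?ltW.
Qed.

Lemma ge0_integral_gaussianN v f : 0 <= v -> measurable_fun setT f ->
  (forall x, 0 <= f x)%E ->
  (\int[gaussian v]_x f (- x)%R = \int[gaussian v]_x f x)%E.
Proof.
move=> v0 mf f0; have mfN : measurable_fun setT (fun x : R => f (- x)%R).
  by apply: measurableT_comp.
have [->|vn0] := eqVneq v 0; first by rewrite !ge0_integral_gaussian0// oppr0.
have {}v0 : 0 < v by rewrite lt_def vn0.
rewrite !ge0_integral_gaussian//.
pose k (x : R) := (f x * (gaussian_density v x)%:E)%E.
have mk : measurable_fun setT k.
  by apply: emeasurable_funM => //; exact/measurable_EFinP.
have mN : measurable_fun setT (-%R : measurableTypeR R -> measurableTypeR R) by [].
transitivity (\int[leb]_x k (- x)%R)%E.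
  by apply: eq_integral => x _; rewrite /k !gaussian_densityE sqrrN.
transitivity (\int[pushforward leb (-%R : measurableTypeR R -> measurableTypeR R)]_x k x)%E.
  rewrite (ge0_integral_pushforward mN)// => x _.
  by rewrite mule_ge0// lee_fin.
by apply: eq_measure_integral => A mA _; exact: lebesgue_measureN.
Qed.

Lemma ge0_integral_gaussian_scale v c f : 0 <= v -> measurable_fun setT f ->
  (forall x, 0 <= f x)%E ->
  (\int[gaussian v]_x f (c * x)%R = \int[gaussian (c ^+ 2 * v)]_x f x)%E.
Proof.
move=> v0 mf f0.
have mfc b : measurable_fun setT (fun x : R => f (b * x)%R).
  by apply: measurableT_comp => //; exact: measurable_funM.
(* Symmetry of the centred law allows [c] to be replaced by [- c]. *)
wlog c0 : c / 0 <= c => [h|].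
  have [c0|c0] := leP 0 c; first exact: h.
  have cN0 : 0 <= - c by rewrite oppr_ge0 ltW.
  have E := h (- c) cN0; rewrite [X in gaussian (X * _)]sqrrN in E; apply: etrans E.
  rewrite -(ge0_integral_gaussianN v0 (mfc (- c)))//.
  by apply: eq_integral => x _; rewrite mulrNN.
have [->|vn0] := eqVneq v 0.
  by rewrite mulr0 !ge0_integral_gaussian0// mulr0.
have {}v0 : 0 < v by rewrite lt_def vn0.
have [->|cn0] := eqVneq c 0.
  have -> : 0 ^+ 2 * v = 0 by rewrite expr0n mul0r.
  rewrite [RHS]ge0_integral_gaussian0//.
  under eq_integral do rewrite mul0r.
  by rewrite integral_cst// [X in (_ * X)%E](probability_setT (gaussian v)) mule1.
have {}c0 : 0 < c by rewrite lt_def cn0.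
have cv0 : 0 < c ^+ 2 * v by rewrite mulr_gt0// exprn_gt0.
rewrite [LHS]ge0_integral_gaussian//.
rewrite [RHS](ge0_integral_gaussian cv0 mf f0).
rewrite [RHS](ge0_integral_affine 0 c0); last 2 first.
- by apply: emeasurable_funM => //; exact/measurable_EFinP.
- by move=> x; rewrite mule_ge0// lee_fin.
rewrite -ge0_integralZl//; last 3 first.
- have maff : measurable_fun setT (fun x : R => c * x + 0).
    by apply: measurable_funD => //; exact: measurable_funM.
  apply: emeasurable_funM; first by apply: (measurableT_comp mf).
  by apply/measurable_EFinP; apply: (measurableT_comp (measurable_gaussian_density _)).
- by move=> x _; rewrite mule_ge0// lee_fin.
- by rewrite lee_fin ltW.
apply: eq_integral => x _; rewrite addr0 muleCA -EFinM; congr (_ * _%:E)%E.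
rewrite !gaussian_densityE mulrA; congr (_ * expR _).
  rewrite -!mulrnAr -[in RHS]mulrA [X in c / X]sqrtrM ?exprn_ge0 ?ltW//.
  by rewrite sqrtr_sqr gtr0_norm// invfM mulVKf// gt_eqF.
by field; rewrite vn0 cn0.
Qed.

(** Completing the square in [z]: the joint density of a sum [u] and its summand [z] is the density
    of [u] times the conditional density of [z], which has mean w u / (v + w) and variance v w / (v
    + w). *)
Lemma gaussian_density_conv v w (u z : R) : 0 < v -> 0 < w ->
  gaussian_density v (u - z) * gaussian_density w z =
  gaussian_density (v + w) u * gaussian_density (v * w / (v + w)) (z - w / (v + w) * u).
Proof.
move=> v0 w0; have s0 : 0 < v + w by rewrite addr_gt0.
have p0 := @pi_gt0 R.
rewrite !gaussian_densityE mulrACA [RHS]mulrACA -!expRD -!invfM -!sqrtrM; last 2 first.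
- by rewrite mulrn_wge0// mulr_ge0 ?ltW.
- by rewrite mulrn_wge0// mulr_ge0 ?ltW.
congr ((Num.sqrt _)^-1 * expR _).
  by field; rewrite gt_eqF.
by field; rewrite ?gt_eqF// !mulf_neq0 ?gt_eqF.
Qed.

(** After the substitution u = y + z and an exchange of integrals, the conditional density of [z]
    integrates to 1. Zero variances are point masses and are treated apart. *)
Lemma ge0_integral_gaussian_conv v w f : 0 <= v -> 0 <= w ->
  measurable_fun setT f -> (forall x, 0 <= f x)%E ->
  (\int[gaussian w]_z \int[gaussian v]_y f (y + z)%R = \int[gaussian (v + w)]_x f x)%E.
Proof.
move=> v0 w0 mf f0.
have mfz (z : R) : measurable_fun setT (fun y : R => f (y + z)%R).
  by apply: (measurableT_comp mf); exact: measurable_funD.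
have mF : measurable_fun setT (fun q : measurableTypeR R * measurableTypeR R => f (q.2 + q.1)%R).
  by apply: (measurableT_comp mf); exact: measurable_funD.
have [->|vn0] := eqVneq v 0.
  by rewrite add0r; under eq_integral do rewrite ge0_integral_gaussian0// add0r.
have {}v0 : 0 < v by rewrite lt_def vn0.
have mG : measurable_fun setT (fun z : R => \int[gaussian v]_y f (y + z)%R)%E.
  exact: (measurable_fun_fubini_tonelli_F _ mF (fun=> f0 _)).
have [->|wn0] := eqVneq w 0.
  rewrite addr0 [LHS](ge0_integral_gaussian0 mG).
  by under eq_integral do rewrite addr0.
have {}w0 : 0 < w by rewrite lt_def wn0.
have s0 : 0 < v + w by rewrite addr_gt0.
have G0 z : (0 <= \int[gaussian v]_y f (y + z)%R)%E by exact: integral_ge0.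
rewrite [LHS](ge0_integral_gaussian w0 mG G0).
pose H (q : measurableTypeR R * measurableTypeR R) := (f q.2 * (gaussian_density v (q.2 - q.1) * gaussian_density w q.1)%:E)%E.
have mH : measurable_fun setT H.
  apply: emeasurable_funM; first exact: (measurableT_comp mf).
  apply/measurable_EFinP/measurable_funM; last exact: (measurableT_comp (measurable_gaussian_density _)).
  by apply: (measurableT_comp (measurable_gaussian_density _)); exact: measurable_funB.
have H0 q : (0 <= H q)%E by rewrite mule_ge0// lee_fin mulr_ge0.
transitivity (\int[leb]_z \int[leb]_u H (z, u))%E.
  apply: eq_integral => z _.
  rewrite (ge0_integral_gaussian v0 (mfz z) (fun=> f0 _)).
  rewrite -[LHS]ge0_integralZr//; last 3 first.
  - apply: emeasurable_funM; first exact: mfz.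
    by apply/measurable_EFinP; exact: mdens.
  - by move=> y _; rewrite mule_ge0// lee_fin.
  - by rewrite lee_fin.
  rewrite [RHS](ge0_integral_affine z ltr01)//; last exact: (measurableT_comp mH).
  rewrite mul1e; apply: eq_integral => y _.
  by rewrite /H /= mul1r addrK EFinM muleA.
rewrite (fubini_tonelli _ mH H0) [RHS](ge0_integral_gaussian s0 mf f0).
apply: eq_integral => u _; rewrite /H /=.
under eq_integral do rewrite gaussian_density_conv// EFinM muleA.
rewrite ge0_integralZl//.
- by rewrite gaussian_density_total ?mule1// divr_gt0// mulr_gt0.
- apply/measurable_EFinP; apply: (measurableT_comp (measurable_gaussian_density _)).
  exact: measurable_funB.
- by move=> z _; rewrite lee_fin.
- by rewrite mule_ge0// lee_fin.
Qed.

End centered_gaussian.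

Section standard_gaussian_moments.
Context {R : realType}.
Local Notation leb := (@lebesgue_measure R).
Local Notation gam := (@gaussian R 1).

Let gaussian1E (f : R -> \bar R) : measurable_fun setT f -> (forall x, 0 <= f x)%E ->
  (\int[gam]_x f x = \int[leb]_x (f x * (gaussian_density 1 x)%:E))%E.
Proof. by move=> mf f0; rewrite ge0_integral_gaussian. Qed.

Let density_shift (v c : R) : 0 < v ->
  (\int[leb]_x (gaussian_density v (x - c))%:E = 1)%E.
Proof. exact: gaussian_density_total. Qed.

Let density_shiftZ (k v c : R) : 0 <= k -> 0 < v ->
  (\int[leb]_x (k%:E * (gaussian_density v (x - c))%:E) = k%:E)%E.
Proof.
move=> k0 v0.
have mf : measurable_fun setT (fun x : R => (gaussian_density v (x - c))%:E).
  apply/measurable_EFinP; apply: (measurableT_comp (measurable_gaussian_density _)).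
  exact: measurable_funB.
have f0 (x : R) : setT x -> (0 <= (gaussian_density v (x - c))%:E)%E.
  by move=> _; rewrite lee_fin gaussian_density_ge0.
by rewrite (ge0_integralZl leb measurableT mf f0)// density_shift// mule1.
Qed.

Lemma gaussian_mgf (a : R) :
  (\int[gam]_x (expR (a * x))%:E = (expR (a ^+ 2 / 2))%:E)%E.
Proof.
have mf : measurable_fun setT (fun x : R => (expR (a * x))%:E).
  by apply/measurable_EFinP; apply: measurableT_comp => //; exact: measurable_funM.
rewrite (gaussian1E mf (fun=> expR_ge0 _)).
transitivity (\int[leb]_x ((expR (a ^+ 2 / 2))%:E * (gaussian_density 1 (x - a))%:E))%E.
  apply: eq_integral => x _; rewrite -!EFinM; congr EFin.
  rewrite !gaussian_densityE mulrCA [RHS]mulrCA -!expRD; congr (_ * expR _).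
  by field.
by rewrite density_shiftZ// ?expR_ge0// invr_ge0 ltW.
Qed.

(** The integrand times the standard density is 1/u times the Gaussian density of variance 1/u^2.
    With [gaussian_mgf] it yields the first two moments from the inequality 1 + x <= e^x alone. *)
Lemma gaussian_expR_sqr (u : R) : 0 < u ->
  (\int[gam]_x (expR (- (u ^+ 2 - 1) * x ^+ 2 / 2))%:E = (u^-1)%:E)%E.
Proof.
move=> u0.
have mf : measurable_fun setT (fun x : R => (expR (- (u ^+ 2 - 1) * x ^+ 2 / 2))%:E).
  apply/measurable_EFinP; apply: measurableT_comp => //.
  by apply: measurable_funM => //; exact: measurable_funM.
rewrite (gaussian1E mf (fun=> expR_ge0 _)).
have v0 : 0 < (u ^+ 2)^-1 by rewrite invr_gt0 exprn_gt0.
transitivity (\int[leb]_x ((u^-1)%:E * (gaussian_density (u ^+ 2)^-1 (x - 0))%:E))%E.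
  apply: eq_integral => x _; rewrite -!EFinM subr0; congr EFin.
  rewrite !gaussian_densityE mulrCA -expRD [RHS]mulrA; congr (_ * expR _).
    rewrite mul1r -[in RHS]mulrnAr sqrtrM ?ltW// sqrtrV ?ltW ?exprn_gt0//.
    by rewrite sqrtr_sqr gtr0_norm// invfM invrK mulrA mulVf ?mul1r// gt_eqF.
  by field; rewrite gt_eqF.
by rewrite density_shiftZ// ?expR_ge0// invr_ge0 ltW.
Qed.

Let integrable_dom (f : R -> R) : measurable_fun setT f ->
  (exists C : R, forall x, `|f x| <= C * (expR x + expR (- x))) ->
  gam.-integrable setT (EFin \o f).
Proof.
move=> mf [C fC].
have ie a : gam.-integrable setT (EFin \o (fun x => expR (a * x))).
  apply/integrableP; split.
    apply/measurable_EFinP; apply: measurableT_comp => //; exact: measurable_funM.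
  under eq_integral do rewrite /= ger0_norm ?expR_ge0//.
  by rewrite gaussian_mgf ltry.
have i2 : gam.-integrable setT (EFin \o (fun x => C * (expR (1 * x) + expR (-1 * x)))).
  exact: (integrableZl measurableT C (integrableD measurableT (ie 1) (ie (-1)))).
apply: (le_integrable measurableT _ _ i2); first exact/measurable_EFinP.
move=> x _; rewrite /= lee_fin mul1r mulN1r.
exact: le_trans (fC x) (ler_norm _).
Qed.

(** For y >= 0, y^k <= (3 + y)^3 = 27 (1 + y/3)^3 <= 27 e^y. *)
Lemma abs_pow_le_expR (k : nat) (x : R) : (k < 4)%N ->
  `|x| ^+ k <= 27 * (expR x + expR (- x)).
Proof.
move=> k4.
have key (y : R) : 0 <= y -> y ^+ k <= 27 * expR y.
  move=> y0; have E : expR y = expR (y / 3) ^+ 3.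
    by rewrite -expRM_natl; congr expR; field.
  have h1 := expR_ge1Dx (y / 3).
  have h2 : (1 + y / 3) ^+ 3 <= expR y.
    by rewrite E lerXn2r// nnegrE; lra.
  apply: le_trans (_ : 27 * (1 + y / 3) ^+ 3 <= _); last by rewrite ler_wpM2l.
  case: k k4 => [|[|[|[|//]]]] _; rewrite !exprS expr0; nra.
have e1 := expR_gt0 x; have e2 := expR_gt0 (- x).
have [x0|x0] := leP 0 x.
  by have := key x x0; rewrite ger0_norm//; lra.
by have := key (- x); rewrite ltr0_norm// oppr_ge0 => /(_ (ltW x0)); lra.
Qed.

Lemma gaussian_integrable_pow (k : nat) : (k < 4)%N ->
  gam.-integrable setT (EFin \o (fun x => x ^+ k)).
Proof.
move=> k4; apply: integrable_dom => //.
by exists 27 => x; rewrite normrX; exact: abs_pow_le_expR.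
Qed.

Lemma gaussian_integrable_abs3 : gam.-integrable setT (EFin \o (fun x => `|x| ^+ 3)).
Proof.
apply: integrable_dom.
  by apply: measurable_funX; exact: normr_measurable.
by exists 27 => x; rewrite normrX normr_id; exact: (abs_pow_le_expR (k := 3)).
Qed.

(** Integrating 1 + a x <= e^(a x) gives a M <= e^(a^2/2) - 1 <= a^2 for |a| <= 1; a linear function
    of [a] below a^2 near 0 must vanish. *)
Lemma gaussian_mean : \int[gam]_x x = 0.
Proof.
have i1 : gam.-integrable setT (EFin \o (fun x => x)) by exact: (gaussian_integrable_pow (k := 1)).
set M := \int[gam]_x x.
have key a : a * M <= expR (a ^+ 2 / 2) - 1.
  have i2 : gam.-integrable setT (EFin \o (fun x => expR (a * x))).
    apply/integrableP; split.
      apply/measurable_EFinP; apply: measurableT_comp => //; exact: measurable_funM.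
    under eq_integral do rewrite /= ger0_norm ?expR_ge0//.
    by rewrite gaussian_mgf ltry.
  have i3 : gam.-integrable setT (EFin \o (fun x => a * x)) by exact: (integrableZl measurableT a i1).
  have ic : gam.-integrable setT (EFin \o (fun x : R => 1 : R)).
    by apply: bounded_integrable => //; exists `|1|.
  have : \int[gam]_x (1 + a * x) <= \int[gam]_x expR (a * x).
    apply: le_Rintegral => //; first exact: (integrableD measurableT ic i3).
    by move=> x _; exact: expR_ge1Dx.
  rewrite RintegralD// Rintegral_cst1 RintegralZ// [leRHS]/Rintegral gaussian_mgf /=.
  by rewrite -/M; lra.
have bound a : `|a| <= 1 -> a * M <= a ^+ 2.
  move=> /ler_normlP[a1 a2]; apply: le_trans (key a) _.
  have := @expR_le_quad R (a ^+ 2 / 2).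
  rewrite ger0_norm ?divr_ge0 ?sqr_ge0// => h.
  have : a ^+ 2 <= 1 by nra.
  move=> a21; have : a ^+ 2 / 2 <= 2^-1 by lra.
  move=> /h; have := sqr_ge0 a; nra.
apply/eqP; apply: contraT => M0.
have m0 : 0 < `|M| by rewrite normr_gt0.
(* With the sign of [M] and |a| <= |M|/2, the product a M is at least 2 a^2, contradicting the bound
   a^2. *)
pose a := Num.min 1 (`|M| / 2) * Num.sg M.
have aM : a * M = Num.min 1 (`|M| / 2) * `|M| by rewrite /a -mulrA -normrEsg.
have mp : 0 < Num.min 1 (`|M| / 2) by rewrite lt_min ltr01 divr_gt0.
have an : `|a| = Num.min 1 (`|M| / 2).
  by rewrite /a normrM normr_sg M0 mulr1 gtr0_norm.
have := bound a; rewrite an ge_min lexx => /(_ isT).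
rewrite aM -real_normK ?num_real// an.
have : Num.min 1 (`|M| / 2) <= `|M| / 2 by rewrite ge_min lexx orbT.
nra.
Qed.

(** Integrating 1 + c x^2 <= e^(c x^2) with c = -(u^2 - 1)/2 and cancelling the factor u - 1 gives u
    (u + 1) M <= 2 for u < 1 and >= 2 for u > 1. Values of [u] close to 1 force M = 1. *)
Lemma gaussian_second_moment : \int[gam]_x x ^+ 2 = 1.
Proof.
have i2 := gaussian_integrable_pow (k := 2) isT.
set M := \int[gam]_x x ^+ 2.
have key u : 0 < u -> 1 - (u ^+ 2 - 1) / 2 * M <= u^-1.
  move=> u0; pose c := - (u ^+ 2 - 1) / 2.
  have ie : gam.-integrable setT (EFin \o (fun x => expR (- (u ^+ 2 - 1) * x ^+ 2 / 2))).
    apply/integrableP; split.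
      apply/measurable_EFinP; apply: measurableT_comp => //.
      by apply: measurable_funM => //; exact: measurable_funM.
    under eq_integral do rewrite /= ger0_norm ?expR_ge0//.
    by rewrite gaussian_expR_sqr// ltry.
  have i3 : gam.-integrable setT (EFin \o (fun x => c * x ^+ 2)) by exact: (integrableZl measurableT c i2).
  have ic : gam.-integrable setT (EFin \o (fun x : R => 1 : R)).
    by apply: bounded_integrable => //; exists `|1|.
  have : \int[gam]_x (1 + c * x ^+ 2) <= \int[gam]_x expR (- (u ^+ 2 - 1) * x ^+ 2 / 2).
    apply: le_Rintegral => //; first exact: (integrableD measurableT ic i3).
    move=> x _; apply: le_trans (expR_ge1Dx _); rewrite lerD2l /c.
    by rewrite le_eqVlt; apply/orP; left; apply/eqP; ring.
  rewrite RintegralD// Rintegral_cst1 RintegralZ// [leRHS]/Rintegral gaussian_expR_sqr//=.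
  by rewrite -/M /c mulNr mulNr.
have M0 : 0 <= M by apply: Rintegral_ge0 => x _; exact: sqr_ge0.
have up u : 0 < u -> u < 1 -> u * (u + 1) * M <= 2.
  move=> u0 u1; have := key u u0.
  have uV : u * u^-1 = 1 by rewrite mulfV// gt_eqF.
  move=> /(ler_wpM2l (ltW u0)); rewrite uV => h.
  have : (1 - u) * (u * (u + 1) * M - 2) <= 0 by lra.
  by rewrite pmulr_rle0 ?subr_gt0// subr_le0.
have lo u : 1 < u -> 2 <= u * (u + 1) * M.
  move=> u1; have u0 : 0 < u by lra.
  have := key u u0.
  have uV : u * u^-1 = 1 by rewrite mulfV// gt_eqF.
  move=> /(ler_wpM2l (ltW u0)); rewrite uV => h.
  have : 0 <= (u - 1) * (u * (u + 1) * M - 2) by lra.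
  by rewrite pmulr_rge0 ?subr_gt0// subr_ge0.
apply/eqP; rewrite eq_le; apply/andP; split; rewrite leNgt; apply/negP => h.
- pose e := (M - 1) / (2 * M); have M1 : 0 < M by lra.
  have e0 : 0 < e by rewrite divr_gt0//; lra.
  have eM : e * (2 * M) = M - 1 by rewrite /e divfK// gt_eqF//; lra.
  have := up (1 - e / 2).
  have : e < 1 by nra.
  move=> e1 /(_ ltac:(lra) ltac:(lra)); nra.
- pose e := (1 - M) / 4; have := lo (1 + e).
  have : 0 < e by rewrite /e; lra.
  move=> e0 /(_ ltac:(lra)); rewrite /e in e0 *; nra.
Qed.

End standard_gaussian_moments.

Section coordinatewise_measurable.
Context {R : realType} {I : Type}.

(* Measurability for the product sigma-algebra on [I -> R], phrased without
   putting a measurable structure on that type. *)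
Definition coord_measurable {d'} {U : measurableType d'} (g : (I -> R) -> U) : Prop :=
  forall d (T : measurableType d) (c : I -> T -> R),
    (forall i, measurable_fun setT (c i)) ->
    measurable_fun setT (fun t => g (c ^~ t)).

End coordinatewise_measurable.

Section gaussian_vector.
Context {R : realType} {I : finType}.
Implicit Types (vs : seq (I -> R)) (a v x : I -> R).

(* The last clause says that x + sqrt b N + sqrt c N' has the law of
   x + sqrt (b + c) N when N' is an independent copy of N. *)
Definition gaussian_vector_spec {d} {T : measurableType d} (P : probability T R)
    (N : I -> T -> R) vs : Prop :=
  [/\ forall i, measurable_fun setT (N i),
      forall a (f : R -> \bar R), measurable_fun setT f -> (forall y, 0 <= f y)%E ->
        (\int[P]_t f (\sum_i a i * N i t)%R =
         \int[gaussian (\sum_(v <- vs) (\sum_i a i * v i) ^+ 2)]_y f y)%E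
    & forall (b c : R) x (g : (I -> R) -> \bar R), 0 <= b -> 0 <= c ->
        coord_measurable g -> (forall y, 0 <= g y)%E ->
        (\int[P]_t \int[P]_t' g (fun i => x i + (Num.sqrt b * N i t + Num.sqrt c * N i t'))%R =
         \int[P]_t g (fun i => x i + Num.sqrt (b + c) * N i t)%R)%E].

Let unit_prob : probability unit R := (dirac tt : probability unit R).

Let gaussian_vector_nil : gaussian_vector_spec unit_prob (fun (_ : I) (_ : unit) => 0) [::].
Proof.
have P1 (c : \bar R) : (\int[unit_prob]_t c = c)%E.
  by rewrite integral_cst// [X in (_ * X)%E](probability_setT unit_prob) mule1.
split => [//|a f mf f0|b c x g b0 c0 mg g0].
  rewrite big_nil ge0_integral_gaussian0// P1; congr f.
  by rewrite big1// => i _; rewrite mulr0.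
rewrite !P1; congr g; apply/funext => i.
by rewrite !mulr0 !addr0.
Qed.

Let sum_scale_conv (b c : R) (f : R -> \bar R) : measurable_fun setT f ->
  (forall y, 0 <= f y)%E -> 0 <= c ->
  (\int[gaussian 1]_z \int[gaussian c]_y f (b * z + y)%R =
   \int[gaussian (b ^+ 2 + c)]_y f y)%E.
Proof.
move=> mf f0 c0.
have mF : measurable_fun setT (fun q : measurableTypeR R * measurableTypeR R => f (b * q.1 + q.2)%R).
  apply: (measurableT_comp mf); apply: measurable_funD => //.
  exact: measurable_funM.
rewrite (fubini_tonelli _ mF (fun=> f0 _)) -ge0_integral_gaussian_conv ?sqr_ge0//.
apply: eq_integral => y _.
have mfy : measurable_fun setT (fun z : R => f (z + y)%R).
  by apply: (measurableT_comp mf); exact: measurable_funD.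
by rewrite (ge0_integral_gaussian_scale b ler01 mfy (fun=> f0 _)) mulr1.
Qed.

Let scale_scale_conv (b c : R) (f : R -> \bar R) : measurable_fun setT f ->
  (forall y, 0 <= f y)%E -> 0 <= b -> 0 <= c ->
  (\int[gaussian 1]_z \int[gaussian 1]_y f (Num.sqrt b * z + Num.sqrt c * y)%R =
   \int[gaussian 1]_y f (Num.sqrt (b + c) * y)%R)%E.
Proof.
move=> mf f0 b0 c0.
rewrite (ge0_integral_gaussian_scale (Num.sqrt (b + c)) ler01 mf f0).
rewrite mulr1 sqr_sqrtr ?addr_ge0// -{2}(sqr_sqrtr b0) -sum_scale_conv//.
apply: eq_integral => z _.
have mfz : measurable_fun setT (fun y : R => f (Num.sqrt b * z + y)%R).
  by apply: (measurableT_comp mf); exact: measurable_funD.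
rewrite (ge0_integral_gaussian_scale (Num.sqrt c) ler01 mfz (fun=> f0 _)).
by rewrite mulr1 sqr_sqrtr.
Qed.

Section cons.
Context {d} {T : measurableType d} (P : probability T R) (N : I -> T -> R).
Variables (v : I -> R) (vs : seq (I -> R)).
Hypothesis HN : gaussian_vector_spec P N vs.
Local Notation G := (@gaussian R 1).
Local Notation T' := (measurableTypeR R * T)%type.
Let N' (i : I) (w : T') : R := v i * w.1 + N i w.2.

Let mN i : measurable_fun setT (N i). Proof. by have [h _ _] := HN; exact: h. Qed.

Let mN' i : measurable_fun setT (N' i).
Proof.
apply: measurable_funD; first exact: measurable_funM.
exact: (measurableT_comp (mN i)).
Qed.

(** Adding an independent standard Gaussian multiple of [v] adds the rank-one matrix v v^T to the
    covariance. The convolution clause separates into a one-dimensional one for the new factor and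
    the inductive one for [N]. *)
Lemma gaussian_vector_cons : gaussian_vector_spec (product_prob G P) N' (v :: vs).
Proof.
have [_ lawN convN] := HN; split => [//|a f mf f0|b c x g b0 c0 mg g0].
- have mF : measurable_fun setT (fun w => f (\sum_i a i * N' i w)%R).
    by apply: (measurableT_comp mf); apply: sumr_measurable => i; exact: measurable_funM.
  rewrite [LHS](fubini_tonelli1 _ mF (fun=> f0 _)) big_cons.
  rewrite -sum_scale_conv//; last by apply: sumr_ge0 => w _; exact: sqr_ge0.
  apply: eq_integral => z _; rewrite /fubini_F /N' /=.
  have mfz : measurable_fun setT (fun y : R => f ((\sum_i a i * v i) * z + y)%R).
    by apply: (measurableT_comp mf); exact: measurable_funD.
  rewrite -(lawN a _ mfz (fun=> f0 _)); apply: eq_integral => t _.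
  congr f; rewrite mulr_suml -big_split; apply: eq_bigr => i _ /=.
  by rewrite mulrDr mulrA.
- pose K (y : R) := (\int[P]_t g (fun i => x i + v i * y + Num.sqrt (b + c) * N i t)%R)%E.
  have mgK : measurable_fun setT (fun w : T' => g (fun i => x i + v i * w.1 + Num.sqrt (b + c) * N i w.2)%R).
    apply: mg => i; apply: measurable_funD.
      by apply: measurable_funD => //; exact: measurable_funM.
    by apply: measurable_funM => //; exact: (measurableT_comp (mN i)).
  have mK : measurable_fun setT K.
    exact: (measurable_fun_fubini_tonelli_F (m2 := P) _ mgK (fun=> g0 _)).
  have K0 y : (0 <= K y)%E by apply: integral_ge0 => t _.
  (* [K] has [N] integrated out at the scale sqrt (b + c), so only the scalar convolution identity
     remains on this side. *)
  transitivity (\int[G]_z \int[G]_z' K (Num.sqrt b * z + Num.sqrt c * z')%R)%E; last first.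
    rewrite scale_scale_conv//.
    have mR : measurable_fun setT (fun w => g (fun i => x i + Num.sqrt (b + c) * N' i w)%R).
      by apply: mg => i; apply: measurable_funD => //; exact: measurable_funM.
    rewrite [RHS](fubini_tonelli1 _ mR (fun=> g0 _)).
    apply: eq_integral => z _; apply: eq_integral => t _; congr g.
    by apply/funext => i; rewrite /N' /=; ring.
  pose H (w w' : T') := g (fun i => x i + (Num.sqrt b * N' i w + Num.sqrt c * N' i w'))%R.
  have mH2 : measurable_fun setT (fun q : T' * T' => H q.1 q.2).
    apply: mg => i; apply: measurable_funD => //; apply: measurable_funD.
      by apply: measurable_funM => //; exact: (measurableT_comp (mN' i)).
    by apply: measurable_funM => //; exact: (measurableT_comp (mN' i)).
  have mH w : measurable_fun setT (H w).
    apply: mg => i; apply: measurable_funD => //; apply: measurable_funD => //.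
    exact: measurable_funM.
  have mL : measurable_fun setT (fun w => \int[product_prob G P]_w' H w w')%E.
    exact: (measurable_fun_fubini_tonelli_F (m2 := product_prob G P) _ mH2 (fun=> g0 _)).
  have L0 w : (0 <= \int[product_prob G P]_w' H w w')%E by apply: integral_ge0 => ? _; exact: g0.
  rewrite [LHS](fubini_tonelli1 _ mL L0).
  apply: eq_integral => z _; rewrite /fubini_F.
  transitivity (\int[P]_t \int[G]_z' \int[P]_t' H (z, t) (z', t'))%E.
    by apply: eq_integral => t _; rewrite [LHS](fubini_tonelli1 _ (mH _) (fun=> g0 _)).
  (* The integrals come in the order z, t, z', t'; exchanging t and z' brings the two copies of [N]
     together. *)
  have mS : measurable_fun setT (fun q : T * measurableTypeR R =>
      \int[P]_t' H (z, q.1) (q.2, t'))%E.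
    apply: (measurable_fun_fubini_tonelli_F (m2 := P)
      (fun r : (T * measurableTypeR R) * T => H (z, r.1.1) (r.1.2, r.2)) _ (fun=> g0 _)).
    have m1 : measurable_fun setT (fun r : (T * measurableTypeR R) * T => (z, r.1.1) : T').
      by apply: measurable_fun_pair => //; exact: measurableT_comp.
    have m2 : measurable_fun setT (fun r : (T * measurableTypeR R) * T => (r.1.2, r.2) : T').
      by apply: measurable_fun_pair => //; exact: measurableT_comp.
    apply: mg => i; apply: measurable_funD => //; apply: measurable_funD.
      by apply: measurable_funM => //; exact: (measurableT_comp (mN' i) m1).
    by apply: measurable_funM => //; exact: (measurableT_comp (mN' i) m2).
  have S0 q : (0 <= \int[P]_t' H (z, q.1) (q.2, t'))%E by apply: integral_ge0 => ? _; exact: g0.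
  rewrite (fubini_tonelli _ mS S0); apply: eq_integral => z' _ /=.
  rewrite /K -(convN b c (fun i => x i + v i * (Num.sqrt b * z + Num.sqrt c * z')) g)//.
  apply: eq_integral => t _; apply: eq_integral => t' _; congr g.
  by apply/funext => i; rewrite /N' /=; ring.
Qed.

End cons.

Lemma gaussian_vector_exists vs : exists d (T : measurableType d)
  (P : probability T R) (N : I -> T -> R), gaussian_vector_spec P N vs.
Proof.
elim: vs => [|v vs [d [T [P [N HN]]]]].
  by eexists; eexists; exists unit_prob; eexists; exact: gaussian_vector_nil.
by eexists; eexists; eexists; eexists; exact: (gaussian_vector_cons v HN).
Qed.

End gaussian_vector.

(** * Decomposition of positive semidefinite matrices *)

Section psd_decomposition.
Context {R : realType} {I : finType}.
Implicit Types (S : I -> I -> R) (a : I -> R).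

Definition quad_form S a : R := \sum_i \sum_j a i * a j * S i j.

Lemma quad_form_shift S a (i0 : I) (t : R) : (forall i j, S i j = S j i) ->
  quad_form S (fun i => a i + t * (i == i0)%:R) =
  quad_form S a + 2 * t * (\sum_j a j * S i0 j) + t ^+ 2 * S i0 i0.
Proof.
move=> symS; rewrite /quad_form.
have pick (F : I -> R) : \sum_j (j == i0)%:R * F j = F i0.
  rewrite (bigD1 i0)//= eqxx mul1r big1 ?addr0// => j /negPf ->.
  by rewrite mul0r.
have E i : \sum_j (a i + t * (i == i0)%:R) * (a j + t * (j == i0)%:R) * S i j =
   \sum_j a i * a j * S i j + t * (a i * S i i0) + (i == i0)%:R * (t * (\sum_j a j * S i j) + t ^+ 2 * S i i0).
  rewrite -[in RHS](pick (fun j => S i j)).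
  rewrite !mulr_sumr !mulrDr !mulr_sumr -!big_split /=; apply: eq_bigr => j _.
  by ring.
under eq_bigr do rewrite E.
rewrite !big_split /= (pick (fun i => t * (\sum_j a j * S i j) + t ^+ 2 * S i i0)).
rewrite -mulr_sumr; under [X in _ + t * X + _ = _]eq_bigr do rewrite symS.
by ring.
Qed.

(** Symmetric Gaussian elimination: each nonzero diagonal entry splits off a rank-one matrix, and
    the Schur complement stays positive semidefinite. *)
Lemma psd_decomposition S : (forall i j, S i j = S j i) ->
  (forall a, 0 <= quad_form S a) ->
  exists vs : seq (I -> R), forall i j, S i j = \sum_(v <- vs) v i * v j.
Proof.
move=> symS psdS.
(* Induction on a list of indices outside which all rows vanish; each step clears the row of its
   head. *)
suff: forall (s : seq I) S, (forall i j, S i j = S j i) ->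
    (forall a, 0 <= quad_form S a) -> (forall i j, i \notin s -> S i j = 0) ->
    exists vs : seq (I -> R), forall i j, S i j = \sum_(v <- vs) v i * v j.
  by move=> /(_ (enum I) S symS psdS); apply => i j; rewrite mem_enum.
elim => [|i0 s ih] {psdS symS}S symS psdS supp.
  by exists [::] => i j; rewrite big_nil supp.
have [Si0|Si0] := eqVneq (S i0 i0) 0.
  apply: ih => // i j ins; have [->|ii0] := eqVneq i i0; last first.
    by apply: supp; rewrite inE negb_or ii0 ins.
  have key t : 0 <= S j j + 2 * t * S i0 j.
    have := psdS (fun k => (k == j)%:R + t * (k == i0)%:R).
    rewrite quad_form_shift// Si0 mulr0 addr0.
    have pick (F : I -> R) : \sum_k (k == j)%:R * F k = F j.
      rewrite (bigD1 j)//= eqxx mul1r big1 ?addr0// => k /negPf ->.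
      by rewrite mul0r.
    rewrite (pick (fun k => S i0 k)) /quad_form.
    have E k : \sum_l (k == j)%:R * (l == j)%:R * S k l = (k == j)%:R * S k j.
      by under eq_bigr do rewrite -mulrA; rewrite -mulr_sumr pick.
    by under eq_bigr do rewrite E; rewrite pick.
  apply/eqP; apply: contraT => h.
  (* A zero pivot makes the form affine in [t]; at this [t] its value would be -1, so the whole row
     of [i0] vanishes. *)
  have := key (- (S j j + 1) / (2 * S i0 j)).
  have -> : 2 * (- (S j j + 1) / (2 * S i0 j)) * S i0 j = - (S j j + 1) by field.
  lra.
have Sp : 0 < S i0 i0.
  rewrite lt_def Si0 /=; have := psdS (fun k => 0 + 1 * (k == i0)%:R).
  rewrite quad_form_shift// /quad_form big1 => [|i _]; last first.
    by rewrite big1// => j _; rewrite mul0r mul0r.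
  by rewrite big1 => [|j _]; [lra|rewrite mul0r].
pose v i := S i0 i / Num.sqrt (S i0 i0).
have vv i j : v i * v j = S i0 i * S i0 j / S i0 i0.
  by rewrite /v mulrACA -invfM -expr2 sqr_sqrtr ?ltW.
pose S' i j := S i j - v i * v j.
have [||i j|vs Evs] := ih S'.
- by move=> i j; rewrite /S' symS (mulrC (v i)).
- move=> a; pose b := \sum_j a j * S i0 j.
  (* This shift minimises the form in the direction of [i0], and the minimum is the form of the
     Schur complement [S']. *)
  have := psdS (fun k => a k + (- b / S i0 i0) * (k == i0)%:R).
  rewrite quad_form_shift// -/b.
  have -> : quad_form S' a = quad_form S a - b ^+ 2 / S i0 i0.
    rewrite /quad_form expr2 [in RHS]/b mulr_suml mulr_suml -sumrB; apply: eq_bigr => i _.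
    rewrite mulr_sumr mulr_suml -sumrB; apply: eq_bigr => j _.
    by rewrite /S' vv; field.
  rewrite (_ : _ + _ + _ = quad_form S a - b ^+ 2 / S i0 i0)//.
  by field.
- move=> ins; rewrite /S' vv; have [->|ii0] := eqVneq i i0.
    by field.
  rewrite (supp i) ?inE ?negb_or ?ii0 ?ins// (symS i0 i) (supp i) ?inE ?negb_or ?ii0 ?ins//.
  by rewrite !mul0r subr0.
exists (v :: vs) => i j; rewrite big_cons -Evs /S'; ring.
Qed.

End psd_decomposition.

Lemma has_law_indic {R : realType} {d d'} {T : measurableType d} {T' : measurableType d'}
    (P : probability T R) (nu : {measure set T' -> \bar R}) (Y : T -> T') :
  measurable_fun setT Y ->
  (forall A : set T', measurable A ->
    (\int[P]_t (\1_A (Y t) : R)%:E = \int[nu]_y (\1_A y : R)%:E)%E) ->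
  has_law P Y nu.
Proof.
move=> mY lawY A mA.
have mYA : measurable (Y @^-1` A) by rewrite -[X in measurable X]setTI; exact: mY.
have E1 : (\int[nu]_y (\1_A y : R)%:E = nu A)%E by rewrite integral_indic// setIT.
have E2 : (\int[P]_t (\1_(Y @^-1` A) t : R)%:E = P (Y @^-1` A))%E.
  by rewrite integral_indic// setIT.
by rewrite -E1 -E2 -(lawY A mA).
Qed.

Section gaussian_vector_moments.
Context {R : realType} {I : finType} {d} {T : measurableType d}.
Variables (P : probability T R) (N : I -> T -> R) (vs : seq (I -> R)).
Hypothesis HN : gaussian_vector_spec P N vs.
Implicit Type a : I -> R.
Local Notation G := (@gaussian R 1).

Let Y a t := \sum_i a i * N i t.
Let q a := \sum_(v <- vs) (\sum_i a i * v i) ^+ 2.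

Let q0 a : 0 <= q a. Proof. by apply: sumr_ge0 => v _; exact: sqr_ge0. Qed.

Let mN i : measurable_fun setT (N i). Proof. by have [h _ _] := HN; exact: h. Qed.

Let mY a : measurable_fun setT (Y a).
Proof. by apply: sumr_measurable => i; exact: measurable_funM. Qed.

Let lawY a : has_law P (Y a : T -> measurableTypeR R) (gaussian (q a)).
Proof.
have [_ lawN _] := HN; apply: has_law_indic => [|A mA]; first exact: mY.
apply: lawN; last by move=> y; rewrite lee_fin.
by apply/measurable_EFinP; exact: measurable_indic.
Qed.

Let sq a : R := Num.sqrt (q a).

Let msq a : measurable_fun setT (fun z : measurableTypeR R => sq a * z : measurableTypeR R).
Proof. exact: measurable_funM. Qed.

(** [Y a] and [sq a] times a standard Gaussian have the same law, which reduces all moments of [Y a]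
    to standard ones. *)
Let lawG a : has_law G (fun z => sq a * z : measurableTypeR R) (gaussian (q a)).
Proof.
apply: has_law_indic => [|A mA]; first exact: msq.
rewrite (ge0_integral_gaussian_scale (f := fun y : R => (\1_A y : R)%:E) (sq a) ler01).
- by rewrite mulr1 sqr_sqrtr.
- by apply/measurable_EFinP; exact: measurable_indic.
- by move=> y; rewrite lee_fin.
Qed.

Lemma gaussian_vector_normal a : univariate_normal P (fun t => \sum_i a i * N i t).
Proof.
exists 0; have [qa0|qa0] := eqVneq (q a) 0.
  by left => A mA; have := lawY a mA; rewrite qa0 gaussian0.
right; exists (Num.sqrt (q a)); first by rewrite sqrtr_gt0 lt_def qa0 q0.
by move=> A mA; have := lawY a mA; rewrite gaussianE.
Qed.

Let transfer_integrable a (f : R -> R) : measurable_fun setT f ->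
  G.-integrable setT (EFin \o (fun z => f (sq a * z))) ->
  P.-integrable setT (EFin \o (fun t => f (Y a t))).
Proof.
move=> mf iG; apply: (proj2 (integrable_law (nu := gaussian (q a)) (mY a) (lawY a) mf)).
exact: (proj1 (integrable_law (nu := gaussian (q a)) (msq a) (lawG a) mf)).
Qed.

Let transfer_Rintegral a (f : R -> R) : measurable_fun setT f ->
  \int[P]_t f (Y a t) = \int[G]_z f (sq a * z).
Proof.
move=> mf; rewrite (Rintegral_law (nu := gaussian (q a)) (mY a) (lawY a) mf).
by rewrite (Rintegral_law (nu := gaussian (q a)) (msq a) (lawG a) mf).
Qed.

Let Y_integrable_pow a k : (k < 4)%N -> P.-integrable setT (EFin \o (fun t => Y a t ^+ k)).
Proof.
move=> k4; apply: (transfer_integrable (f := fun y => y ^+ k)) => //.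
rewrite (_ : _ \o _ = EFin \o (fun z => sq a ^+ k * z ^+ k)).
  exact: (integrableZl measurableT _ (gaussian_integrable_pow k4)).
by apply/funext => z /=; rewrite exprMn.
Qed.

Let Y_integrable_abs3 a : P.-integrable setT (EFin \o (fun t => `|Y a t| ^+ 3)).
Proof.
apply: (transfer_integrable (f := fun y => `|y| ^+ 3)).
  by apply: measurable_funX; exact: normr_measurable.
rewrite (_ : _ \o _ = EFin \o (fun z => `|sq a| ^+ 3 * `|z| ^+ 3)).
  exact: (integrableZl measurableT _ gaussian_integrable_abs3).
by apply/funext => z /=; rewrite normrM exprMn.
Qed.

Let Y_mean a : \int[P]_t Y a t = 0.
Proof.
rewrite (transfer_Rintegral _ (f := id))// RintegralZ; last exact: (gaussian_integrable_pow (k := 1)).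
by rewrite gaussian_mean mulr0.
Qed.

Let Y_second a : \int[P]_t Y a t ^+ 2 = q a.
Proof.
rewrite (transfer_Rintegral _ (f := fun y => y ^+ 2))//.
under eq_Rintegral do rewrite exprMn.
rewrite RintegralZ; last exact: (gaussian_integrable_pow (k := 2)).
by rewrite gaussian_second_moment mulr1 sqr_sqrtr.
Qed.

Let del (i j : I) : R := (j == i)%:R.

Let delE (F : I -> R) i : \sum_j del i j * F j = F i.
Proof.
rewrite (bigD1 i)//= /del eqxx mul1r big1 ?addr0// => j /negPf ->.
by rewrite mul0r.
Qed.

Let NE i t : N i t = Y (del i) t. Proof. by rewrite /Y (delE (N ^~ t)). Qed.

Let NDE i j t : N i t + N j t = Y (fun k => del i k + del j k) t.
Proof.
by rewrite /Y; under eq_bigr do rewrite mulrDl; rewrite big_split /= !(delE (N ^~ t)).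
Qed.

Lemma gaussian_vector_integrable i : P.-integrable setT (EFin \o N i).
Proof.
rewrite (_ : N i = (fun t => Y (del i) t ^+ 1)); first exact: Y_integrable_pow.
by apply/funext => t; rewrite expr1 NE.
Qed.

Lemma gaussian_vector_integrable_abs3 i :
  P.-integrable setT (EFin \o (fun t => `|N i t| ^+ 3)).
Proof. by under eq_fun do rewrite NE; exact: Y_integrable_abs3. Qed.

(** Moments are known only for powers of single linear combinations; polarisation recovers the mixed
    second moments. *)
Let polarize i j t :
  N i t * N j t = 2^-1 * ((N i t + N j t) ^+ 2 + - 1 * (N i t ^+ 2 + N j t ^+ 2)).
Proof. by field. Qed.

Let i2 i : P.-integrable setT (EFin \o (fun t => N i t ^+ 2)).
Proof. by under eq_fun do rewrite NE; exact: Y_integrable_pow. Qed.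

Let i2D i j : P.-integrable setT (EFin \o (fun t => (N i t + N j t) ^+ 2)).
Proof. by under eq_fun do rewrite NDE; exact: Y_integrable_pow. Qed.

Let i22 i j : P.-integrable setT (EFin \o (fun t => N i t ^+ 2 + N j t ^+ 2)).
Proof. exact: (integrableD measurableT (i2 i) (i2 j)). Qed.

Let i22N i j : P.-integrable setT (EFin \o (fun t => - 1 * (N i t ^+ 2 + N j t ^+ 2))).
Proof. exact: (integrableZl measurableT _ (i22 i j)). Qed.

Let iD i j : P.-integrable setT
  (EFin \o (fun t => (N i t + N j t) ^+ 2 + - 1 * (N i t ^+ 2 + N j t ^+ 2))).
Proof. exact: (integrableD measurableT (i2D i j) (i22N i j)). Qed.

Lemma gaussian_vector_integrableM i j :
  P.-integrable setT (EFin \o (fun t => N i t * N j t)).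
Proof.
rewrite (_ : (fun t => _) = (fun t => 2^-1 *
    ((N i t + N j t) ^+ 2 + - 1 * (N i t ^+ 2 + N j t ^+ 2)))).
  exact: (integrableZl measurableT _ (iD i j)).
by apply/funext => t; exact: polarize.
Qed.

Lemma gaussian_vector_mean i : \int[P]_t N i t = 0.
Proof. by under eq_Rintegral do rewrite NE; exact: Y_mean. Qed.

Lemma gaussian_vector_covariance i j :
  \int[P]_t (N i t * N j t) = \sum_(v <- vs) v i * v j.
Proof.
under eq_Rintegral do rewrite polarize.
rewrite RintegralZ// RintegralD// RintegralZ// RintegralD//.
under eq_Rintegral do rewrite NDE.
under [X in _ + _ * (X + _)]eq_Rintegral do rewrite NE.
under [X in _ + _ * (_ + X)]eq_Rintegral do rewrite NE.
rewrite !Y_second /q -big_split /= mulr_sumr -big_split /= mulr_sumr.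
apply: eq_bigr => v _.
have -> : \sum_k (del i k + del j k) * v k = v i + v j.
  by under eq_bigr do rewrite mulrDl; rewrite big_split /= !delE.
by rewrite !delE; field.
Qed.

End gaussian_vector_moments.

(** * Lindeberg's replacement method *)

Section smearing.
Context {R : realType} {I : finType}.
Implicit Types (g : (I -> R) -> R) (x : I -> R).

(** A convolution operator. These operators commute and do not increase uniform distances, so
    exchanging one summand can be estimated regardless of the others. *)
Definition smear {d} {T : measurableType d} (P : probability T R)
    (Z : I -> T -> R) g x : R := \int[P]_w g (fun i => x i + Z i w).

Section measurability.
Context {d} {T : measurableType d} (P : probability T R) (Z : I -> T -> R).
Hypothesis mZ : forall i, measurable_fun setT (Z i).
Variables (g : (I -> R) -> R) (M : R).
Hypothesis mg : coord_measurable g.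
Hypothesis gM : forall x, `|g x| <= M.

Lemma measurable_translate x : measurable_fun setT (fun w => g (fun i => x i + Z i w)).
Proof. by apply: mg => i; exact: measurable_funD. Qed.

Lemma integrable_translate x :
  P.-integrable setT (EFin \o (fun w => g (fun i => x i + Z i w))).
Proof. by apply: bounded_integrable; [exact: measurable_translate | exists M]. Qed.

Lemma coord_measurable_smear : coord_measurable (smear P Z g).
Proof.
move=> d0 T0 c mc.
(* Measurability in the parameter is read off Fubini's theorem, for which any probability on the
   parameter space will do. *)
pose Q0 : probability T0 R := dirac point.
apply: (measurable_Rintegral2 Q0 P (f := fun q => g (fun i => c i q.1 + Z i q.2))).
  apply: mg => i; apply: measurable_funD.
    exact: (measurableT_comp (mc i)).
  exact: (measurableT_comp (mZ i)).
by exists M.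
Qed.

Lemma smear_bound x : `|smear P Z g x| <= M.
Proof. by apply: Rintegral_le_cst => //; exact: measurable_translate. Qed.

End measurability.

Lemma smear_comm {d1 d2} {T1 : measurableType d1} {T2 : measurableType d2}
    (P1 : probability T1 R) (P2 : probability T2 R) Z1 Z2 g (M : R) x :
  (forall i, measurable_fun setT (Z1 i)) -> (forall i, measurable_fun setT (Z2 i)) ->
  coord_measurable g -> (forall y, `|g y| <= M) ->
  smear P1 Z1 (smear P2 Z2 g) x = smear P2 Z2 (smear P1 Z1 g) x.
Proof.
move=> m1 m2 mg gM; rewrite /smear.
rewrite (Rfubini P1 P2 (f := fun q => g (fun i => x i + Z1 i q.1 + Z2 i q.2))); last 2 first.
- apply: mg => i; apply: measurable_funD.
    by apply: measurable_funD => //; exact: (measurableT_comp (m1 i)).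
  exact: (measurableT_comp (m2 i)).
- by exists M.
apply: eq_Rintegral => w2 _; apply: eq_Rintegral => w1 _; congr g.
by apply/funext => i; rewrite addrAC.
Qed.

Lemma smear_dist {d} {T : measurableType d} (P : probability T R) Z g1 g2 (M e : R) x :
  (forall i, measurable_fun setT (Z i)) ->
  coord_measurable g1 -> (forall y, `|g1 y| <= M) ->
  coord_measurable g2 -> (forall y, `|g2 y| <= M) ->
  (forall y, `|g1 y - g2 y| <= e) -> `|smear P Z g1 x - smear P Z g2 x| <= e.
Proof.
move=> mZ m1 g1M m2 g2M g12.
rewrite /smear -RintegralB//; last 2 first.
- exact: (integrable_translate P mZ m1 g1M).
- exact: (integrable_translate P mZ m2 g2M).
apply: Rintegral_le_cst => //.
by apply: measurable_funB; exact: measurable_translate.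
Qed.

Lemma gaussian_vector_semigroup {d} {T : measurableType d} (P : probability T R)
    (N : I -> T -> R) vs g (M b c : R) x :
  gaussian_vector_spec P N vs -> coord_measurable g -> (forall y, `|g y| <= M) ->
  0 <= b -> 0 <= c ->
  smear P (fun i w => Num.sqrt (b + c) * N i w) g x =
  smear P (fun i w => Num.sqrt b * N i w) (smear P (fun i w => Num.sqrt c * N i w) g) x.
Proof.
move=> [mN _ convN] mg gM b0 c0.
have mZ (e : R) i : measurable_fun setT (fun w => e * N i w) by exact: measurable_funM.
have iM : P.-integrable setT (EFin \o (fun=> M)).
  by apply: bounded_integrable => //; exists `|M|.
(* The convolution clause concerns nonnegative functions; the shift by [M] makes [g] one and cancels
   by linearity. *)
have := convN b c x (fun y => (g y + M)%:E) b0 c0.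
have mgM : coord_measurable (fun y => (g y + M)%:E).
  move=> d0 T0 e me; apply/measurable_EFinP; apply: measurable_funD => //.
  exact: (mg _ _ e me).
have gM0 y : (0 <= (g y + M)%:E)%E.
  by rewrite lee_fin; have := gM y => /ler_normlP[]; lra.
move=> /(_ mgM gM0) E; apply: (addIr M).
have E1 : smear P (fun i w => Num.sqrt (b + c) * N i w) g x + M =
    fine (\int[P]_t (g (fun i => x i + Num.sqrt (b + c) * N i t)%R + M)%:E)%E.
  rewrite -[X in _ + X = _](Rintegral_cst1 P) -RintegralD//.
  exact: (integrable_translate P (mZ _) mg gM).
rewrite E1 -E.
have mS : coord_measurable (smear P (fun i w => Num.sqrt c * N i w) g).
  exact: (coord_measurable_smear P (mZ _) mg gM).
have SM := smear_bound P (mZ (Num.sqrt c)) mg gM.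
rewrite -[X in _ = _ + X](Rintegral_cst1 P) -RintegralD//; last first.
  exact: (integrable_translate P (mZ _) mS SM).
congr fine; apply: eq_integral => t _.
rewrite -[X in _ = (_ + X)%:E](Rintegral_cst1 P) -RintegralD//; last first.
  exact: (integrable_translate P (mZ _) mg gM).
rewrite EFin_Rintegral; last first.
  exact: (integrableD measurableT (integrable_translate P (mZ _) mg gM _) iM).
apply: eq_integral => t' _; congr (g _ + _)%:E.
by apply/funext => i; rewrite addrA.
Qed.

End smearing.

Section lindeberg.
Context {R : realType} {I : finType}.
Implicit Types (g : (I -> R) -> R) (x a : I -> R) (b : I -> I -> R).

(** The factor 1/2 of the second-order term is absorbed into [b]. *)
Definition taylor2_at g (K : R) x a b : Prop := forall y,
  `|g (fun i => x i + y i) - g x - \sum_i a i * y i - \sum_i \sum_j b i j * (y i * y j)|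
    <= K * \sum_i `|y i| ^+ 3.

Definition taylor2 g (K : R) : Prop := forall x, exists a b, taylor2_at g K x a b.

Section one_step.
Context {d} {T : measurableType d} (P : probability T R) (Z : I -> T -> R).
Variable S : I -> I -> R.
Hypothesis mZ : forall i, measurable_fun setT (Z i).
Hypothesis iZ : forall i, P.-integrable setT (EFin \o Z i).
Hypothesis iZZ : forall i j, P.-integrable setT (EFin \o (fun t => Z i t * Z j t)).
Hypothesis iZ3 : forall i, P.-integrable setT (EFin \o (fun t => `|Z i t| ^+ 3)).
Hypothesis Z0 : forall i, \int[P]_t Z i t = 0.
Hypothesis ZS : forall i j, \int[P]_t (Z i t * Z j t) = S i j.

(** Integrating the expansion removes the linear term and leaves a quadratic one that depends only
    on the covariance. Two centred vectors with equal covariances are thus indistinguishable up to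
    r^3. *)
Lemma taylor2_smear g (M K : R) x a b (r : R) : coord_measurable g ->
  (forall y, `|g y| <= M) -> taylor2_at g K x a b -> 0 <= r ->
  `|smear P (fun i w => r * Z i w) g x - (g x + r ^+ 2 * \sum_i \sum_j b i j * S i j)|
    <= K * r ^+ 3 * \sum_i \int[P]_t `|Z i t| ^+ 3.
Proof.
move=> mg gM tg r0.
have mrZ i : measurable_fun setT (fun w => r * Z i w) by exact: measurable_funM.
have ig := integrable_translate P mrZ mg gM x.
have [i1 E1] := Rintegral_sum (P := P) (index_enum I)
  (fun i => integrableZl measurableT (a i * r) (iZ i)).
have i2a i := Rintegral_sum (P := P) (index_enum I)
  (fun j => integrableZl measurableT (b i j * r ^+ 2) (iZZ i j)).
have [i2 E2] := Rintegral_sum (P := P) (index_enum I) (fun i => (i2a i).1).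
have [i3 E3] := Rintegral_sum (P := P) (index_enum I) iZ3.
pose L1 w := \sum_i (a i * r) * Z i w.
pose L2 w := \sum_i \sum_j (b i j * r ^+ 2) * (Z i w * Z j w).
pose gx w := g (fun i => x i + r * Z i w).
have ic (e : R) : P.-integrable setT (EFin \o (fun=> e)).
  by apply: bounded_integrable => //; exists `|e|.
have iD1 : P.-integrable setT (EFin \o (fun w => gx w - g x)).
  exact: (integrableB measurableT ig (ic _)).
have iD2 : P.-integrable setT (EFin \o (fun w => gx w - g x - L1 w)).
  exact: (integrableB measurableT iD1 i1).
have iD3 : P.-integrable setT (EFin \o (fun w => gx w - g x - L1 w - L2 w)).
  exact: (integrableB measurableT iD2 i2).
have EL1 : \int[P]_w L1 w = 0.
  rewrite /L1 E1 big1// => i _; have := RintegralZ (a i * r) (iZ i).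
  by rewrite Z0 mulr0.
have EL2 : \int[P]_w L2 w = r ^+ 2 * \sum_i \sum_j b i j * S i j.
  rewrite /L2 E2 mulr_sumr; apply: eq_bigr => i _.
  rewrite (i2a i).2 mulr_sumr; apply: eq_bigr => j _.
  have := RintegralZ (b i j * r ^+ 2) (iZZ i j); rewrite ZS => ->; ring.
have -> : smear P (fun i w => r * Z i w) g x - (g x + r ^+ 2 * \sum_i \sum_j b i j * S i j)
  = \int[P]_w (gx w - g x - L1 w - L2 w).
  rewrite RintegralB// RintegralB// RintegralB// Rintegral_cst1 EL1 EL2 subr0.
  by rewrite opprD addrA.
apply: le_trans (le_normr_Rintegral _ iD3) _ => //.
have iK : P.-integrable setT (EFin \o (fun w => (K * r ^+ 3) * \sum_i `|Z i w| ^+ 3)).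
  exact: (integrableZl measurableT _ i3).
rewrite -E3 -RintegralZ//; apply: le_Rintegral => //.
  exact: (integrable_abse iD3).
move=> w _; have := tg (fun i => r * Z i w).
rewrite -/(gx w) => h.
have -> : L1 w = \sum_i a i * (r * Z i w).
  by apply: eq_bigr => i _; rewrite mulrA.
have -> : L2 w = \sum_i \sum_j b i j * (r * Z i w * (r * Z j w)).
  by apply: eq_bigr => i _; apply: eq_bigr => j _; ring.
apply: le_trans h _; rewrite -[in leRHS]mulrA [X in _ <= _ * X]mulr_sumr.
rewrite le_eqVlt; apply/orP; left; apply/eqP; congr (_ * _).
by apply: eq_bigr => i _; rewrite normrM exprMn ger0_norm.
Qed.

End one_step.

Section clt_smooth.
Context {d d' d2} {T : measurableType d} {T' : measurableType d'} {T2 : measurableType d2}.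
Variables (P : probability T R) (nu : probability T' R) (X : nat -> {RV P >-> T'}).
Hypothesis iidX : iid_with_law nu X.
Variables (h : I -> T' -> R) (B : R).
Hypothesis mh : forall i, measurable_fun setT (h i).
Hypothesis hB : forall i y, `|h i y| <= B.
Hypothesis h0 : forall i, \int[nu]_y h i y = 0.
Variables (P2 : probability T2 R) (N : I -> T2 -> R) (vs : seq (I -> R)).
Hypothesis HN : gaussian_vector_spec P2 N vs.
Hypothesis hS : forall i j, \int[nu]_y (h i y * h j y) = \sum_(v <- vs) v i * v j.
Variables (g : (I -> R) -> R) (M K : R).
Hypothesis mg : coord_measurable g.
Hypothesis gM : forall y, `|g y| <= M.
Hypothesis tg : taylor2 g K.

Let hI := fun y i => h i y.
Let S n t i := partial_sum X hI n t i.

Let ih i : nu.-integrable setT (EFin \o h i).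
Proof. by apply: bounded_integrable => //; exists B. Qed.

Let ihh i j : nu.-integrable setT (EFin \o (fun t => h i t * h j t)).
Proof.
apply: bounded_integrable; first exact: measurable_funM.
by exists (B * B) => y; rewrite normrM ler_pM.
Qed.

Let ih3 i : nu.-integrable setT (EFin \o (fun t => `|h i t| ^+ 3)).
Proof.
apply: bounded_integrable.
  by apply: measurable_funX; exact: measurableT_comp.
by exists (B ^+ 3) => y; rewrite normrX normr_id lerXn2r// nnegrE ?(le_trans _ (hB i y)).
Qed.

Let mN i : measurable_fun setT (N i). Proof. by have [mN _ _] := HN. Qed.

Let C := K * (\sum_i \int[nu]_t `|h i t| ^+ 3 + \sum_i \int[P2]_t `|N i t| ^+ 3).

Let mrh (r : R) i : measurable_fun setT (fun w => r * h i w).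
Proof. exact: measurable_funM. Qed.

Let mrN (r : R) i : measurable_fun setT (fun w => r * N i w).
Proof. exact: measurable_funM. Qed.

Let one_step (r : R) x : 0 <= r ->
  `|smear nu (fun i y => r * h i y) g x - smear P2 (fun i w => r * N i w) g x| <= C * r ^+ 3.
Proof.
move=> r0; have [a [b tab]] := tg x.
have := taylor2_smear mh ih ihh ih3 h0 hS mg gM tab r0.
have := taylor2_smear mN (gaussian_vector_integrable HN) (gaussian_vector_integrableM HN)
  (gaussian_vector_integrable_abs3 HN) (gaussian_vector_mean HN)
  (gaussian_vector_covariance HN) mg gM tab r0.
set L := g x + _; set s1 := smear _ _ _ _; set s2 := smear _ _ _ _.
move=> /ler_normlP[u1 u2] /ler_normlP[u3 u4]; apply/ler_normlP; split; rewrite /C; lra.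
Qed.

(* The law of k summands scaled by r, completed by an independent Gaussian
   vector with c times the limiting covariance. *)
Let mix (r : R) (c : R) k := \int[P]_t smear P2 (fun i w => Num.sqrt c * N i w) g (fun i => r * S k t i).

Let mS k i : measurable_fun setT (fun t => S k t i).
Proof. by apply: measurable_partial_sum => j; exact: mh. Qed.

(** One replacement: the [k]-th summand is peeled off on one side, and a Gaussian of scale r, by the
    semigroup property, on the other. What remains on both sides is smearing by the same Gaussian,
    so [one_step] applies inside it. *)
Let mix_step (r c : R) k : 0 <= r -> 0 <= c ->
  `|mix r c k.+1 - mix r (r ^+ 2 + c) k| <= C * r ^+ 3.
Proof.
move=> r0 c0.
pose Nc i w := Num.sqrt c * N i w.
pose gc := smear P2 Nc g.
have mgc : coord_measurable gc := coord_measurable_smear P2 (mrN (Num.sqrt c)) mg gM.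
have gcM := smear_bound P2 (mrN (Num.sqrt c)) mg gM : forall y, `|gc y| <= M.
have -> : mix r c k.+1 = \int[P]_t \int[nu]_y gc (fun i => r * S k t i + r * h i y).
  pose Psi (s : I -> R) y := gc (fun i => r * s i + r * h i y).
  rewrite -(partial_sum_step iidX (h := hI) mh (k := k) (Psi := Psi)).
  - apply: eq_Rintegral => t _; rewrite /Psi; congr gc; apply/funext => i.
    by rewrite /S partial_sumS mulrDr.
  - move=> d0 T0 e me; apply: mgc => i; apply: measurable_funD.
      by apply: measurable_funM => //; exact: (measurableT_comp (me i)).
    exact: (measurableT_comp (mrh r i)).
  - by exists M => t y; exact: gcM.
pose F1 := smear nu (fun i y => r * h i y) g.
pose F2 := smear P2 (fun i w => r * N i w) g.
have mF1 : coord_measurable F1 := coord_measurable_smear nu (mrh r) mg gM.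
have F1M : forall y, `|F1 y| <= M := smear_bound nu (mrh r) mg gM.
have mF2 : coord_measurable F2 := coord_measurable_smear P2 (mrN r) mg gM.
have F2M : forall y, `|F2 y| <= M := smear_bound P2 (mrN r) mg gM.
have E1 t : \int[nu]_y gc (fun i => r * S k t i + r * h i y) = smear P2 Nc F1 (fun i => r * S k t i).
  by rewrite (smear_comm _ _ _ (mrN _) (mrh r) mg gM).
have E2 t : smear P2 (fun i w => Num.sqrt (r ^+ 2 + c) * N i w) g (fun i => r * S k t i) =
    smear P2 Nc F2 (fun i => r * S k t i).
  rewrite (gaussian_vector_semigroup _ HN mg gM (sqr_ge0 r) c0).
  rewrite sqrtr_sqr ger0_norm//.
  by rewrite (smear_comm _ _ _ (mrN _) (mrN r) mg gM).
under eq_Rintegral do rewrite E1.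
rewrite /mix; under [X in _ - X]eq_Rintegral do rewrite E2.
have mrS i : measurable_fun setT (fun t => r * S k t i) by exact: measurable_funM.
have mm (F : (I -> R) -> R) : coord_measurable F -> (forall y, `|F y| <= M) ->
    measurable_fun setT (fun t => smear P2 Nc F (fun i => r * S k t i)).
  move=> mF FM; exact: (coord_measurable_smear P2 (mrN (Num.sqrt c)) mF FM).
have im (F : (I -> R) -> R) : coord_measurable F -> (forall y, `|F y| <= M) ->
    P.-integrable setT (EFin \o (fun t => smear P2 Nc F (fun i => r * S k t i))).
  move=> mF FM; apply: bounded_integrable; first exact: mm.
  by exists M => t; exact: (smear_bound P2 (mrN (Num.sqrt c)) mF FM).
rewrite -RintegralB//; [|exact: im|exact: im].
apply: Rintegral_le_cst; first by apply: measurable_funB; exact: mm.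
move=> t; apply: (smear_dist P2 (M := M)) => //; first exact: mrN.
by move=> y; exact: one_step.
Qed.

(** With r = n^(-1/2), [mix] is telescoped from the pure Gaussian (k = 0) to the pure sum (k = n),
    the Gaussian keeping the share (n - k)/n of the covariance. There are n steps of order
    n^(-3/2). *)
Lemma clt_smooth n : (0 < n)%N ->
  `|\int[P]_t g (fun i => (Num.sqrt n%:R)^-1 * S n t i) - \int[P2]_w g (fun i => N i w)|
    <= C / Num.sqrt n%:R.
Proof.
move=> n0; pose r : R := (Num.sqrt n%:R)^-1.
have n0R : (0 : R) < n%:R by rewrite ltr0n.
have r0 : 0 <= r by rewrite invr_ge0 sqrtr_ge0.
have r2 : r ^+ 2 = n%:R^-1 by rewrite exprVn sqr_sqrtr// ltW.
have key k : (k <= n)%N ->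
    `|mix r ((n - k)%:R / n%:R) k - mix r 1 0| <= k%:R * (C * r ^+ 3).
  elim: k => [|k ih1] kn; first by rewrite subn0 divff ?gt_eqF// subrr normr0 mul0r.
  have c0 : 0 <= (n - k.+1)%:R / n%:R :> R by rewrite divr_ge0.
  have := mix_step k r0 c0.
  have -> : r ^+ 2 + (n - k.+1)%:R / n%:R = (n - k)%:R / n%:R.
    rewrite r2 -[X in X + _]mul1r -mulrDl; congr (_ / _).
    by rewrite -(natrD _ 1) add1n subnSK.
  have := ih1 (ltnW kn).
  rewrite -natr1 mulrDl mul1r => u1 u2.
  rewrite -(subrKA (mix r ((n - k)%:R / n%:R) k)) addrC.
  by apply: le_trans (ler_normD _ _) _; rewrite lerD// addrC.
have := key n (leqnn n); rewrite subnn mul0r.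
have -> : mix r 0 n = \int[P]_t g (fun i => r * S n t i).
  apply: eq_Rintegral => t _; rewrite /smear sqrtr0.
  under eq_Rintegral => w _.
    rewrite (_ : (fun i => _) = (fun i => r * S n t i)); last first.
      by apply/funext => i; rewrite mul0r addr0.
    over.
  by rewrite Rintegral_cst1.
have -> : mix r 1 0 = \int[P2]_w g (fun i => N i w).
  rewrite /mix /smear sqrtr1.
  transitivity (\int[P]_t \int[P2]_w g (fun i => N i w)); last exact: Rintegral_cst1.
  apply: eq_Rintegral => t _; apply: eq_Rintegral => w _; congr g.
  by apply/funext => i; rewrite /S /partial_sum big_ord0 mulr0 add0r mul1r.
move=> u; apply: le_trans u _.
rewrite le_eqVlt; apply/orP; left; apply/eqP.
rewrite -/r mulrCA; congr (_ * _).
by rewrite exprSr r2 mulrA mulfV ?mul1r// gt_eqF.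
Qed.

End clt_smooth.
End lindeberg.

(** * Smooth test functions and weak convergence *)

Section cubic_step.
Context {R : realType}.
Implicit Types u t : R.

Let pos u : R := Num.max u 0.

(* A twice differentiable step from 0 to 1 on [0, 3]:
   cubic_step u - cubic_step (u - 1) is the cubic B-spline. *)
Definition cubic_step u : R :=
  (pos u ^+ 3 - 3 * pos (u - 1) ^+ 3 + 3 * pos (u - 2) ^+ 3 - pos (u - 3) ^+ 3) / 6.

Let posn u : u <= 0 -> pos u = 0. Proof. by rewrite /pos => /max_idPr. Qed.
Let posp u : 0 <= u -> pos u = u. Proof. by rewrite /pos => /max_idPl. Qed.

Lemma cubic_step0 u : u <= 0 -> cubic_step u = 0.
Proof. by move=> h; rewrite /cubic_step !posn; [field|lra|lra|lra|lra]. Qed.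

Lemma cubic_step1 u : 3 <= u -> cubic_step u = 1.
Proof. by move=> h; rewrite /cubic_step !posp; [field|lra|lra|lra|lra]. Qed.

Let step01 u : 0 <= u <= 1 -> cubic_step u = u ^+ 3 / 6.
Proof.
move=> /andP[? ?]; rewrite /cubic_step posp ?(@posn (u - _)); first field; lra.
Qed.

Let step12 u : 1 <= u <= 2 -> cubic_step u = (u ^+ 3 - 3 * (u - 1) ^+ 3) / 6.
Proof.
move=> /andP[? ?]; rewrite /cubic_step posp ?(@posp (u - 1)) ?(@posn (u - _)); first field; lra.
Qed.

Let step23 u : 2 <= u <= 3 -> cubic_step u = 1 - (3 - u) ^+ 3 / 6.
Proof.
move=> /andP[? ?]; rewrite /cubic_step posp ?(@posp (u - 1)) ?(@posp (u - 2)) ?(@posn (u - 3)); first field; lra.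
Qed.

Let cubeI (v : R) : 0 <= v <= 1 -> 0 <= v ^+ 3 <= 1.
Proof. by move=> /andP[? ?]; rewrite exprn_ge0// exprn_ile1. Qed.

Lemma cubic_step_range u : 0 <= cubic_step u <= 1.
Proof.
have [u0|u0] := leP u 0; first by rewrite cubic_step0// lexx ler01.
have [u3|u3] := leP 3 u; first by rewrite cubic_step1// ler01 lexx.
have [u1|u1] := leP u 1.
  have /cubeI/andP[? ?] : 0 <= u <= 1 by lra.
  rewrite step01; lra.
have [u2|u2] := leP u 2; last first.
  have /cubeI/andP[? ?] : 0 <= 3 - u <= 1 by lra.
  rewrite step23; lra.
rewrite step12; last lra.
pose v := u - 1; have -> : u = v + 1 by rewrite /v; ring.
have v01 : 0 <= v <= 1 by rewrite /v; lra.
have /andP[v0 v1] := cubeI v01; case/andP: v01 => ? ?.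
have : 0 <= v ^+ 2 <= 1 by rewrite sqr_ge0 expr_le1.
move=> /andP[? ?]; rewrite addrK.
have : 0 <= (v - 1) ^+ 2 * (v + 2) by rewrite mulr_ge0 ?sqr_ge0//; lra.
have -> : (v - 1) ^+ 2 * (v + 2) = v ^+ 3 - 3 * v + 2 by ring.
move=> ?; have : v ^+ 2 <= v by rewrite expr2 ler_piMl.
move=> ?; have : v ^+ 3 <= v ^+ 2 by rewrite exprS ler_piMl.
move=> ?.
have -> : (v + 1) ^+ 3 = v ^+ 3 + 3 * v ^+ 2 + 3 * v + 1 by ring.
by apply/andP; split; lra.
Qed.

Lemma cubic_step_spline u : 0 <= cubic_step u - cubic_step (u - 1).
Proof.
have [u0|u0] := leP u 0; first by rewrite !cubic_step0//; lra.
have [u4|u4] := leP 4 u; first by rewrite !cubic_step1//; lra.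
have [u1|u1] := leP u 1.
  by rewrite (@cubic_step0 (u - 1)) ?subr0; [case/andP: (cubic_step_range u)|lra].
have [u3|u3] := leP 3 u.
  by rewrite cubic_step1// subr_ge0; case/andP: (cubic_step_range (u - 1)).
have [u2|u2] := leP u 2.
  rewrite step12; last lra.
  rewrite step01; last lra.
  pose v := u - 1; have -> : u = v + 1 by rewrite /v; ring.
  have v01 : 0 <= v <= 1 by rewrite /v; lra.
  have /andP[v0 v1] := cubeI v01; case/andP: v01 => ? ?.
  have := sqr_ge0 v; rewrite addrK => ?.
  have : v ^+ 3 <= v ^+ 2 by rewrite exprS ler_piMl.
  move=> ?.
  have -> : (v + 1) ^+ 3 = v ^+ 3 + 3 * v ^+ 2 + 3 * v + 1 by ring.
  lra.
rewrite step23; last lra.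
rewrite step12; last lra.
pose v := 3 - u; have -> : u = 3 - v by rewrite /v; ring.
have v01 : 0 <= v <= 1 by rewrite /v; lra.
have /andP[v0 v1] := cubeI v01; case/andP: v01 => ? ?.
have := sqr_ge0 v => ?.
have : v ^+ 3 <= v ^+ 2 by rewrite exprS ler_piMl.
move=> ?.
have -> : 3 - (3 - v) = v by ring.
have -> : (3 - v - 1) ^+ 3 - 3 * (3 - v - 1 - 1) ^+ 3 = 5 - 3 * v - 3 * v ^+ 2 + 2 * v ^+ 3 by ring.
lra.
Qed.

(** The reason for cubic splines: the truncated cube has a second-order expansion with a cubic
    remainder even across its knot. *)
Let pos_taylor u t : `|pos (u + t) ^+ 3 - pos u ^+ 3 - 3 * pos u ^+ 2 * t - 3 * pos u * t ^+ 2| <= `|t| ^+ 3.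
Proof.
have [u0|u0] := leP 0 u; have [ut|ut] := leP 0 (u + t).
- rewrite !posp//.
  have -> : (u + t) ^+ 3 - u ^+ 3 - 3 * u ^+ 2 * t - 3 * u * t ^+ 2 = t ^+ 3 by ring.
  by rewrite normrX.
- rewrite (posp u0) (posn (ltW ut)) expr0n /= sub0r.
  have t0 : t <= 0 by lra.
  have -> : - u ^+ 3 - 3 * u ^+ 2 * t - 3 * u * t ^+ 2 = (- (u + t)) ^+ 3 - (- t) ^+ 3 by ring.
  rewrite (ler0_norm t0) distrC ger0_norm.
    by rewrite lerBlDr lerDl exprn_ge0//; lra.
  by rewrite subr_ge0 lerXn2r ?nnegrE//; lra.
- rewrite (posp ut) (posn (ltW u0)) !expr0n /= !mulr0 !mul0r !subr0.
  have t0 : 0 <= t by lra.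
  by rewrite (ger0_norm t0) ger0_norm ?exprn_ge0// lerXn2r ?nnegrE//; lra.
- rewrite (posn (ltW ut)) (posn (ltW u0)) !expr0n /= !mulr0 !mul0r !subr0 normr0.
  by rewrite exprn_ge0.
Qed.

(** The four remainders add up to (1 + 3 + 3 + 1)/6 <= 2. The coefficients vanish for u >= 3, where
    the step is constant, and below 3 all positive parts are at most 3; 36 is a crude bound. *)
Lemma cubic_step_taylor u : exists a b, [/\ `|a| <= 36, `|b| <= 36 &
  forall t, `|cubic_step (u + t) - cubic_step u - a * t - b * t ^+ 2| <= 2 * `|t| ^+ 3].
Proof.
pose a := (3 * pos u ^+ 2 - 9 * pos (u - 1) ^+ 2 + 9 * pos (u - 2) ^+ 2 - 3 * pos (u - 3) ^+ 2) / 6.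
pose b := (3 * pos u - 9 * pos (u - 1) + 9 * pos (u - 2) - 3 * pos (u - 3)) / 6.
exists a, b.
have [ab1 ab2] : `|a| <= 36 /\ `|b| <= 36.
  have [u3|u3] := leP 3 u.
    rewrite /a /b !posp; try lra.
    rewrite [X in `|X / 6| <= _](_ : _ = 0); last by ring.
    rewrite [X in _ /\ `|X / 6| <= _](_ : _ = 0); last by ring.
    by rewrite mul0r normr0.
  have bd (w : R) : w <= u -> 0 <= pos w <= 3.
    by move=> wu; rewrite /pos le_max lexx orbT /= ge_max; lra.
  have bd2 (w : R) : 0 <= w <= 3 -> 0 <= w ^+ 2 <= 9.
    by move=> /andP[? ?]; rewrite sqr_ge0 /=; nra.
  have /bd h0 : u <= u by []. have /bd h1 : u - 1 <= u by lra.
  have /bd h2 : u - 2 <= u by lra. have /bd h3 : u - 3 <= u by lra.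
  have := bd2 _ h0; have := bd2 _ h1; have := bd2 _ h2; have := bd2 _ h3.
  move=> /andP[? ?] /andP[? ?] /andP[? ?] /andP[? ?].
  case/andP: h0 => ? ?; case/andP: h1 => ? ?; case/andP: h2 => ? ?; case/andP: h3 => ? ?.
  by split; apply/ler_normlP; rewrite /a /b; split; lra.
split => // t.
have := pos_taylor u t; have := pos_taylor (u - 1) t; have := pos_taylor (u - 2) t.
have := pos_taylor (u - 3) t.
have -> : u - 1 + t = u + t - 1 by ring.
have -> : u - 2 + t = u + t - 2 by ring.
have -> : u - 3 + t = u + t - 3 by ring.
move=> /ler_normlP[? ?] /ler_normlP[? ?] /ler_normlP[? ?] /ler_normlP[? ?].
have : 0 <= `|t| ^+ 3 by rewrite exprn_ge0.
move=> ?; apply/ler_normlP; rewrite /cubic_step /a /b; split; lra.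
Qed.

Lemma measurable_cubic_step : measurable_fun setT cubic_step.
Proof.
have mpos c : measurable_fun setT (fun u => pos (u - c) ^+ 3).
  by apply: measurable_funX; apply: measurable_maxr => //; exact: measurable_funB.
apply: measurable_funM => //; apply: measurable_funB; last exact: mpos.
apply: measurable_funD; last by apply: measurable_funM => //; exact: mpos.
apply: measurable_funB; last by apply: measurable_funM => //; exact: mpos.
by apply: measurable_funX; exact: measurable_maxr.
Qed.

End cubic_step.

Section smooth_test_functions.
Context {R : realType} {I : finType}.
Implicit Types (g : (I -> R) -> R) (x y a : I -> R) (b : I -> I -> R) (M K L : R).

Let lin a y : R := \sum_i a i * y i.
Let bil b y : R := \sum_i \sum_j b i j * (y i * y j).
Let len y : R := \sum_i `|y i|.

(* Second-order Taylor expansions with uniformly bounded coefficients; unlike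
   twice differentiability, this is stable under sums and products for free. *)
Definition expansion_bounds g (M K : R) : Prop :=
  forall x, `|g x| <= M /\ exists a b,
    [/\ forall i, `|a i| <= M, forall i j, `|b i j| <= M &
     forall y, `|g (fun i => x i + y i) - g x - \sum_i a i * y i
       - \sum_i \sum_j b i j * (y i * y j)| <= K * (\sum_i `|y i|) ^+ 3].

Definition smooth_test g : Prop :=
  coord_measurable g /\ exists M K, [/\ 0 <= M, 0 <= K & expansion_bounds g M K].

Let len_ge0 y : 0 <= len y. Proof. exact: sumr_ge0. Qed.

Let lin_le a y M : (forall i, `|a i| <= M) -> `|lin a y| <= M * len y.
Proof.
move=> aM; apply: le_trans (ler_norm_sum _ _ _) _.
by rewrite /len mulr_sumr; apply: ler_sum => i _; rewrite normrM ler_wpM2r.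
Qed.

Let bil_le b y M : (forall i j, `|b i j| <= M) -> `|bil b y| <= M * len y ^+ 2.
Proof.
move=> bM; apply: le_trans (ler_norm_sum _ _ _) _.
rewrite expr2 /len mulr_suml mulr_sumr; apply: ler_sum => i _.
apply: le_trans (ler_norm_sum _ _ _) _.
rewrite !mulr_sumr; apply: ler_sum => j _.
by rewrite !normrM ler_wpM2r// mulr_ge0.
Qed.

Lemma smooth_test_bound g : smooth_test g -> exists M, forall x, `|g x| <= M.
Proof. by move=> [_ [M [K [_ _ gMK]]]]; exists M => x; have [] := gMK x. Qed.

(** Increments of length at most 1 are controlled by the expansion, longer ones by 2M. *)
Lemma smooth_test_lipschitz g : smooth_test g ->
  exists2 L, 0 <= L & forall x y, `|g (fun i => x i + y i) - g x| <= L * \sum_i `|y i|.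
Proof.
move=> [_ [M [K [M0 K0 gMK]]]]; exists (2 * M + K); first by rewrite addr_ge0// mulr_ge0.
move=> x y; rewrite -/(len y); have [gM [a [b [aM bM gab]]]] := gMK x.
have s0 := len_ge0 y.
have [s1|s1] := leP (len y) 1.
  have h1 := lin_le y aM; have h2 := bil_le y bM; have h3 := gab y.
  rewrite -/(lin a y) -/(bil b y) -/(len y) in h3.
  have s2 : M * len y ^+ 2 <= M * len y by rewrite ler_wpM2l// expr2 ler_piMl.
  have s3 : K * len y ^+ 3 <= K * len y.
    by rewrite ler_wpM2l// exprS ler_piMr// exprn_ile1.
  move: h1 h2 h3 => /ler_normlP[? ?] /ler_normlP[? ?] /ler_normlP[? ?].
  by apply/ler_normlP; split; lra.
have [/ler_normlP[? ?] _] := gMK (fun i => x i + y i).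
move: gM => /ler_normlP[? ?].
have : M <= M * len y by rewrite ler_peMr// ltW.
have : 0 <= K * len y by rewrite mulr_ge0.
by move=> ? ?; apply/ler_normlP; split; lra.
Qed.

(** Products are easier to expand with the cube of the sum as remainder, Lindeberg's step with the
    sum of cubes; comparison with the largest coordinate passes from one to the other. *)
Let len_cube y : len y ^+ 3 <= #|I|%:R ^+ 3 * \sum_i `|y i| ^+ 3.
Proof.
have [i0 _|noI] := pickP (fun _ : I => true); last first.
  have -> : len y = 0 by rewrite /len big1// => i; have := noI i.
  by rewrite expr0n /= mulr_ge0// ?exprn_ge0// sumr_ge0// => i _; rewrite exprn_ge0.
pose i1 := [arg max_(i > i0) `|y i|]%O.
have maxi i : `|y i| <= `|y i1|.
  by rewrite /i1; case: arg_maxP => //= j _; apply.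
have h1 : len y <= #|I|%:R * `|y i1|.
  rewrite mulr_natl -sumr_const; exact: ler_sum.
apply: (@le_trans _ _ ((#|I|%:R * `|y i1|) ^+ 3)).
  by rewrite lerXn2r ?nnegrE// mulr_ge0.
rewrite exprMn ler_wpM2l ?exprn_ge0// (bigD1 i1)//= lerDl.
by rewrite sumr_ge0// => i _; rewrite exprn_ge0.
Qed.

Lemma smooth_test_taylor2 g : smooth_test g -> exists K, taylor2 g K.
Proof.
move=> [_ [M [K [M0 K0 gMK]]]]; exists (K * #|I|%:R ^+ 3) => x.
have [_ [a [b [_ _ gab]]]] := gMK x; exists a, b => y.
apply: le_trans (gab y) _; rewrite -mulrA ler_wpM2l//; exact: len_cube.
Qed.

Lemma smooth_test_cst (c : R) : smooth_test (fun=> c).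
Proof.
split; first by move=> d T e _; exact: measurable_cst.
exists `|c|, 0; split => // x; split => //.
exists (fun=> 0 : R), (fun _ _ => 0 : R); split => [i|i j|y]; rewrite ?normr0//.
have -> : \sum_i 0 * y i = 0 by rewrite big1// => i _; rewrite mul0r.
have -> : \sum_i \sum_j 0 * (y i * y j) = 0.
  by rewrite big1// => i _; rewrite big1// => j _; rewrite mul0r.
by rewrite subrr !subr0 normr0 mul0r.
Qed.

Lemma smooth_test_coord (i0 : I) (f : R -> R) (M K : R) : measurable_fun setT f ->
  0 <= M -> 0 <= K -> (forall u : R, `|f u| <= M /\ exists a b : R, [/\ `|a| <= M, `|b| <= M &
    forall t, `|f (u + t) - f u - a * t - b * t ^+ 2| <= K * `|t| ^+ 3]) ->
  smooth_test (fun x => f (x i0)).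
Proof.
move=> mf M0 K0 fMK; split.
  by move=> d T e me; exact: (measurableT_comp mf (me i0)).
exists M, K; split => // x; have [fM [a [b [aM bM fab]]]] := fMK (x i0); split => //.
exists (fun i => a * (i == i0)%:R), (fun i j => b * (i == i0)%:R * (j == i0)%:R).
split => [i|i j|y].
- by rewrite normrM; case: (i == i0); rewrite ?normr1 ?mulr1// normr0 mulr0.
- by rewrite !normrM; case: (i == i0); case: (j == i0); rewrite ?normr1 ?normr0 ?mulr1 ?mulr0 ?mul0r.
have E1 : \sum_i a * (i == i0)%:R * y i = a * y i0.
  rewrite (bigD1 i0)//= eqxx mulr1 big1 ?addr0// => i /negPf ->.
  by rewrite mulr0 mul0r.
have E2 : \sum_i \sum_j b * (i == i0)%:R * (j == i0)%:R * (y i * y j) = b * y i0 ^+ 2.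
  rewrite (bigD1 i0)//= [X in _ + X]big1 ?addr0 => [|i /negPf ->]; last first.
    by rewrite big1// => j _; rewrite mulr0 !mul0r.
  rewrite (bigD1 i0)//= eqxx !mulr1 big1 ?addr0// => j /negPf ->.
  by rewrite mulr0 !mul0r.
rewrite E1 E2; apply: le_trans (fab (y i0)) _; rewrite ler_wpM2l//.
rewrite lerXn2r ?nnegrE ?sumr_ge0//.
by rewrite (bigD1 i0)//= lerDl sumr_ge0.
Qed.

Lemma smooth_testD g1 g2 : smooth_test g1 -> smooth_test g2 ->
  smooth_test (fun x => g1 x + g2 x).
Proof.
move=> [m1 [M1 [K1 [M10 K10 b1]]]] [m2 [M2 [K2 [M20 K20 b2]]]]; split.
  by move=> d T e me; apply: measurable_funD; [exact: m1|exact: m2].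
exists (M1 + M2), (K1 + K2); split; rewrite ?addr_ge0// => x.
have [gM1 [a [b [aM bM gab]]]] := b1 x; have [gM2 [a' [b' [aM' bM' gab']]]] := b2 x.
split; first by apply: le_trans (ler_normD _ _) _; rewrite lerD.
exists (fun i => a i + a' i), (fun i j => b i j + b' i j).
split => [i|i j|y]; try by apply: le_trans (ler_normD _ _) _; rewrite lerD.
have -> : \sum_i (a i + a' i) * y i = lin a y + lin a' y.
  by rewrite /lin -big_split; apply: eq_bigr => i _; rewrite mulrDl.
have -> : \sum_i \sum_j (b i j + b' i j) * (y i * y j) = bil b y + bil b' y.
  rewrite /bil -big_split; apply: eq_bigr => i _; rewrite -big_split.
  by apply: eq_bigr => j _; rewrite mulrDl.
have := gab y; have := gab' y.
rewrite -!/(lin _ y) -!/(bil _ y) -!/(len y).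
move=> /ler_normlP[? ?] /ler_normlP[? ?].
by apply/ler_normlP; split; lra.
Qed.

Lemma smooth_testM g1 g2 : smooth_test g1 -> smooth_test g2 ->
  smooth_test (fun x => g1 x * g2 x).
Proof.
move=> [m1 [M1 [K1 [M10 K10 b1]]]] [m2 [M2 [K2 [M20 K20 b2]]]]; split.
  by move=> d T e me; apply: measurable_funM; [exact: m1|exact: m2].
pose M := M1 + M2; pose K := K1 + K2.
have M0 : 0 <= M by rewrite addr_ge0.
have K0 : 0 <= K by rewrite addr_ge0.
have leM1 (z : R) : z <= M1 -> z <= M by move=> h; rewrite (le_trans h)// lerDl.
have leM2 (z : R) : z <= M2 -> z <= M by move=> h; rewrite (le_trans h)// lerDr.
exists (3 * M ^+ 2), (4 * M * K + 7 * M ^+ 2).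
split; [by rewrite mulr_ge0// sqr_ge0|by rewrite addr_ge0// !mulr_ge0// sqr_ge0|move=> x].
have [/leM1 gM1 [a [b [aM bM gab]]]] := b1 x.
have [/leM2 gM2 [a' [b' [aM' bM' gab']]]] := b2 x.
have MM (z z' : R) : `|z| <= M -> `|z'| <= M -> `|z * z'| <= M ^+ 2.
  by move=> h h'; rewrite normrM expr2 ler_pM.
have M20' : 0 <= M ^+ 2 := sqr_ge0 M.
split; first by apply: le_trans (MM _ _ gM1 gM2) _; lra.
exists (fun i => a i * g2 x + a' i * g1 x),
  (fun i j => b i j * g2 x + b' i j * g1 x + a i * a' j).
split => [i|i j|y].
- have := MM _ _ (leM1 _ (aM i)) gM2; have := MM _ _ (leM2 _ (aM' i)) gM1.
  by move=> /ler_normlP[? ?] /ler_normlP[? ?]; apply/ler_normlP; split; lra.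
- have := MM _ _ (leM1 _ (bM i j)) gM2; have := MM _ _ (leM2 _ (bM' i j)) gM1.
  have := MM _ _ (leM1 _ (aM i)) (leM2 _ (aM' j)).
  move=> /ler_normlP[? ?] /ler_normlP[? ?] /ler_normlP[? ?].
  by apply/ler_normlP; split; lra.
have -> : \sum_i (a i * g2 x + a' i * g1 x) * y i = lin a y * g2 x + lin a' y * g1 x.
  rewrite /lin !mulr_suml -big_split; apply: eq_bigr => i _ /=; ring.
have -> : \sum_i \sum_j (b i j * g2 x + b' i j * g1 x + a i * a' j) * (y i * y j) =
    bil b y * g2 x + bil b' y * g1 x + lin a y * lin a' y.
  rewrite /bil /lin !mulr_suml -!big_split; apply: eq_bigr => i _ /=.
  rewrite !mulr_suml mulr_sumr -!big_split; apply: eq_bigr => j _ /=; ring.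
have [/leM1 GM1 _] := b1 (fun i => x i + y i).
have [/leM2 GM2 _] := b2 (fun i => x i + y i).
have L1 := lin_le y (fun i => leM1 _ (aM i)).
have L2 := lin_le y (fun i => leM2 _ (aM' i)).
have Q1 := bil_le y (fun i j => leM1 _ (bM i j)).
have Q2 := bil_le y (fun i j => leM2 _ (bM' i j)).
have := gab y; have := gab' y.
rewrite -!/(lin _ y) -!/(bil _ y) -!/(len y).
set G1 := g1 _ in GM1 *; set G2 := g2 _ in GM2 *.
move: (lin a y) (lin a' y) (bil b y) (bil b' y) L1 L2 Q1 Q2 => l1 l2 q1 q2 L1 L2 Q1 Q2.
move: (g1 x) (g2 x) gM1 gM2 => h1 h2 gM1 gM2.
set s := len y in L1 L2 Q1 Q2 *; have s0 : 0 <= s := len_ge0 y.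
pose r1 := G1 - h1 - l1 - q1; pose r2 := G2 - h2 - l2 - q2.
rewrite -/r1 -/r2 => rb2 rb1.
have s3 : 0 <= s ^+ 3 by rewrite exprn_ge0.
have {}rb1 : `|r1| <= K * s ^+ 3.
  by apply: le_trans rb1 _; rewrite ler_wpM2r// lerDl.
have {}rb2 : `|r2| <= K * s ^+ 3.
  by apply: le_trans rb2 _; rewrite ler_wpM2r// lerDr.
have pr (u v A B : R) : `|u| <= A -> `|v| <= B -> `|u * v| <= A * B.
  by move=> *; rewrite normrM ler_pM.
have [s1|s1] := leP s 1.
  (* Short increments: multiply the two expansions; all terms left over are of third order or
     higher. *)
  have s2 : s ^+ 2 <= s by rewrite expr2 ler_piMl.
  have -> : G1 * G2 - h1 * h2 - (l1 * h2 + l2 * h1) - (q1 * h2 + q2 * h1 + l1 * l2) =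
    G1 * r2 + r1 * (h2 + l2 + q2) + l1 * q2 + q1 * l2 + q1 * q2.
    by rewrite /r1 /r2; ring.
  have t0 : `|h2 + l2 + q2| <= 3 * M.
    apply: le_trans (ler_normD _ _) _; apply: le_trans (lerD (ler_normD _ _) (lexx _)) _.
    have : M * s <= M by rewrite ler_piMr.
    have : M * s ^+ 2 <= M * s by rewrite ler_wpM2l.
    lra.
  have t1' := pr _ _ _ _ GM1 rb2.
  have t2 := pr _ _ _ _ rb1 t0.
  have t3 := pr _ _ _ _ L1 Q2.
  have t4 := pr _ _ _ _ Q1 L2.
  have t5 := pr _ _ _ _ Q1 Q2.
  have s43 : s ^+ 4 <= s ^+ 3 by rewrite [leLHS]exprS ler_piMl.
  have e5 : M * s ^+ 2 * (M * s ^+ 2) <= M ^+ 2 * s ^+ 3.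
    have -> : M * s ^+ 2 * (M * s ^+ 2) = M ^+ 2 * s ^+ 4 by ring.
    by rewrite ler_wpM2l.
  have M2s3 : 0 <= M ^+ 2 * s ^+ 3 by rewrite mulr_ge0.
  apply: le_trans (ler_normD _ _) _; apply: le_trans (lerD (ler_normD _ _) (lexx _)) _.
  apply: le_trans (lerD (lerD (ler_normD _ _) (lexx _)) (lexx _)) _.
  apply: le_trans (lerD (lerD (lerD (ler_normD _ _) (lexx _)) (lexx _)) (lexx _)) _.
  apply: le_trans (lerD (lerD (lerD (lerD t1' t2) t3) t4) (le_trans t5 e5)) _.
  have -> : M * (K * s ^+ 3) + K * s ^+ 3 * (3 * M) + M * s * (M * s ^+ 2)
    + M * s ^+ 2 * (M * s) + M ^+ 2 * s ^+ 3 = (4 * M * K + 3 * M ^+ 2) * s ^+ 3 by ring.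
  rewrite ler_wpM2r//; lra.
(* Long increments: each of the seven products is at most M^2 s^3, whence the term 7 M^2 of the
   constant. *)
have s12 : s <= s ^+ 3 by rewrite exprS ler_peMr// expr_ge1// ltW.
have s23 : s ^+ 2 <= s ^+ 3 by rewrite [leRHS]exprS ler_peMl ?sqr_ge0// ltW.
have s03 : 1 <= s ^+ 3 by rewrite expr_ge1// ltW.
have t1 := pr _ _ _ _ GM1 GM2; have t2 := pr _ _ _ _ gM1 gM2.
have t3 := pr _ _ _ _ L1 gM2; have t4 := pr _ _ _ _ L2 gM1.
have t5 := pr _ _ _ _ Q1 gM2; have t6 := pr _ _ _ _ Q2 gM1.
have t7 := pr _ _ _ _ L1 L2.
have e1 : M * M <= M ^+ 2 * s ^+ 3 by rewrite -expr2 ler_peMr.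
have e2 : M * s * M <= M ^+ 2 * s ^+ 3.
  by have -> : M * s * M = M ^+ 2 * s by [ring]; rewrite ler_wpM2l.
have e3 : M * s ^+ 2 * M <= M ^+ 2 * s ^+ 3.
  by have -> : M * s ^+ 2 * M = M ^+ 2 * s ^+ 2 by [ring]; rewrite ler_wpM2l.
have e4 : M * s * (M * s) <= M ^+ 2 * s ^+ 3.
  by have -> : M * s * (M * s) = M ^+ 2 * s ^+ 2 by [ring]; rewrite ler_wpM2l.
have e5 : 0 <= M * K * s ^+ 3 by rewrite !mulr_ge0.
move: t1 t2 t3 t4 t5 t6 t7 => /ler_normlP[? ?] /ler_normlP[? ?] /ler_normlP[? ?]
  /ler_normlP[? ?] /ler_normlP[? ?] /ler_normlP[? ?] /ler_normlP[? ?].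
by apply/ler_normlP; split; lra.
Qed.

Lemma smooth_test_sum {J : Type} (r : seq J) (G : J -> (I -> R) -> R) :
  (forall j, smooth_test (G j)) -> smooth_test (fun x => \sum_(j <- r) G j x).
Proof.
move=> sG; elim: r => [|j r ih].
  by under eq_fun do rewrite big_nil; exact: smooth_test_cst.
by under eq_fun do rewrite big_cons; exact: smooth_testD.
Qed.

Lemma smooth_test_prod {J : Type} (r : seq J) (G : J -> (I -> R) -> R) :
  (forall j, smooth_test (G j)) -> smooth_test (fun x => \prod_(j <- r) G j x).
Proof.
move=> sG; elim: r => [|j r ih].
  by under eq_fun do rewrite big_nil; exact: smooth_test_cst.
by under eq_fun do rewrite big_cons; exact: smooth_testM.
Qed.

Lemma smooth_test_step (i0 : I) (c k : R) :
  smooth_test (fun x => cubic_step (c * x i0 + k)).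
Proof.
pose f u := cubic_step (c * u + k) : R.
have mf : measurable_fun setT f.
  apply: (measurableT_comp measurable_cubic_step).
  by apply: measurable_funD => //; exact: measurable_funM.
apply: (@smooth_test_coord i0 f (1 + 36 * `|c| + 36 * c ^+ 2) (2 * `|c| ^+ 3)) => //.
  by have := sqr_ge0 c; have := normr_ge0 c; lra.
move=> u; have n0 : 0 <= `|c| by []; have s0 := sqr_ge0 c; split.
  by have /andP[? ?] := cubic_step_range (c * u + k); rewrite /f ger0_norm//; lra.
have [a [b [aM bM ab]]] := cubic_step_taylor (c * u + k).
exists (a * c), (b * c ^+ 2); split => [||t].
- rewrite normrM; have : `|a| * `|c| <= 36 * `|c| by rewrite ler_wpM2r.
  lra.
- rewrite normrM (ger0_norm s0); have : `|b| * c ^+ 2 <= 36 * c ^+ 2 by rewrite ler_wpM2r.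
  lra.
have := ab (c * t).
have -> : f (u + t) = cubic_step (c * u + k + c * t) by rewrite /f; congr cubic_step; ring.
have -> : b * (c * t) ^+ 2 = b * c ^+ 2 * t ^+ 2 by ring.
have -> : 2 * `|c * t| ^+ 3 = 2 * `|c| ^+ 3 * `|t| ^+ 3 by rewrite normrM; ring.
by rewrite /f mulrA.
Qed.

End smooth_test_functions.

Section convergence_in_law.
Context {R : realType} {I : finType}.
Implicit Types (F g : (I -> R) -> R) (x y : I -> R).

Definition coordwise_continuous F : Prop := forall x (e : R), 0 < e ->
  exists2 r : R, 0 < r & forall y, (forall i, `|y i - x i| < r) -> `|F y - F x| < e.

Section spline_minorant.
Variables (F : (I -> R) -> R) (M : R).
Hypothesis F0 : forall x, 0 <= F x.
Hypothesis FM : forall x, F x <= M.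

(** The mesh is 1/m with m^2 nodes on each side of 0: the grid gets finer while its window, of
    half-width m, exhausts the line. *)
Let side (m : nat) : nat := (m ^ 2)%N.

Let node (m : nat) := {ffun I -> 'I_(side m + side m)}.

Let pos m (k : nat) (u : R) : R := m%:R * u + ((side m)%:R - k%:R).

Let spline m k u : R := cubic_step (pos m k u) - cubic_step (pos m k u - 1).

Let weight m (ka : node m) x : R := \prod_i spline m (ka i) (x i).

Let cell m (ka : node m) : set (I -> R) :=
  [set y | forall i, 0 <= pos m (ka i) (y i) <= 4].

Let low m (ka : node m) : R := inf (F @` cell ka).

(* Replacing the values of F near each grid point by their infimum makes the
   spline interpolant a minorant of F, converging by mere continuity. *)
Definition spline_minorant m x : R := \sum_(ka : node m) low ka * weight ka x.

Let spline_ge0 m k u : 0 <= spline m k u. Proof. exact: cubic_step_spline. Qed.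

Let weight_ge0 m (ka : node m) x : 0 <= weight ka x.
Proof. by apply: prodr_ge0 => i _; exact: spline_ge0. Qed.

Let weight_cell m (ka : node m) x : weight ka x != 0 -> cell ka x.
Proof.
move=> /prodf_neq0 h i; have := h i isT; apply: contra_neqT.
rewrite negb_and -!ltNge /spline => /orP[u0|u4].
  by rewrite !cubic_step0 ?subrr//; lra.
by rewrite !cubic_step1 ?subrr//; lra.
Qed.

(** Distributivity turns the sum over the grid into a product of one-dimensional sums, each of which
    telescopes. Each factor is 1 well inside the window. *)
Let sum_weight m x : \sum_(ka : node m) weight ka x =
  \prod_i (cubic_step (m%:R * x i + (side m)%:R) - cubic_step (m%:R * x i - (side m)%:R)).
Proof.
rewrite -(bigA_distr_bigA (fun i (k : 'I_(side m + side m)) => spline m k (x i))).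
apply: eq_bigr => i _.
pose f (k : nat) := - cubic_step (pos m k (x i)).
rewrite (eq_bigr (fun k : 'I__ => f k.+1 - f k)); last first.
  move=> k _; rewrite /f /spline opprK [RHS]addrC; congr (_ - _).
  by congr cubic_step; rewrite /pos -natr1; ring.
rewrite -(big_mkord xpredT (fun k => f k.+1 - f k)) telescope_sumr//.
have p0 : pos m 0 (x i) = m%:R * x i + (side m)%:R by rewrite /pos subr0.
have p1 : pos m (side m + side m) (x i) = m%:R * x i - (side m)%:R.
  by rewrite /pos natrD; ring.
by rewrite /f p0 p1 opprK addrC.
Qed.

Let sum_weight_le1 m x : \sum_(ka : node m) weight ka x <= 1.
Proof.
have h0 : 0 <= \sum_(ka : node m) weight ka x by apply: sumr_ge0 => ka _; exact: weight_ge0.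
rewrite sum_weight in h0 *.
rewrite (le_trans (ler_norm _))// normr_prod; apply: prodr_ile1 => i _.
rewrite normr_ge0 /=; apply/ler_normlP.
have /andP[? ?] := cubic_step_range (m%:R * x i + (side m)%:R).
have /andP[? ?] := cubic_step_range (m%:R * x i - (side m)%:R).
by split; lra.
Qed.

Let low_lb m (ka : node m) x : cell ka x -> low ka <= F x.
Proof.
move=> cx; apply: inf_lbound; last by exists x.
by exists 0 => _ [y _ <-].
Qed.

Let low_ge m (ka : node m) x c : cell ka x -> (forall y, cell ka y -> c <= F y) -> c <= low ka.
Proof.
move=> cx h; apply: lb_le_inf; first by exists (F x), x.
by move=> _ [y cy <-]; exact: h.
Qed.

Let low_weight_le m (ka : node m) x : low ka * weight ka x <= F x * weight ka x.
Proof.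
have [->|w0] := eqVneq (weight ka x) 0; first by rewrite !mulr0.
by rewrite ler_wpM2r// low_lb//; exact: weight_cell.
Qed.

Lemma spline_minorant_le m x : spline_minorant m x <= F x.
Proof.
apply: (@le_trans _ _ (\sum_(ka : node m) F x * weight ka x)).
  by apply: ler_sum => ka _; exact: low_weight_le.
by rewrite -mulr_sumr ler_piMr.
Qed.

Lemma spline_minorant_ge0 m x : 0 <= spline_minorant m x.
Proof.
apply: sumr_ge0 => ka _; have [->|w0] := eqVneq (weight ka x) 0; first by rewrite mulr0.
by rewrite mulr_ge0// (low_ge (weight_cell w0)).
Qed.

Lemma smooth_spline_minorant m : smooth_test (spline_minorant m).
Proof.
apply: smooth_test_sum => ka; apply: smooth_testM; first exact: smooth_test_cst.
apply: smooth_test_prod => i; apply: smooth_testD; first exact: smooth_test_step.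
rewrite (_ : (fun x => _) =
  (fun x => -1 * cubic_step (m%:R * x i + ((side m)%:R - (ka i)%:R - 1)))).
  by apply: smooth_testM; [exact: smooth_test_cst|exact: smooth_test_step].
by apply/funext => x; rewrite mulN1r; congr (- cubic_step _); rewrite /pos; ring.
Qed.

Hypothesis cF : coordwise_continuous F.

Lemma spline_minorant_cvg x : spline_minorant ^~ x @ \oo --> F x.
Proof.
apply/cvgrPdist_le => e e0.
have [r r0 hr] := cF x e0.
pose L : R := \sum_i `|x i|.
have xL i : `|x i| <= L by rewrite /L (bigD1 i)//= lerDl sumr_ge0.
have L0 : 0 <= L by exact: sumr_ge0.
near=> m.
(* Cells have side 4/m; they must fit into the radius of continuity at [x]. *)
have mr : 4 < m%:R * r.
  by rewrite -ltr_pdivrMr//; near: m; exact: nbhs_infty_gtr.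
(* Puts [x] inside the window with a margin, so that the weights sum to 1. *)
have mL : L + 4 <= m%:R by near: m; exact: nbhs_infty_ger.
have m0 : 0 < m%:R :> R by lra.
have sE : (side m)%:R = m%:R * m%:R :> R by rewrite /side natrX expr2.
suff : F x - e <= spline_minorant m x.
  have := spline_minorant_le m x; move=> ? ?.
  by apply/ler_normlP; split; lra.
have W1 : \sum_(ka : node m) weight ka x = 1.
  rewrite sum_weight big1// => i _.
  have := xL i => /ler_normlP[x1 x2].
  have h1 : m%:R * (- x i) <= m%:R * L by rewrite ler_wpM2l// ltW.
  have h2 : m%:R * x i <= m%:R * L by rewrite ler_wpM2l// ltW.
  have h3 : m%:R * (L + 4) <= m%:R * m%:R by rewrite ler_wpM2l// ltW.
  rewrite cubic_step1 ?cubic_step0 ?subr0// sE; lra.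
rewrite -[leLHS]mulr1 -W1 mulr_sumr; apply: ler_sum => ka _.
have [->|w0] := eqVneq (weight ka x) 0; first by rewrite !mulr0.
have cx := weight_cell w0.
rewrite ler_wpM2r//; apply: (low_ge cx) => y cy.
have : `|F y - F x| < e.
  apply: hr => i; have := cx i; have := cy i; rewrite /pos => /andP[a1 a2] /andP[a3 a4].
  rewrite -(ltr_pM2l m0); apply: le_lt_trans mr.
  rewrite -[X in X * _](ger0_norm (ltW m0)) -normrM; apply/ler_normlP; split; lra.
by move=> /ltr_normlP[? ?]; lra.
Unshelve. all: by end_near.
Qed.

End spline_minorant.

(** After a shift by [M] the function is the pointwise limit of its spline minorants, which are
    measurable as smooth test functions. *)
Lemma coordwise_continuous_measurable F (M : R) : (forall x, `|F x| <= M) ->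
  coordwise_continuous F -> coord_measurable F.
Proof.
move=> FM cF d T c mc.
pose G x := F x + M.
have G0 (x : I -> R) : 0 <= G x by have /ler_normlP[] := FM x; rewrite /G; lra.
have GM (x : I -> R) : G x <= M + M by have /ler_normlP[] := FM x; rewrite /G; lra.
have cG : coordwise_continuous G.
  by move=> x e /(cF x)[r r0 hr]; exists r => // y /hr; rewrite /G opprD addrACA subrr addr0.
have mG : measurable_fun setT (fun t => G (c ^~ t)).
  apply: (measurable_fun_cvg (h := fun m t => spline_minorant G m (c ^~ t))).
    move=> m; have [mm _] := smooth_spline_minorant G m; exact: mm.
  by move=> t _; exact: (spline_minorant_cvg G0 cG).
rewrite (_ : (fun t => _) = (fun t => G (c ^~ t) - M)).
  exact: measurable_funB.
by apply/funext => t; rewrite /G addrK.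
Qed.

Section portmanteau.
Context {d d2} {T : measurableType d} {T2 : measurableType d2}.
Variables (P : probability T R) (P2 : probability T2 R).
Variables (Z : nat -> I -> T -> R) (Y : I -> T2 -> R).
Hypothesis mZ : forall n i, measurable_fun setT (Z n i).
Hypothesis mY : forall i, measurable_fun setT (Y i).
Hypothesis ZY : forall g, smooth_test g ->
  \int[P]_t g ((Z n) ^~ t) @[n --> \oo] --> \int[P2]_t g (Y ^~ t).

(** One minorant, chosen by dominated convergence, loses at most e/2 of the limiting integral;
    convergence for that single test function costs the other e/2. *)
Let lower F (M e : R) : (forall x, 0 <= F x) -> (forall x, F x <= M) ->
  coordwise_continuous F -> 0 < e ->
  \forall n \near \oo, \int[P2]_t F (Y ^~ t) - e <= \int[P]_t F ((Z n) ^~ t).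
Proof.
move=> F0 FM cF e0.
have FMn x : `|F x| <= M by rewrite ger0_norm.
have mF := coordwise_continuous_measurable FMn cF.
pose g m := spline_minorant F m.
have sg m : smooth_test (g m) := smooth_spline_minorant F m.
have g0 m x : 0 <= g m x := spline_minorant_ge0 F0 m x.
have gF m x : g m x <= F x := spline_minorant_le F0 m x.
have gM m x : `|g m x| <= M by rewrite ger0_norm// (le_trans (gF m x)).
have mgY m : measurable_fun setT (fun t => g m (Y ^~ t)) by have [mm _] := sg m; exact: mm.
have mFY : measurable_fun setT (fun t => F (Y ^~ t)) by exact: mF.
have igY m : P2.-integrable setT (EFin \o (fun t => g m (Y ^~ t))).
  by apply: bounded_integrable => //; exists M.
have iFY : P2.-integrable setT (EFin \o (fun t => F (Y ^~ t))).
  by apply: bounded_integrable => //; exists M.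
have cvgE : \int[P2]_t g m (Y ^~ t) @[m --> \oo] --> \int[P2]_t F (Y ^~ t).
  apply: fine_cvg; rewrite -/(Rintegral _ _ _) EFin_Rintegral//.
  apply: (dominated_cvg measurableT (g := fun=> M%:E)) => //.
  - by move=> m; exact/measurable_EFinP.
  - move=> t _; apply: cvg_EFin; first by near=> m.
    exact: (spline_minorant_cvg F0 cF).
  - by apply: (bounded_integrable P2 (f := fun=> M)) => //; exists `|M|.
  - by move=> m t _; rewrite /= lee_fin.
have e2 : 0 < e / 2 by rewrite divr_gt0.
have /cvgrPdist_le/(_ _ e2)[m _ /(_ m (leqnn m)) hm] := cvgE.
have /cvgrPdist_le/(_ _ e2) := ZY (sg m).
apply: filterS => n hn.
have mgZ : measurable_fun setT (fun t => g m ((Z n) ^~ t)) by have [mm _] := sg m; exact: mm.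
have mFZ : measurable_fun setT (fun t => F ((Z n) ^~ t)) by exact: mF.
have : \int[P]_t g m ((Z n) ^~ t) <= \int[P]_t F ((Z n) ^~ t).
  apply: le_Rintegral => //.
  - by apply: bounded_integrable => //; exists M.
  - by apply: bounded_integrable => //; exists M.
move: hm hn => /ler_normlP[? ?] /ler_normlP[? ?]; lra.
Unshelve. all: by end_near.
Qed.

(** The one-sided bound for both F + M and M - F. *)
Lemma portmanteau F (M : R) : (forall x, `|F x| <= M) -> coordwise_continuous F ->
  \int[P]_t F ((Z n) ^~ t) @[n --> \oo] --> \int[P2]_t F (Y ^~ t).
Proof.
move=> FM cF.
have mF := coordwise_continuous_measurable FM cF.
have iFY : P2.-integrable setT (EFin \o (fun t => F (Y ^~ t))).
  by apply: bounded_integrable; [exact: mF|exists M].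
have iFZ n : P.-integrable setT (EFin \o (fun t => F ((Z n) ^~ t))).
  by apply: bounded_integrable; [exact: mF|exists M].
have iM d0 (T0 : measurableType d0) (P0 : probability T0 R) :
    P0.-integrable setT (EFin \o (fun=> M)).
  by apply: bounded_integrable => //; exists `|M|.
apply/cvgrPdist_le => e e0.
have low1 : \forall n \near \oo, \int[P2]_t (F (Y ^~ t) + M) - e <= \int[P]_t (F ((Z n) ^~ t) + M).
  apply: (lower (F := fun x => F x + M) (M := M + M)) => //.
  - by move=> x; have /ler_normlP[] := FM x; lra.
  - by move=> x; have /ler_normlP[] := FM x; lra.
  - by move=> x e1 /(cF x)[r r0 hr]; exists r => // y /hr; rewrite opprD addrACA subrr addr0.
have low2 : \forall n \near \oo, \int[P2]_t (M - F (Y ^~ t)) - e <= \int[P]_t (M - F ((Z n) ^~ t)).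
  apply: (lower (F := fun x => M - F x) (M := M + M)) => //.
  - by move=> x; have /ler_normlP[] := FM x; lra.
  - by move=> x; have /ler_normlP[] := FM x; lra.
  - move=> x e1 /(cF x)[r r0 hr]; exists r => // y /hr.
    by have -> : M - F y - (M - F x) = - (F y - F x) by [ring]; rewrite normrN.
near=> n.
have : \int[P2]_t (F (Y ^~ t) + M) - e <= \int[P]_t (F ((Z n) ^~ t) + M) by near: n.
have : \int[P2]_t (M - F (Y ^~ t)) - e <= \int[P]_t (M - F ((Z n) ^~ t)) by near: n.
have E1 d0 (T0 : measurableType d0) (P0 : probability T0 R) (f : T0 -> R) :
    P0.-integrable setT (EFin \o f) ->
    \int[P0]_t (f t + M) = \int[P0]_t f t + M /\
    \int[P0]_t (M - f t) = M - \int[P0]_t f t.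
  move=> intf; have iM0 := iM _ _ P0.
  have EM : \int[P0]_t M = M by exact: Rintegral_cst1.
  by split; [rewrite RintegralD// EM|rewrite RintegralB// EM].
have [-> ->] := E1 _ _ _ _ iFY; have [-> ->] := E1 _ _ _ _ (iFZ n) => ? ?.
by apply/ler_normlP; split; lra.
Unshelve. all: by end_near.
Qed.

End portmanteau.
End convergence_in_law.

(** * The complex plane *)

Section complex_modulus.
Context {R : realType}.
Implicit Types (z w : R[i]).

(** The norm of R[i] takes values in R[i]; this is the same modulus as a real number. *)
Definition modc z : R := complex.Re `|z|.

Lemma normE z : `|z| = (modc z)%:C.
Proof. by rewrite /modc normc_def. Qed.

Lemma modcE z : modc z = Num.sqrt (complex.Re z ^+ 2 + complex.Im z ^+ 2).
Proof. by rewrite /modc normc_def. Qed.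

Lemma modc_ge0 z : 0 <= modc z.
Proof. by rewrite modcE sqrtr_ge0. Qed.

Lemma modcM z w : modc (z * w) = modc z * modc w.
Proof. by apply: complexI; rewrite rmorphM /= -!normE normrM. Qed.

Lemma modcV z : modc z^-1 = (modc z)^-1.
Proof. by apply: complexI; rewrite fmorphV /= -!normE normfV. Qed.

Lemma modcD z w : modc (z + w) <= modc z + modc w.
Proof. by rewrite -lecR rmorphD /= -!normE ler_normD. Qed.

Lemma modcN z : modc (- z) = modc z.
Proof. by rewrite /modc normrN. Qed.

Lemma modcB z w : modc (z - w) <= modc z + modc w.
Proof. by rewrite -(modcN w) modcD. Qed.

Lemma modc_distC z w : modc (z - w) = modc (w - z).
Proof. by rewrite -modcN opprB. Qed.

Lemma modc0 : modc 0 = 0.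
Proof. by rewrite /modc normr0. Qed.

Lemma modc1 : modc 1 = 1.
Proof. by rewrite /modc normr1. Qed.

Lemma modc_eq0 z : (modc z == 0) = (z == 0).
Proof. by rewrite -(normr_eq0 z) normE eq_complex /= eqxx andbT. Qed.

Lemma modc_gt0 z : (0 < modc z) = (z != 0).
Proof. by rewrite lt_def modc_ge0 andbT modc_eq0. Qed.

Lemma modcX z n : modc (z ^+ n) = modc z ^+ n.
Proof. by elim: n => [|n ih]; rewrite ?expr0 ?modc1// !exprS modcM ih. Qed.

Lemma modc_real (x : R) : modc x%:C = `|x|.
Proof. by rewrite modcE /= expr0n addr0 sqrtr_sqr. Qed.

Lemma modc_nat n : modc n%:R = n%:R.
Proof. by rewrite -(rmorph_nat (real_complex R)) modc_real ger0_norm. Qed.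

Lemma modc_sum {J : Type} (r : seq J) (Q : pred J) (f : J -> R[i]) :
  modc (\sum_(j <- r | Q j) f j) <= \sum_(j <- r | Q j) modc (f j).
Proof.
elim/big_ind2 : _ => [|x1 x2 y1 y2 h1 h2|j _] //; first by rewrite modc0.
by apply: le_trans (modcD _ _) _; rewrite lerD.
Qed.

Lemma Re_le_modc z : `|complex.Re z| <= modc z.
Proof.
rewrite modcE -sqrtr_sqr; apply: ler_wsqrtr.
by rewrite lerDl sqr_ge0.
Qed.

Lemma Im_le_modc z : `|complex.Im z| <= modc z.
Proof.
rewrite modcE -sqrtr_sqr; apply: ler_wsqrtr.
by rewrite lerDr sqr_ge0.
Qed.

Lemma modc_le_ReIm z : modc z <= `|complex.Re z| + `|complex.Im z|.
Proof.
rewrite modcE -[leRHS]ger0_norm ?addr_ge0// -sqrtr_sqr; apply: ler_wsqrtr.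
rewrite sqrrD !real_normK ?num_real// -addrA lerD2l lerDr.
by rewrite mulrn_wge0// mulr_ge0.
Qed.

Lemma ReD z w : complex.Re (z + w) = complex.Re z + complex.Re w.
Proof. by case: z => ? ?; case: w. Qed.

Lemma ImD z w : complex.Im (z + w) = complex.Im z + complex.Im w.
Proof. by case: z => ? ?; case: w. Qed.

Lemma ReN z : complex.Re (- z) = - complex.Re z.
Proof. by case: z. Qed.

Lemma ImN z : complex.Im (- z) = - complex.Im z.
Proof. by case: z. Qed.

Lemma Re_sum {J : Type} (r : seq J) (Q : pred J) (f : J -> R[i]) :
  complex.Re (\sum_(j <- r | Q j) f j) = \sum_(j <- r | Q j) complex.Re (f j).
Proof. by elim/big_rec2 : _ => // j x y _ <-; rewrite ReD. Qed.

Lemma Im_sum {J : Type} (r : seq J) (Q : pred J) (f : J -> R[i]) :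
  complex.Im (\sum_(j <- r | Q j) f j) = \sum_(j <- r | Q j) complex.Im (f j).
Proof. by elim/big_rec2 : _ => // j x y _ <-; rewrite ImD. Qed.

Lemma ReM z w : complex.Re (z * w) =
  complex.Re z * complex.Re w - complex.Im z * complex.Im w.
Proof. by case: z => ? ?; case: w. Qed.

Lemma ImM z w : complex.Im (z * w) =
  complex.Re z * complex.Im w + complex.Im z * complex.Re w.
Proof. by case: z => ? ?; case: w. Qed.

Lemma ReV z : complex.Re z^-1 = complex.Re z / (complex.Re z ^+ 2 + complex.Im z ^+ 2).
Proof. by case: z. Qed.

Lemma ImV z : complex.Im z^-1 = - complex.Im z / (complex.Re z ^+ 2 + complex.Im z ^+ 2).
Proof. by case: z => a b /=; rewrite mulNr. Qed.

End complex_modulus.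

Section complex_borel.
Context {R : realType}.
Implicit Types (z w : R[i]).

Lemma nbhs_modc (z : R[i]) (A : set R[i]) :
  nbhs z A <-> exists2 r : R, 0 < r & forall w, modc (w - z) < r -> A w.
Proof.
split=> [/nbhs_ballP[e /= e0 zA]|[r r0 zA]].
  exists (complex.Re e); first by move: e0; rewrite ltcE => /andP[].
  move=> w zw; apply: zA; rewrite /ball /=.
  have -> : e = (complex.Re e)%:C by rewrite RRe_real// gtr0_real.
  by rewrite distrC normE ltcR.
apply/nbhs_ballP; exists r%:C; first by rewrite /= ltcR.
by move=> w; rewrite /ball /= distrC normE ltcR; exact: zA.
Qed.

Lemma open_modcP (U : set R[i]) : open U <->
  forall z, U z -> exists2 r : R, 0 < r & forall w, modc (w - z) < r -> U w.
Proof.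
rewrite openE; split => [oU z /oU/nbhs_modc //|h z Uz].
by apply/nbhs_modc; exact: h.
Qed.

Lemma open_modc_ball z (r : R) : open [set w : R[i] | modc (w - z) < r].
Proof.
apply/open_modcP => w /= zw; exists (r - modc (w - z)).
  by rewrite subr_gt0.
move=> u uw /=; have -> : u - z = (u - w) + (w - z) by ring.
by apply: le_lt_trans (modcD _ _) _; rewrite -ltrBrDr.
Qed.

Lemma complex_open_measurable (U : set R[i]) : open U -> measurable U.
Proof. by move=> oU; exact: sub_sigma_algebra. Qed.

Lemma lipschitz_measurable (f : R[i] -> R) :
  (forall z w, `|f z - f w| <= modc (z - w)) -> measurable_fun setT f.
Proof.
move=> lf; apply: (measurability _ (RGenOpens.measurableE R)).
move=> _ [_ [a [b ->] <-]]; apply: measurableI => //.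
apply: complex_open_measurable; apply/open_modcP => z /=; rewrite in_itv /= => /andP[az zb].
exists (Num.min (f z - a) (b - f z)).
  by rewrite lt_min !subr_gt0 az zb.
move=> w; rewrite lt_min => /andP[h1 h2] /=; rewrite in_itv /=.
have := lf w z => /ler_normlP[? ?]; lra.
Qed.

Lemma measurable_Re : measurable_fun setT (@complex.Re R).
Proof.
apply: lipschitz_measurable => z w.
by rewrite -ReN -ReD; exact: Re_le_modc.
Qed.

Lemma measurable_Im : measurable_fun setT (@complex.Im R).
Proof.
apply: lipschitz_measurable => z w.
by rewrite -ImN -ImD; exact: Im_le_modc.
Qed.

(** An open set of the plane is the union of the countably many rational boxes it contains, and the
    preimage of a box is measurable coordinatewise. *)
Lemma measurable_complex {d} {T : measurableType d} (f : T -> R[i]) :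
  measurable_fun setT (fun t => complex.Re (f t)) ->
  measurable_fun setT (fun t => complex.Im (f t)) ->
  measurable_fun setT f.
Proof.
move=> mRe mIm.
apply: (@measurability _ _ _ R[i] setT f (@open R[i])) => //.
move=> _ [U oU <-]; apply: measurableI => //.
pose box (p q : rat * rat) : set R[i] := [set z | (ratr p.1 < complex.Re z < ratr p.2) /\
  (ratr q.1 < complex.Im z < ratr q.2)].
pose Q := [set pq : (rat * rat) * (rat * rat) | box pq.1 pq.2 `<=` U].
have -> : f @^-1` U = \bigcup_pq [set t | Q pq /\ box pq.1 pq.2 (f t)].
  apply/seteqP; split => [t Uft|t [pq _ [Qpq]]]; last exact: Qpq.
  have /open_modcP/(_ _ Uft)[r r0 hr] := oU.
  have r2 : 0 < r / 2 by rewrite divr_gt0.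
  have pick (x : R) : exists2 p : rat * rat, (ratr p.1 < x < ratr p.2) &
      forall y : R, ratr p.1 < y < ratr p.2 -> `|y - x| < r / 2.
    have [p1] := @rat_in_itvoo R (x - r / 2) x ltac:(lra).
    have [p2] := @rat_in_itvoo R x (x + r / 2) ltac:(lra).
    rewrite !in_itv /= => /andP[? ?] /andP[? ?]; exists (p1, p2); first by apply/andP.
    by move=> y /andP[/= ? ?]; apply/ltr_normlP; split; lra.
  have [p xp hp] := pick (complex.Re (f t)); have [q xq hq] := pick (complex.Im (f t)).
  exists (p, q) => //; split; last by split.
  move=> w [/= /hp h1 /hq h2]; apply: hr.
  apply: le_lt_trans (modc_le_ReIm _) _.
  by rewrite ReD ReN ImD ImN; lra.
apply: countable_bigcupT_measurable => [|[p q]]; first by apply: countableP.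
have [Qpq|nQ] := pselect (Q (p, q)); last first.
  rewrite (_ : [set t | _] = set0); first exact: measurable0.
  by apply/seteqP; split => t // -[].
pose itv (r : rat * rat) : set R := `]ratr r.1, ratr r.2[%classic.
rewrite (_ : [set t | _] = ((fun t => complex.Re (f t)) @^-1` itv p) `&`
  ((fun t => complex.Im (f t)) @^-1` itv q)).
  by apply: measurableI; rewrite -[X in measurable X]setTI; [apply: mRe|apply: mIm] => //;
    exact: measurable_itv.
apply/seteqP; split => t /=; rewrite /itv /box /= !in_itv /=; last by move=> [h1 h2]; split.
by move=> [_ [h1 h2]]; split.
Qed.

End complex_borel.

(** * Critical points near a root *)

Lemma deriv_prod_linear {F : fieldType} {J : Type} (r : seq J) (Q : pred J) (a : J -> F) (z : F) :
  (forall j, Q j -> z != a j) ->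
  (\prod_(j <- r | Q j) ('X - (a j)%:P))^`().[z] =
  \prod_(j <- r | Q j) (z - a j) * \sum_(j <- r | Q j) (z - a j)^-1.
Proof.
move=> za; elim: r => [|j r ih]; first by rewrite !big_nil derivC horner0 mulr0.
rewrite !big_cons; case: ifP => // Qj.
have zj : z - a j != 0 by rewrite subr_eq0 za.
have ev : (\prod_(j <- r | Q j) ('X - (a j)%:P)).[z] = \prod_(j <- r | Q j) (z - a j).
  by rewrite horner_prod; apply: eq_bigr => i _; rewrite hornerXsubC.
rewrite derivM derivXsubC mul1r hornerD hornerM hornerXsubC ih ev.
by field.
Qed.

Section geometric_limit.
Context {R : realType}.

Lemma geometric_cvg (u : nat -> R) (C : R) :
  (forall k, `|u k.+1 - u k| <= C * 2^-1 ^+ k) -> cvgn u.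
Proof.
move=> uC; pose v k := u k.+1 - u k.
have cv : cvgn (series v).
  apply: normed_cvg; apply: (series_le_cvg (v_ := geometric C 2^-1)) => //.
  - by move=> k; rewrite normr_ge0.
  - by move=> k; apply: le_trans (uC k); rewrite normr_ge0.
  - by apply: is_cvg_geometric_series; rewrite ger0_norm ?invr_ge0// invf_lt1// ltr1n.
have -> : u = (fun k => series v k + u 0%N).
  apply/funext => k; rewrite /series /= telescope_sumr//.
  by rewrite subrK.
exact: is_cvgD (cv) (is_cvg_cst _).
Qed.

End geometric_limit.

Section critical_points.
Context {R : realType} {s : nat} (xi : 'I_s -> R[i]) (x : nat -> R[i]) (n : nat).
Hypothesis n0 : (0 < n)%N.
Hypothesis sn : (s <= n.+1)%N.
Variable de : R.
Hypothesis de0 : 0 < de.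
Hypothesis xi_sep : forall l j, l != j -> de <= modc (xi l - xi j).
Hypothesis x_sep : forall l (j : nat), (j < n.+1 - s)%N -> de <= modc (x j - xi l).

Let nR : (0 : R) < n%:R. Proof. by rewrite ltr0n. Qed.

Definition pole_sum (l : 'I_s) (z : R[i]) : R[i] :=
  \sum_(j < s | j != l) (z - xi j)^-1 + \sum_(j < n.+1 - s) (z - x j)^-1.

Lemma pole_sum_xi l : pole_sum l (xi l) = reciprocal_sum xi x n l.
Proof. by []. Qed.

Let near_xi l z a : modc (z - xi l) <= de / 2 -> de <= modc (a - xi l) ->
  de / 2 <= modc (z - a).
Proof.
move=> zl al; have := modcD (z - a) (xi l - z).
have -> : z - a + (xi l - z) = - (a - xi l) by ring.
rewrite modcN (modc_distC (xi l)); lra.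
Qed.

Let near_xi_xi l j z : modc (z - xi l) <= de / 2 -> j != l -> de / 2 <= modc (z - xi j).
Proof. by move=> zl jl; apply: near_xi zl _; exact: xi_sep. Qed.

Let near_xi_x l (j : 'I_(n.+1 - s)) z : modc (z - xi l) <= de / 2 -> de / 2 <= modc (z - x j).
Proof. by move=> zl; apply: near_xi zl _; exact: x_sep. Qed.

Let neq_of_sep z a : de / 2 <= modc (z - a) -> z != a.
Proof. by move=> h; rewrite -subr_eq0 -modc_gt0 (lt_le_trans _ h)// divr_gt0. Qed.

(** Write p = (X - xi l) q. Then p' = q (1 + (X - xi l) q'/q), where q'/q is [pole_sum l] and q has
    no zero in the disk. *)
Lemma critical_pointE l z : modc (z - xi l) <= de / 2 ->
  critical_point (poly_of_roots xi x n) z <-> 1 + (z - xi l) * pole_sum l z = 0.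
Proof.
move=> zl; rewrite /critical_point /root /poly_of_roots (bigD1 l)//= -mulrA.
set q1 := \prod_(j < s | j != l) _; set q2 := \prod_(j < n.+1 - s) _.
have z1 j : j != l -> z != xi j by move=> jl; apply: neq_of_sep; exact: near_xi_xi zl jl.
have z2 (j : 'I_(n.+1 - s)) : true -> z != x j.
  by move=> _; apply: neq_of_sep; exact: near_xi_x zl.
have e1 : q1.[z] = \prod_(j < s | j != l) (z - xi j).
  by rewrite horner_prod; apply: eq_bigr => i _; rewrite hornerXsubC.
have e2 : q2.[z] = \prod_(j < n.+1 - s) (z - x j).
  by rewrite horner_prod; apply: eq_bigr => i _; rewrite hornerXsubC.
have q1z : q1.[z] != 0 by rewrite e1; apply/prodf_neq0 => j jl; rewrite subr_eq0 z1.
have q2z : q2.[z] != 0 by rewrite e2; apply/prodf_neq0 => j _; rewrite subr_eq0 z2.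
have d1 : q1^`().[z] = q1.[z] * \sum_(j < s | j != l) (z - xi j)^-1.
  by rewrite e1; exact: deriv_prod_linear.
have d2 : q2^`().[z] = q2.[z] * \sum_(j < n.+1 - s) (z - x j)^-1.
  by rewrite e2; exact: deriv_prod_linear.
have -> : (('X - (xi l)%:P) * (q1 * q2))^`().[z] =
    q1.[z] * q2.[z] * (1 + (z - xi l) * pole_sum l z).
  rewrite derivM derivXsubC mul1r hornerD !hornerM hornerXsubC derivM hornerD !hornerM.
  by rewrite d1 d2 /pole_sum; ring.
rewrite mulf_eq0 mulf_eq0 (negbTE q1z) (negbTE q2z) /=.
by split => [/eqP|->].
Qed.

(** Counts the roots other than [xi l]; the index [l] guarantees that s is positive. *)
Let card_poles (l : 'I_s) : (s.-1 + (n.+1 - s) <= n)%N.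
Proof. by case: s l sn => [[]//|s' _ s'n]; rewrite subSS subnKC. Qed.

Let inv_lip z z' a : de / 2 <= modc (z - a) -> de / 2 <= modc (z' - a) ->
  modc ((z - a)^-1 - (z' - a)^-1) <= 4 / de ^+ 2 * modc (z - z').
Proof.
move=> h h'; have za := neq_of_sep h; have z'a := neq_of_sep h'.
rewrite -subr_eq0 in za; rewrite -subr_eq0 in z'a.
have -> : (z - a)^-1 - (z' - a)^-1 = (z' - z) * ((z - a)^-1 * (z' - a)^-1).
  by field; rewrite za z'a.
rewrite !modcM !modcV modc_distC mulrC ler_wpM2r ?modc_ge0//.
have d2 : 0 < de / 2 by rewrite divr_gt0.
have -> : 4 / de ^+ 2 = (de / 2)^-1 * (de / 2)^-1 by field; rewrite gt_eqF.
by rewrite ler_pM ?invr_ge0 ?modc_ge0// lef_pV2 ?posrE// ?(lt_le_trans d2).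
Qed.

(** At most n poles, all at distance at least de/2, each with Lipschitz constant (2/de)^2. *)
Lemma pole_sum_lip l z z' : modc (z - xi l) <= de / 2 -> modc (z' - xi l) <= de / 2 ->
  modc (pole_sum l z - pole_sum l z') <= n%:R * (4 / de ^+ 2) * modc (z - z').
Proof.
move=> zl z'l; rewrite /pole_sum opprD addrACA -!sumrB.
pose c := 4 / de ^+ 2 * modc (z - z').
have c0 : 0 <= c by rewrite mulr_ge0 ?modc_ge0// divr_ge0// sqr_ge0.
apply: le_trans (modcD _ _) _.
apply: (@le_trans _ _ (\sum_(j < s | j != l) c + \sum_(j < n.+1 - s) c)).
  apply: lerD; apply: le_trans (modc_sum _ _ _) _; apply: ler_sum => j jl.
    by apply: inv_lip; apply: near_xi_xi jl.
  by apply: inv_lip; exact: (near_xi_x (l := l)).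
rewrite !sumr_const card_ord cardC1 card_ord -mulrnDr.
rewrite (_ : n%:R * _ * _ = c *+ n); last by rewrite -mulrA mulr_natl.
exact: ler_wpMn2l (card_poles l).
Qed.

Section one_root.
Variables (l : 'I_s) (mu : R).
Hypothesis mu0 : 0 < mu.
(** 72 limits the variation of [pole_sum] over the disk to mu n / 6 and makes the map a contraction
    by 1/2; 9 bounds the radius by de/3, which keeps the disks around distinct [xi l] disjoint. *)
Hypothesis n_large1 : 72 <= de ^+ 2 * mu ^+ 2 * n%:R.
Hypothesis n_large2 : 9 <= de * mu * n%:R.
Hypothesis pole_sum_large : n%:R * mu / 2 <= modc (pole_sum l (xi l)).

Let r : R := 3 / (mu * n%:R).

Let mn0 : 0 < mu * n%:R. Proof. exact: mulr_gt0. Qed.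

Let r0 : 0 < r. Proof. exact: divr_gt0. Qed.

Let rE : r * (mu * n%:R) = 3. Proof. by rewrite /r divfK// gt_eqF. Qed.

Lemma radius_le : 3 / (mu * n%:R) <= de / 3.
Proof. by rewrite ler_pdivrMr//; have := n_large2; lra. Qed.

Let r_le : r <= de / 2.
Proof. by apply: le_trans radius_le _; have := de0; lra. Qed.

Let lip_const : n%:R * (4 / de ^+ 2) * 18 <= mu ^+ 2 * n%:R ^+ 2.
Proof.
have d2 : 0 < de ^+ 2 by rewrite exprn_gt0.
have -> : n%:R * (4 / de ^+ 2) * 18 = 72 * n%:R / de ^+ 2 by field; rewrite gt_eqF.
rewrite ler_pdivrMr//.
have : 72 * n%:R <= de ^+ 2 * mu ^+ 2 * n%:R * n%:R by rewrite ler_wpM2r.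
by rewrite -mulrA; nra.
Qed.

(** mu n/2 - mu n/6 = mu n/3. This explains the radius 3/(mu n): it is the resulting bound on
    1/|S_l|, so the map sends the disk into itself. *)
Lemma pole_sum_lb z : modc (z - xi l) <= r -> mu * n%:R / 3 <= modc (pole_sum l z).
Proof.
move=> zr; have zl := le_trans zr r_le.
have xl : modc (xi l - xi l) <= de / 2 by rewrite subrr modc0 divr_ge0// ltW.
have h := pole_sum_lip zl xl.
have h2 : n%:R * (4 / de ^+ 2) * modc (z - xi l) <= mu * n%:R / 6.
  apply: (@le_trans _ _ (n%:R * (4 / de ^+ 2) * r)).
    by rewrite ler_wpM2l// mulr_ge0// divr_ge0// sqr_ge0.
  have := lip_const; rewrite -(ler_pM2r r0).
  have -> : mu ^+ 2 * n%:R ^+ 2 * r = 3 * (mu * n%:R) by rewrite -rE; ring.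
  lra.
have := modcD (pole_sum l z) (pole_sum l (xi l) - pole_sum l z).
rewrite addrCA subrr addr0 (modc_distC (pole_sum l (xi l))).
by have := pole_sum_large; lra.
Qed.

Let pole_sum_neq0 z : modc (z - xi l) <= r -> pole_sum l z != 0.
Proof. by move=> /pole_sum_lb h; rewrite -modc_gt0; have := mn0; lra. Qed.

Definition newton_map (z : R[i]) : R[i] := xi l - (pole_sum l z)^-1.

Let modV z : modc (z - xi l) <= r -> modc (pole_sum l z)^-1 <= r.
Proof.
move=> zr; have h := pole_sum_lb zr; rewrite modcV.
have -> : r = (mu * n%:R / 3)^-1 by rewrite invf_div.
by rewrite lef_pV2 ?posrE//; have := mn0; lra.
Qed.

Lemma newton_map_disk z : modc (z - xi l) <= r -> modc (newton_map z - xi l) <= r.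
Proof.
by move=> /modV h; rewrite /newton_map addrAC subrr add0r modcN.
Qed.

(** The Lipschitz constant 4n/de^2 of the pole sum times the square of the bound 3/(mu n) on the
    inverses. *)
Lemma inv_pole_sum_lip z z' : modc (z - xi l) <= r -> modc (z' - xi l) <= r ->
  modc ((pole_sum l z)^-1 - (pole_sum l z')^-1) <= 36 / (de ^+ 2 * mu ^+ 2 * n%:R) * modc (z - z').
Proof.
move=> zr z'r; have p := pole_sum_neq0 zr; have p' := pole_sum_neq0 z'r.
have -> : (pole_sum l z)^-1 - (pole_sum l z')^-1 =
    (pole_sum l z' - pole_sum l z) * ((pole_sum l z)^-1 * (pole_sum l z')^-1).
  by field; rewrite p p'.
rewrite !modcM modc_distC.
have h := pole_sum_lip (le_trans zr r_le) (le_trans z'r r_le).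
have hV : modc (pole_sum l z)^-1 * modc (pole_sum l z')^-1 <= r * r.
  by rewrite ler_pM ?modc_ge0// modV.
apply: le_trans (ler_pM _ _ h hV) _; rewrite ?mulr_ge0 ?modc_ge0//.
rewrite le_eqVlt; apply/orP; left; apply/eqP; rewrite /r.
by field; rewrite !gt_eqF.
Qed.

Let contraction_const : 36 / (de ^+ 2 * mu ^+ 2 * n%:R) <= 2^-1.
Proof.
by rewrite ler_pdivrMr; [have := n_large1; lra|rewrite !mulr_gt0// exprn_gt0].
Qed.

Lemma newton_map_contraction z z' : modc (z - xi l) <= r -> modc (z' - xi l) <= r ->
  modc (newton_map z - newton_map z') <= 2^-1 * modc (z - z').
Proof.
move=> zr z'r; rewrite /newton_map opprB addrC subrKA modc_distC.
apply: le_trans (inv_pole_sum_lip zr z'r) _.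
by rewrite ler_wpM2r ?modc_ge0.
Qed.

Lemma critical_point_fixed z : modc (z - xi l) <= r ->
  critical_point (poly_of_roots xi x n) z <-> newton_map z = z.
Proof.
move=> zr; have p := pole_sum_neq0 zr.
rewrite (critical_pointE (le_trans zr r_le)) /newton_map; split => h.
  have -> : (pole_sum l z)^-1 = - (z - xi l).
    apply: (mulIf p); rewrite mulVf// mulNr.
    by apply/eqP; rewrite -addr_eq0 h.
  by rewrite opprK addrC subrK.
have -> : z - xi l = - (pole_sum l z)^-1 by rewrite -{1}h addrAC subrr add0r.
by rewrite mulNr mulVf// subrr.
Qed.

Lemma fixed_point_unique z z' : modc (z - xi l) <= r -> modc (z' - xi l) <= r ->
  newton_map z = z -> newton_map z' = z' -> z = z'.
Proof.
move=> zr z'r fz fz'; have := newton_map_contraction zr z'r.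
rewrite fz fz' => h; apply/eqP; rewrite -subr_eq0 -modc_eq0 eq_le modc_ge0 andbT.
by have := modc_ge0 (z - z'); lra.
Qed.

Definition newton_iter (k : nat) : R[i] := iter k newton_map (xi l).

Lemma newton_iter_disk k : modc (newton_iter k - xi l) <= r.
Proof.
elim: k => [|k ih]; first by rewrite /newton_iter /= subrr modc0 ltW.
exact: newton_map_disk.
Qed.

Lemma newton_iter_step k : modc (newton_iter k.+1 - newton_iter k) <= r * 2^-1 ^+ k.
Proof.
elim: k => [|k ih]; first by rewrite expr0 mulr1; exact: (newton_iter_disk 1).
apply: le_trans (newton_map_contraction (newton_iter_disk k.+1) (newton_iter_disk k)) _.
by rewrite exprS mulrCA ler_wpM2l.
Qed.

Lemma newton_iter_cvg :
  cvgn (fun k => complex.Re (newton_iter k)) /\ cvgn (fun k => complex.Im (newton_iter k)).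
Proof.
split; apply: (geometric_cvg (C := r)) => k; apply: le_trans (newton_iter_step k).
  by rewrite -ReN -ReD; exact: Re_le_modc.
by rewrite -ImN -ImD; exact: Im_le_modc.
Qed.

(* Defined coordinatewise so that measurability in x is that of a limit of real
   functions. *)
Definition newton_limit : R[i] :=
  limn (fun k => complex.Re (newton_iter k)) +i* limn (fun k => complex.Im (newton_iter k)).

Let newton_limit_close e : 0 < e -> \forall k \near \oo, modc (newton_limit - newton_iter k) <= e.
Proof.
move=> e0; have [cR cI] := newton_iter_cvg; have e2 : 0 < e / 2 by lra.
have /cvgrPdist_le/(_ _ e2) hR := cR; have /cvgrPdist_le/(_ _ e2) hI := cI.
near=> k.
apply: le_trans (modc_le_ReIm _) _; rewrite ReD ReN ImD ImN /=.
have : `|limn (fun k => complex.Re (newton_iter k)) - complex.Re (newton_iter k)| <= e / 2.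
  by near: k.
have : `|limn (fun k => complex.Im (newton_iter k)) - complex.Im (newton_iter k)| <= e / 2.
  by near: k.
lra.
Unshelve. all: by end_near.
Qed.

Lemma newton_limit_disk : modc (newton_limit - xi l) <= r.
Proof.
apply/ler_addgt0Pr => e e0.
have [k _ /(_ k (leqnn k)) h] := newton_limit_close e0.
have := modcD (newton_limit - newton_iter k) (newton_iter k - xi l).
rewrite subrKA; have := newton_iter_disk k; lra.
Qed.

Lemma newton_limit_fixed : newton_map newton_limit = newton_limit.
Proof.
apply/eqP; rewrite -subr_eq0 -modc_eq0 eq_le modc_ge0 andbT.
apply/ler_addgt0Pr => e e0; rewrite add0r.
have e2 : 0 < e / 2 by lra.
have [k _ hk] := newton_limit_close e2.
have h1 := hk k (leqnn k); have h2 := hk k.+1 (leqnSn k).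
have := newton_map_contraction newton_limit_disk (newton_iter_disk k).
have := modcD (newton_map newton_limit - newton_iter k.+1) (newton_iter k.+1 - newton_limit).
rewrite subrKA (modc_distC (newton_iter k.+1)) -[newton_map (newton_iter k)]/(newton_iter k.+1).
have := modc_ge0 (newton_limit - newton_iter k); lra.
Qed.

(** Replacing the fixed point by [xi l] inside S_l costs the Lipschitz constant 36/(de^2 mu^2 n)
    times the radius; replacing 1 by n/(n + 1) costs 1/((n + 1)|S_l|). These are the two terms of
    the constant. *)
Lemma newton_limit_expansion :
  modc (newton_limit - xi l + n.+1%:R^-1 * (n%:R / pole_sum l (xi l)))
    <= (108 / (de ^+ 2 * mu ^+ 3) + 2 / mu) / n%:R ^+ 2.
Proof.
have x0 : modc (xi l - xi l) <= r by rewrite subrr modc0 ltW.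
have p0 := pole_sum_neq0 x0.
have nn : n.+1%:R != 0 :> R[i] by rewrite pnatr_eq0.
have -> : newton_limit - xi l + n.+1%:R^-1 * (n%:R / pole_sum l (xi l)) =
    - ((pole_sum l newton_limit)^-1 - (pole_sum l (xi l))^-1) - n.+1%:R^-1 / pole_sum l (xi l).
  rewrite -{1}newton_limit_fixed /newton_map.
  have -> : n%:R = n.+1%:R - 1 :> R[i] by rewrite -natr1 addrK.
  have pL := pole_sum_neq0 newton_limit_disk.
  move: (n.+1%:R : R[i]) (pole_sum l (xi l)) (pole_sum l newton_limit) nn p0 pL => N S0 SL N0 S00 SL0.
  by field; rewrite N0 S00 SL0.
apply: le_trans (modcB _ _) _; rewrite modcN mulrDl; apply: lerD.
  apply: le_trans (inv_pole_sum_lip newton_limit_disk x0) _.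
  apply: le_trans (ler_wpM2l _ newton_limit_disk) _.
    by rewrite divr_ge0// !mulr_ge0// ?exprn_ge0// ltW.
  rewrite le_eqVlt; apply/orP; left; apply/eqP; rewrite /r.
  by field; rewrite !gt_eqF.
rewrite modcM !modcV modc_nat.
have -> : 2 / mu / n%:R ^+ 2 = n%:R^-1 * (n%:R * mu / 2)^-1 by field; rewrite !gt_eqF.
apply: ler_pM; rewrite ?invr_ge0 ?modc_ge0//.
  by rewrite lef_pV2 ?posrE// ler_nat.
have nm : 0 < n%:R * mu by rewrite mulr_gt0.
have nm2 : 0 < n%:R * mu / 2 by rewrite divr_gt0.
have pp := lt_le_trans nm2 pole_sum_large.
by rewrite lef_pV2 ?posrE.
Qed.

End one_root.
End critical_points.

(** * Truncated poles *)

Section complex_measurable_operations.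
Context {R : realType} {d} {T : measurableType d}.
Implicit Types f g : T -> R[i].

Lemma measurable_invr : measurable_fun setT (fun x : R => x^-1).
Proof.
(* Inversion is continuous only away from 0. *)
have -> : [set: R] = [set 0] `|` ~` [set 0] by rewrite setUv.
apply/measurable_funU => //; first exact: measurableC.
split; first exact: measurable_fun_set1.
apply: open_continuous_measurable_fun.
  by apply: closed_openC; exact: closed_eq.
by move=> x /set_mem /= x0; apply: inv_continuous; apply/eqP.
Qed.

Lemma measurable_Re_comp f : measurable_fun setT f ->
  measurable_fun setT (fun t => complex.Re (f t)).
Proof. by move=> mf; exact: (measurableT_comp measurable_Re mf). Qed.

Lemma measurable_Im_comp f : measurable_fun setT f ->
  measurable_fun setT (fun t => complex.Im (f t)).
Proof. by move=> mf; exact: (measurableT_comp measurable_Im mf). Qed.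

Lemma measurable_complexD f g : measurable_fun setT f -> measurable_fun setT g ->
  measurable_fun setT (fun t => f t + g t).
Proof.
move=> mf mg; apply: measurable_complex.
  under eq_fun do rewrite ReD.
  by apply: measurable_funD; exact: measurable_Re_comp.
under eq_fun do rewrite ImD.
by apply: measurable_funD; exact: measurable_Im_comp.
Qed.

Lemma measurable_complexN f : measurable_fun setT f ->
  measurable_fun setT (fun t => - f t).
Proof.
move=> mf; apply: measurable_complex.
  under eq_fun do rewrite ReN.
  by apply: measurableT_comp => //; exact: measurable_Re_comp.
under eq_fun do rewrite ImN.
by apply: measurableT_comp => //; exact: measurable_Im_comp.
Qed.

Lemma measurable_complexB f g : measurable_fun setT f -> measurable_fun setT g ->
  measurable_fun setT (fun t => f t - g t).
Proof.
by move=> mf mg; apply: measurable_complexD => //; exact: measurable_complexN.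
Qed.

Let mnorm2 f : measurable_fun setT f ->
  measurable_fun setT (fun t => (complex.Re (f t) ^+ 2 + complex.Im (f t) ^+ 2)^-1).
Proof.
move=> mf; apply: (measurableT_comp measurable_invr).
apply: measurable_funD; apply: measurable_funX.
  exact: measurable_Re_comp.
exact: measurable_Im_comp.
Qed.

Lemma measurable_complexV f : measurable_fun setT f ->
  measurable_fun setT (fun t => (f t)^-1).
Proof.
move=> mf; apply: measurable_complex.
  under eq_fun do rewrite ReV.
  by apply: measurable_funM; [exact: measurable_Re_comp|exact: mnorm2].
under eq_fun do rewrite ImV.
apply: measurable_funM; last exact: mnorm2.
by apply: measurableT_comp => //; exact: measurable_Im_comp.
Qed.

Lemma measurable_complexM f g : measurable_fun setT f -> measurable_fun setT g ->
  measurable_fun setT (fun t => f t * g t).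
Proof.
move=> /[dup] /measurable_Re_comp fR /measurable_Im_comp fI.
move=> /[dup] /measurable_Re_comp gR /measurable_Im_comp gI.
apply: measurable_complex.
  by under eq_fun do rewrite ReM; apply: measurable_funB; exact: measurable_funM.
by under eq_fun do rewrite ImM; apply: measurable_funD; exact: measurable_funM.
Qed.

Lemma measurable_complex_sum {J : Type} (r : seq J) (Q : pred J) (F : J -> T -> R[i]) :
  (forall j, measurable_fun setT (F j)) ->
  measurable_fun setT (fun t => \sum_(j <- r | Q j) F j t).
Proof.
move=> mF; elim: r => [|j r ih].
  by under eq_fun do rewrite big_nil; exact: measurable_cst.
under eq_fun do rewrite big_cons; case: (Q j) => //.
exact: measurable_complexD.
Qed.

Lemma measurable_modc f : measurable_fun setT f -> measurable_fun setT (fun t => modc (f t)).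
Proof.
move=> mf; apply: (measurableT_comp _ mf); apply: lipschitz_measurable => z w.
have h1 := modcD (z - w) w; have h2 := modcD (w - z) z.
rewrite subrK in h1; rewrite subrK modc_distC in h2.
by apply/ler_normlP; split; lra.
Qed.

Lemma measurable_modc_lt f (r : R) : measurable_fun setT f ->
  measurable [set t | modc (f t) < r].
Proof.
move=> /measurable_modc mf.
rewrite (_ : [set t | _] = setT `&` (fun t => modc (f t)) @^-1` [set` `]-oo, r[]).
  by apply: mf => //; exact: measurable_itv.
by rewrite setTI; apply/seteqP; split => t /=; rewrite in_itv.
Qed.

End complex_measurable_operations.

Section finite_positive.
Context {R : realType} {J : finType}.

Lemma finite_common_radius (Q : J -> R -> Prop) :
  (forall j, exists2 r : R, 0 < r & Q j r) ->
  (forall j (r r' : R), 0 < r' -> r' <= r -> Q j r -> Q j r') ->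
  exists2 r : R, 0 < r & forall j, Q j r.
Proof.
move=> hQ mono.
suff: forall e : seq J, exists2 r : R, 0 < r & forall j, j \in e -> Q j r.
  by move=> /(_ (enum J))[r r0 h]; exists r => // j; apply: h; rewrite mem_enum.
elim => [|j e [r r0 h]]; first by exists 1.
have [r' r'0 h'] := hQ j; exists (Num.min r r'); first by rewrite lt_min r0 r'0.
move=> k; rewrite inE => /orP[/eqP ->|ke].
  by apply: mono h'; rewrite ?lt_min ?r0 ?r'0// ge_min lexx orbT.
by apply: (mono _ r); [rewrite lt_min r0 r'0|rewrite ge_min lexx|exact: h].
Qed.

End finite_positive.

Section truncated_inverse.
Context {R : realType} (mu : probability R[i] R) (z : R[i]) (de : R).
Hypothesis de0 : 0 < de.
Hypothesis mu_ball : mu [set y : R[i] | modc (y - z) < de] = 0%E.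

(* Bounded, and equal mu-a.e. to the pole it replaces. *)
Definition trunc_inv (y : R[i]) : R[i] := if modc (y - z) < de then 0 else (z - y)^-1.

Let mdiff : measurable_fun setT (fun y : R[i] => y - z).
Proof. by apply: measurable_complexB; [exact: measurable_id|exact: measurable_cst]. Qed.

Let mball : measurable [set y : R[i] | modc (y - z) < de].
Proof. exact: measurable_modc_lt. Qed.

Let minv : measurable_fun setT (fun y : R[i] => (z - y)^-1).
Proof.
by apply: measurable_complexV; apply: measurable_complexB;
  [exact: measurable_cst|exact: measurable_id].
Qed.

Lemma measurable_trunc_inv : measurable_fun setT trunc_inv.
Proof.
apply: measurable_fun_ifT => //.
apply: (measurable_fun_bool true); rewrite (_ : _ `&` _ = [set y : R[i] | modc (y - z) < de])//.
by apply/seteqP; split => y //= -[].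
Qed.

Lemma trunc_inv_le y : modc (trunc_inv y) <= de^-1.
Proof.
rewrite /trunc_inv; case: ltP => [_|h]; first by rewrite modc0 invr_ge0 ltW.
by rewrite modcV modc_distC lef_pV2 ?posrE// (lt_le_trans de0).
Qed.

Lemma trunc_inv_out y : de <= modc (y - z) -> trunc_inv y = (z - y)^-1.
Proof. by move=> h; rewrite /trunc_inv ltNge h. Qed.

Lemma trunc_inv_ae {A : Type} (p : R[i] -> A) :
  {ae mu, forall y, p (trunc_inv y) = p (z - y)^-1}.
Proof.
exists [set y : R[i] | modc (y - z) < de]; split => // y /= h.
by apply: contrapT => /negP; rewrite -leNgt => /trunc_inv_out e; apply: h; rewrite e.
Qed.

End truncated_inverse.

Section covariance_theory.
Context {R : realType}.

Lemma expectation_law {d d'} {T : measurableType d} {T' : measurableType d'}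
    (P : probability T R) (nu : probability T' R) (X : T -> T') (f : T' -> R) :
  measurable_fun setT X -> has_law P X nu -> measurable_fun setT f ->
  ('E_P[fun t => f (X t)] = 'E_nu[f])%E.
Proof.
move=> mX lawX mf; rewrite !expectation.unlock.
apply: (integral_law (nu := nu) mX lawX (f := fun y => (f y)%:E)).
exact/measurable_EFinP.
Qed.

Lemma covariance_law {d d'} {T : measurableType d} {T' : measurableType d'}
    (P : probability T R) (nu : probability T' R) (X : T -> T') (f g : T' -> R) :
  measurable_fun setT X -> has_law P X nu -> measurable_fun setT f -> measurable_fun setT g ->
  covariance P (fun t => f (X t)) (fun t => g (X t)) = covariance nu f g.
Proof.
move=> mX lawX mf mg; rewrite covariance.unlock !(expectation_law mX lawX)//.
set a := fine _; set b := fine _.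
apply: (expectation_law (f := fun y => (f y - a) * (g y - b)) mX lawX).
by apply: measurable_funM; apply: measurable_funB => //; exact: measurable_cst.
Qed.

Context {d} {T : measurableType d} (P : probability T R).

Lemma expectation_ae (f g : T -> R) : measurable_fun setT f -> measurable_fun setT g ->
  {ae P, forall t, f t = g t} -> ('E_P[f] = 'E_P[g])%E.
Proof.
move=> mf mg fg; rewrite !expectation.unlock.
apply: ae_eq_integral => //; try exact/measurable_EFinP.
by apply: filterS fg => t ->.
Qed.

Lemma covariance_ae (f f' g g' : T -> R) :
  measurable_fun setT f -> measurable_fun setT f' ->
  measurable_fun setT g -> measurable_fun setT g' ->
  {ae P, forall t, f t = f' t} -> {ae P, forall t, g t = g' t} ->
  covariance P f g = covariance P f' g'.
Proof.
move=> mf mf' mg mg' ff' gg'; rewrite covariance.unlock.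
rewrite (expectation_ae mf mf' ff') (expectation_ae mg mg' gg').
have mB (u : T -> R) (c : R) : measurable_fun setT u -> measurable_fun setT (u \- cst c).
  by move=> mu; apply: measurable_funB => //; exact: measurable_cst.
apply: expectation_ae; [exact: measurable_funM (mB _ _ mf) (mB _ _ mg)|
  exact: measurable_funM (mB _ _ mf') (mB _ _ mg')|].
by apply: filterS2 ff' gg' => t /= e1 e2; rewrite /GRing.mul/= e1 e2.
Qed.

Lemma covariance_Rintegral (f g : T -> R) (a b : R) :
  P.-integrable setT (EFin \o f) -> P.-integrable setT (EFin \o g) ->
  \int[P]_t f t = a -> \int[P]_t g t = b ->
  P.-integrable setT (EFin \o (fun t => (f t - a) * (g t - b))) ->
  (covariance P f g = (\int[P]_t ((f t - a) * (g t - b)))%:E)%E.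
Proof.
move=> If Ig ea eb Ifg; rewrite covariance.unlock.
have -> : ('E_P[f] = a%:E)%E by rewrite expectation.unlock -ea (EFin_Rintegral If).
have -> : ('E_P[g] = b%:E)%E by rewrite expectation.unlock -eb (EFin_Rintegral Ig).
by rewrite expectation.unlock (EFin_Rintegral Ifg).
Qed.

End covariance_theory.

(** Real and imaginary parts as one family, with the convention of [Re_Im_coordinates], so that the
    plane is treated as real coordinates indexed by ['I_s * bool]. *)
Definition complex_part {R : realType} (b : bool) (z : R[i]) : R :=
  if b then complex.Im z else complex.Re z.

Section complex_part.
Context {R : realType}.

Lemma complex_part_le b (z : R[i]) : `|complex_part b z| <= modc z.
Proof. by case: b; [exact: Im_le_modc|exact: Re_le_modc]. Qed.

Lemma complex_partD b (z w : R[i]) :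
  complex_part b (z + w) = complex_part b z + complex_part b w.
Proof. by case: b; [exact: ImD|exact: ReD]. Qed.

Lemma complex_partN b (z : R[i]) : complex_part b (- z) = - complex_part b z.
Proof. by case: b; [exact: ImN|exact: ReN]. Qed.

Lemma complex_part_sum b {J : Type} (r : seq J) (Q : pred J) (f : J -> R[i]) :
  complex_part b (\sum_(j <- r | Q j) f j) = \sum_(j <- r | Q j) complex_part b (f j).
Proof. by case: b; [exact: Im_sum|exact: Re_sum]. Qed.

Lemma measurable_complex_part {d} {T : measurableType d} b (f : T -> R[i]) :
  measurable_fun setT f -> measurable_fun setT (fun t => complex_part b (f t)).
Proof. by case: b; [exact: measurable_Im_comp|exact: measurable_Re_comp]. Qed.

End complex_part.

Section off_support.
Context {R : realType} (mu : probability R[i] R).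

Let mball (z : R[i]) (r : R) : measurable [set y : R[i] | modc (y - z) < r].
Proof. by apply: complex_open_measurable; exact: open_modc_ball. Qed.

Lemma null_ball_off_support (z : R[i]) : ~ measure_support mu z ->
  exists2 r : R, 0 < r & mu [set y : R[i] | modc (y - z) < r] = 0%E.
Proof.
move=> /existsNP[U /not_implyP[[oU Uz] /negP]]; rewrite -leNgt => U0.
have [r r0 rU] := (open_modcP U).1 oU z Uz; exists r => //.
apply/eqP; rewrite eq_le measure_ge0 andbT; apply: le_trans U0.
by apply: le_measure; rewrite ?inE//; exact: complex_open_measurable.
Qed.

Lemma null_ball_sub (z : R[i]) (r r' : R) : r' <= r ->
  mu [set y : R[i] | modc (y - z) < r] = 0%E -> mu [set y : R[i] | modc (y - z) < r'] = 0%E.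
Proof.
move=> rr' h; apply/eqP; rewrite eq_le measure_ge0 andbT -h.
apply: le_measure; rewrite ?inE//.
by move=> y /= /lt_le_trans; exact.
Qed.

Lemma separation_radius {s : nat} (xi : 'I_s -> R[i]) : injective xi ->
  (forall l, ~ measure_support mu (xi l)) ->
  exists2 de : R, 0 < de &
    (forall l j, l != j -> de <= modc (xi l - xi j)) /\
    (forall l, mu [set y : R[i] | modc (y - xi l) < de] = 0%E).
Proof.
move=> xi_inj xi_out.
pose Q l (r : R) := (forall j, l != j -> r <= modc (xi l - xi j)) /\
  mu [set y : R[i] | modc (y - xi l) < r] = 0%E.
have [|l r r' _ rr' [h1 h2]|de de0 h] := @finite_common_radius R _ Q; first last.
- by exists de => //; split => l; have [] := h l.
- by split; [move=> j /h1; exact: le_trans|exact: null_ball_sub h2].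
move=> l; have [r r0 hr] := null_ball_off_support (xi_out l).
have [|j t t' _ tt' h lj|r2 r20 h2] :=
  @finite_common_radius R _ (fun j (t : R) => l != j -> t <= modc (xi l - xi j)).
- move=> j; have [->|lj] := eqVneq l j; first by exists 1.
  exists (modc (xi l - xi j)) => //.
  by rewrite modc_gt0 subr_eq0; apply: contra lj => /eqP/xi_inj ->.
- exact: le_trans tt' (h lj).
exists (Num.min r r2); first by rewrite lt_min r0 r20.
split; first by move=> j /h2; apply: le_trans; rewrite ge_min lexx orbT.
by apply: null_ball_sub hr; rewrite ge_min lexx.
Qed.

Context (z : R[i]) (de : R).
Hypothesis de0 : 0 < de.
Hypothesis mu_ball : mu [set y : R[i] | modc (y - z) < de] = 0%E.

Let mtrunc b : measurable_fun setT (fun y => complex_part b (trunc_inv z de y)).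
Proof. by apply: measurable_complex_part; exact: measurable_trunc_inv. Qed.

Let mpole b : measurable_fun setT (fun y : R[i] => complex_part b (z - y)^-1).
Proof.
apply: measurable_complex_part; apply: measurable_complexV.
by apply: measurable_complexB; [exact: measurable_cst|exact: measurable_id].
Qed.

Let trunc_le b y : `|complex_part b (trunc_inv z de y)| <= de^-1.
Proof. by apply: le_trans (complex_part_le _ _) _; exact: trunc_inv_le. Qed.

Lemma trunc_part_integrable b :
  mu.-integrable setT (EFin \o (fun y => complex_part b (trunc_inv z de y))).
Proof. by apply: bounded_integrable => //; exists de^-1. Qed.

Lemma pole_part_integrable b :
  mu.-integrable setT (fun y => (complex_part b (z - y)^-1)%:E).
Proof.
apply/integrableP; split; first exact/measurable_EFinP.
have /integrableP[_] := trunc_part_integrable b; apply: le_lt_trans.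
rewrite le_eqVlt; apply/orP; left; apply/eqP; apply: ae_eq_integral => //.
- by apply/measurable_EFinP; exact: measurableT_comp (mpole b).
- by apply/measurable_EFinP; exact: measurableT_comp (mtrunc b).
by apply: filterS (trunc_inv_ae mu_ball (complex_part b)) => y /= ->.
Qed.

Lemma cauchy_stieltjes_part b :
  complex_part b (cauchy_stieltjes mu z) = \int[mu]_y complex_part b (trunc_inv z de y).
Proof.
have -> : complex_part b (cauchy_stieltjes mu z) = \int[mu]_y complex_part b (z - y)^-1.
  by case: b.
rewrite /Rintegral; congr fine; apply: ae_eq_integral => //; try exact/measurable_EFinP.
by apply: filterS (trunc_inv_ae mu_ball (complex_part b)) => y /= ->.
Qed.

(** Membership in the zero set includes existence of the transform, so existence has to be proved
    first; it follows from the null disk around [z]. *)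
Lemma cauchy_stieltjes_neq0 : ~ cauchy_stieltjes_zeros mu z -> cauchy_stieltjes mu z != 0.
Proof.
move=> h; apply/eqP => e; apply: h; split => //; split.
- have sz : [set z] = (fun y : R[i] => modc (y - z)) @^-1` [set 0].
    apply/seteqP; split => y /=; first by move=> ->; rewrite subrr modc0.
    by move/eqP; rewrite modc_eq0 subr_eq0 => /eqP.
  apply/eqP; rewrite eq_le measure_ge0 andbT -mu_ball; apply: le_measure; rewrite ?inE.
  + rewrite sz -[X in measurable X]setTI; apply: measurable_modc => //.
    by apply: measurable_complexB; [exact: measurable_id|exact: measurable_cst].
  + exact: mball.
  + by move=> y /= ->; rewrite subrr modc0.
- exact: (pole_part_integrable false).
exact: (pole_part_integrable true).
Qed.

Definition centered_part (b : bool) (y : R[i]) : R :=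
  complex_part b (trunc_inv z de y) - complex_part b (cauchy_stieltjes mu z).

Lemma measurable_centered_part b : measurable_fun setT (centered_part b).
Proof. by apply: measurable_funB => //; exact: measurable_cst. Qed.

Lemma centered_part_le b y : `|centered_part b y| <= 2 / de.
Proof.
apply: le_trans (ler_normB _ _) _.
have : `|complex_part b (cauchy_stieltjes mu z)| <= de^-1.
  by rewrite cauchy_stieltjes_part; exact: Rintegral_le_cst.
by have := trunc_le b y; lra.
Qed.

Lemma centered_part_mean b : \int[mu]_y centered_part b y = 0.
Proof.
rewrite /centered_part RintegralB//; last exact: finite_measure_integrable_cst.
  by rewrite Rintegral_cst1 cauchy_stieltjes_part subrr.
exact: trunc_part_integrable.
Qed.

End off_support.

Lemma gaussian_vector_covarianceE {R : realType} {I : finType} {d} {T : measurableType d}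
    (P : probability T R) (N : I -> T -> R) (vs : seq (I -> R)) :
  gaussian_vector_spec P N vs -> forall i j : I,
  covariance P (N i) (N j) = (\sum_(v <- vs) v i * v j)%:E.
Proof.
move=> HN i j.
rewrite (@covariance_Rintegral _ _ _ P (N i) (N j) 0 0) ?(gaussian_vector_mean HN)//.
- congr EFin; rewrite -(gaussian_vector_covariance HN).
  by apply: eq_Rintegral => t _; rewrite !subr0.
- exact: gaussian_vector_integrable HN i.
- exact: gaussian_vector_integrable HN j.
- have -> : (fun t => (N i t - 0) * (N j t - 0)) = (fun t => N i t * N j t).
    by apply/funext => t; rewrite !subr0.
  exact: gaussian_vector_integrableM HN i j.
Qed.

Section pole_covariance.
Context {R : realType} (mu : probability R[i] R) {s : nat} (xi : 'I_s -> R[i]) (de : R).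
Hypothesis de0 : 0 < de.
Hypothesis mu_ball : forall l, mu [set y : R[i] | modc (y - xi l) < de] = 0%E.

Definition centered_poles (i : 'I_s * bool) (y : R[i]) : R := centered_part mu (xi i.1) de i.2 y.

Lemma measurable_centered_poles i : measurable_fun setT (centered_poles i).
Proof. exact: measurable_centered_part. Qed.

Lemma centered_poles_le i y : `|centered_poles i y| <= 2 / de.
Proof. by exact: centered_part_le. Qed.

Lemma centered_poles_mean i : \int[mu]_y centered_poles i y = 0.
Proof. by exact: (centered_part_mean de0 (mu_ball _)). Qed.

Definition pole_covariance_matrix (i j : 'I_s * bool) : R :=
  \int[mu]_y (centered_poles i y * centered_poles j y).

Let poleM_integrable i j :
  mu.-integrable setT (EFin \o (fun y => centered_poles i y * centered_poles j y)).
Proof.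
apply: bounded_integrable.
  by apply: measurable_funM; exact: measurable_centered_poles.
exists (2 / de * (2 / de)) => y; rewrite normrM.
by apply: ler_pM; rewrite ?normr_ge0//; exact: centered_poles_le.
Qed.

(** The form is the second moment of a linear combination of the centred poles. *)
Lemma pole_covariance_psd a : 0 <= quad_form pole_covariance_matrix a.
Proof.
have -> : quad_form pole_covariance_matrix a = \int[mu]_y (\sum_i a i * centered_poles i y) ^+ 2.
  have -> : (fun y => (\sum_i a i * centered_poles i y) ^+ 2) =
      (fun y => \sum_i \sum_j a i * a j * (centered_poles i y * centered_poles j y)).
    apply/funext => y; rewrite expr2 mulr_suml; apply: eq_bigr => i _.
    by rewrite mulr_sumr; apply: eq_bigr => j _; ring.
  have I2 i j : mu.-integrable setT
      (EFin \o (fun y => a i * a j * (centered_poles i y * centered_poles j y))).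
    exact: (integrableZl measurableT (a i * a j) (poleM_integrable i j)).
  have I1 i := Rintegral_sum (index_enum ('I_s * bool)%type) (I2 i).
  rewrite (Rintegral_sum _ (fun i => (I1 i).1)).2; apply: eq_bigr => i _.
  rewrite (I1 i).2; apply: eq_bigr => j _.
  by rewrite RintegralZ.
by apply: Rintegral_ge0 => y _; exact: sqr_ge0.
Qed.

Lemma pole_gaussian_exists :
  exists d (T : measurableType d) (P : probability T R) (N : 'I_s * bool -> T -> R) vs,
    gaussian_vector_spec P N vs /\
    forall i j, pole_covariance_matrix i j = \sum_(v <- vs) v i * v j.
Proof.
have [|vs hvs] := psd_decomposition _ pole_covariance_psd.
  by move=> i j; apply: eq_Rintegral => y _; rewrite mulrC.
have [d [T [P [N HN]]]] := gaussian_vector_exists vs.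
by exists d, T, P, N, vs.
Qed.

(** Covariances depend only on the law and are insensitive to null sets, so the true poles may be
    replaced by the truncated ones under [mu]. *)
Lemma pole_covarianceE {d} {T : measurableType d} (P : probability T R) (X : T -> R[i]) :
  measurable_fun setT X -> has_law P X mu -> forall i j : 'I_s * bool,
  covariance P (fun t => complex_part i.2 (xi i.1 - X t)^-1)
               (fun t => complex_part j.2 (xi j.1 - X t)^-1) =
  (pole_covariance_matrix i j)%:E.
Proof.
move=> mX lawX i j.
have mpole (k : 'I_s * bool) : measurable_fun setT (fun y : R[i] => complex_part k.2 (xi k.1 - y)^-1).
  apply: measurable_complex_part; apply: measurable_complexV.
  by apply: measurable_complexB; [exact: measurable_cst|exact: measurable_id].
have mtrunc (k : 'I_s * bool) :
    measurable_fun setT (fun y : R[i] => complex_part k.2 (trunc_inv (xi k.1) de y)).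
  by apply: measurable_complex_part; exact: measurable_trunc_inv.
rewrite (covariance_law mX lawX (mpole i) (mpole j)).
rewrite (covariance_ae (mpole i) (mtrunc i) (mpole j) (mtrunc j)); first last.
- by apply: filterS (trunc_inv_ae (mu_ball j.1) (complex_part j.2)) => y ->.
- by apply: filterS (trunc_inv_ae (mu_ball i.1) (complex_part i.2)) => y ->.
have tI (k : 'I_s * bool) := @trunc_part_integrable R mu (xi k.1) de de0 k.2.
have tE (k : 'I_s * bool) := esym (cauchy_stieltjes_part (mu_ball k.1) k.2).
rewrite (covariance_Rintegral (tI i) (tI j) (tE i) (tE j))//.
exact: (poleM_integrable i j).
Qed.

End pole_covariance.

(** * Critical points of the random polynomial *)

Lemma finite_union_bound {R : realType} {d} {T : measurableType d} (P : probability T R)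
    {J : finType} (A : J -> set T) (b : R) :
  (forall j, measurable (A j)) -> (forall j, (P (A j) <= b%:E)%E) ->
  measurable [set t | exists j, A j t] /\ (P [set t | exists j, A j t] <= (#|J|%:R * b)%:E)%E.
Proof.
move=> mA Ab.
have -> : [set t | exists j, A j t] = [set t | exists2 j, j \in enum J & A j t].
  apply/seteqP; split => t [j]; first by move=> Ajt; exists j => //; rewrite mem_enum.
  by move=> _ Ajt; exists j.
rewrite cardE; elim: (enum J) => [|j e [me be]].
  rewrite (_ : [set t | _] = set0); first by rewrite measure0 mul0r.
  by apply/seteqP; split => t // -[].
rewrite (_ : [set t | _] = A j `|` [set t | exists2 j, j \in e & A j t]).
  split; first exact: measurableU.
  apply: le_trans (measureU2 _ _ _) _ => //.
  by rewrite /= -nat1r mulrDl mul1r EFinD; exact: leeD.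
apply/seteqP; split => t.
  move=> [k]; rewrite inE => /orP[/eqP ->|ke Akt]; first by left.
  by right; exists k.
move=> [Ajt|[k ke Akt]]; first by exists j; rewrite ?inE ?eqxx.
by exists k => //; rewrite inE ke orbT.
Qed.

Section good_event.
Context {R : realType} (mu : probability R[i] R) {s : nat} (xi : 'I_s -> R[i]) (de : R).
Hypothesis de0 : 0 < de.
Hypothesis mu_ball : forall l, mu [set y : R[i] | modc (y - xi l) < de] = 0%E.
Context {d : measure_display} {T : measurableType d} (P : probability T R).
Variable X : nat -> {RV P >-> R[i]}.
Hypothesis iidX : iid_with_law mu X.

Definition near_pole (n : nat) : set T :=
  [set t | exists jl : 'I_(n.+1 - s) * 'I_s, modc (X jl.1 t - xi jl.2) < de].

(** Both signs are included so that the one-sided tail bound controls absolute values. *)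
Definition signed_pole (i : ('I_s * bool) * bool) (y : R[i]) : R :=
  if i.2 then - centered_poles mu xi de i.1 y else centered_poles mu xi de i.1 y.

Definition large_deviation (e : R) (n : nat) : set T :=
  [set t | exists i, e * n%:R <= \sum_(j < n) signed_pole i (X j t)].

(* Empty when n < K, where a lower bound 1 - C e^(-c n) <= 0 asserts nothing. *)
Definition good_event (e K : R) (n : nat) : set T :=
  if (K <= n%:R) && (s <= n.+1)%N then ~` (near_pole n `|` large_deviation e n) else set0.

Let near_pole_null n : measurable (near_pole n) /\ P (near_pole n) = 0%E.
Proof.
have [||m b] := finite_union_bound (P := P) (b := 0)
  (A := fun jl : 'I_(n.+1 - s) * 'I_s => [set t | modc (X jl.1 t - xi jl.2) < de]).
- move=> [j l]; apply: measurable_modc_lt.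
  by apply: measurable_complexB; [exact: measurable_funPT|exact: measurable_cst].
- move=> [j l] /=; have := iidX.2 j _ (complex_open_measurable (@open_modc_ball _ (xi l) de)).
  by rewrite (mu_ball l) => h; rewrite [X in (X <= _)%E]h.
by split=> //; apply/eqP; rewrite eq_le measure_ge0 andbT; rewrite mulr0 in b.
Qed.

Let mspole i : measurable_fun setT (signed_pole i).
Proof.
have := measurable_centered_poles mu xi de i.1; rewrite /signed_pole; case: i.2 => // h.
exact: measurableT_comp.
Qed.

Let spole_le i y : `|signed_pole i y| <= 2 / de.
Proof. by rewrite /signed_pole; case: ifP => _; rewrite ?normrN; exact: centered_poles_le. Qed.

Let spole_mean i : \int[mu]_y signed_pole i y = 0.
Proof.
case: i => i []; last exact: centered_poles_mean.
transitivity (\int[mu]_y (-1 * centered_poles mu xi de i y)).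
  by apply: eq_Rintegral => y _; rewrite mulN1r.
rewrite RintegralZ ?centered_poles_mean ?mulr0//.
apply: bounded_integrable; first exact: measurable_centered_poles.
by exists (2 / de) => y; exact: centered_poles_le.
Qed.

(** The factor 4s counts s points, two coordinates and two signs. *)
Let large_deviation_le e l n : 0 < l -> l * (2 / de) <= 2^-1 -> 0 < e ->
  4 * l * (2 / de) ^+ 2 <= e ->
  measurable (large_deviation e n) /\
  (P (large_deviation e n) <= (4 * s%:R * expR (- (l * e / 2 * n%:R)))%:E)%E.
Proof.
move=> l0 lB e0 eB.
have [||m b] := finite_union_bound (P := P) (b := expR (- (l * e / 2 * n%:R)))
  (A := fun i => [set t | e * n%:R <= \sum_(j < n) signed_pole i (X j t)]).
- move=> i; rewrite -[X in measurable X]setTI.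
  apply: measurable_fun_le => //.
  by apply: sumr_measurable => j; apply: (measurableT_comp (mspole i)); exact: measurable_funPT.
- by move=> i; exact: (sum_tail iidX (mspole i) (spole_le i) (spole_mean i) n l0 lB e0 eB).
split => //; apply: le_trans b _.
rewrite !card_prod card_ord card_bool lee_fin -mulnA mulnC natrM.
by rewrite (_ : (2 * 2)%:R = 4 :> R)// -natrM.
Qed.

Lemma measurable_good_event e l K n : 0 < l -> l * (2 / de) <= 2^-1 -> 0 < e ->
  4 * l * (2 / de) ^+ 2 <= e -> measurable (good_event e K n).
Proof.
move=> l0 lB e0 eB; rewrite /good_event; case: ifP => // _.
apply: measurableC; apply: measurableU; first exact: (near_pole_null n).1.
exact: (large_deviation_le n l0 lB e0 eB).1.
Qed.

Lemma good_event_prob e l K n : 0 < l -> l * (2 / de) <= 2^-1 -> 0 < e ->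
  4 * l * (2 / de) ^+ 2 <= e -> K <= n%:R -> (s <= n.+1)%N ->
  ((1 - 4 * s%:R * expR (- (l * e / 2 * n%:R)))%:E <= P (good_event e K n))%E.
Proof.
move=> l0 lB e0 eB Kn sn; rewrite /good_event Kn sn/=.
have [m1 b1] := near_pole_null n; have [m2 b2] := large_deviation_le n l0 lB e0 eB.
rewrite probability_setC; last exact: measurableU.
rewrite EFinB; apply: leeB => //; apply: le_trans (measureU2 _ _ _) _ => //.
by rewrite [X in (X + _)%E]b1 add0e.
Qed.

Lemma good_event_large e K n t : good_event e K n t -> K <= n%:R /\ (s <= n.+1)%N.
Proof. by rewrite /good_event; case: ifP => // /andP[]. Qed.

Lemma good_event_sep e K n t : good_event e K n t ->
  forall l (j : nat), (j < n.+1 - s)%N -> de <= modc (X j t - xi l).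
Proof.
rewrite /good_event; case: ifP => // _ h l j jn; rewrite leNgt; apply/negP => h'.
by apply: h; left; exists (Ordinal jn, l).
Qed.

Lemma good_event_dev e K n t : good_event e K n t ->
  forall i, `|\sum_(j < n) centered_poles mu xi de i (X j t)| <= e * n%:R.
Proof.
rewrite /good_event; case: ifP => // _ h i; rewrite leNgt; apply/negP => h'.
apply: h; right; move: h'; rewrite ltr_normr => /orP[] /ltW h'.
  by exists (i, false).
by exists (i, true); rewrite /signed_pole/= sumrN.
Qed.

End good_event.

(** * Deterministic estimates for the fluctuations *)

Section fluctuation.
Context {R : realType}.

(** The difference consists of the poles at the other [xi j] and of the last s - 1 of the n
    summands, which do not occur in the polynomial: two groups of at most s terms, each term of size
    at most 1/de. *)
Lemma reciprocal_sum_approx {s : nat} (xi : 'I_s -> R[i]) (x : nat -> R[i]) (n : nat) (de : R)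
    (l : 'I_s) (m : R[i]) : 0 < de -> (s <= n.+1)%N ->
  (forall l j, l != j -> de <= modc (xi l - xi j)) ->
  (forall (j : nat), (j < n.+1 - s)%N -> de <= modc (x j - xi l)) ->
  modc (reciprocal_sum xi x n l - n%:R * m - \sum_(j < n) (trunc_inv (xi l) de (x j) - m))
    <= 2 * s%:R / de.
Proof.
move=> de0 sn xi_sep x_sep; rewrite /reciprocal_sum.
set A := \sum_(j < s | _) _.
have -> : \sum_(j < n.+1 - s) (xi l - x j)^-1 = \sum_(j < n.+1 - s) trunc_inv (xi l) de (x j).
  by apply: eq_bigr => j _; rewrite trunc_inv_out// x_sep.
have s0 : (0 < s)%N by exact: leq_ltn_trans (leq0n l) (ltn_ord l).
have kn : (n.+1 - s <= n)%N by rewrite leq_subLR -add1n leq_add2r.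
rewrite sumrB sumr_const card_ord -[m *+ n]mulr_natl.
rewrite -!(big_mkord xpredT (fun j => trunc_inv (xi l) de (x j))) (big_cat_nat (leq0n _) kn)/=.
set B := \sum_(0 <= i < n.+1 - s) _; set D := \sum_(n.+1 - s <= i < n) _.
have -> : A + B - n%:R * m - (B + D - n%:R * m) = A - D by ring.
apply: le_trans (modcB _ _) _.
have hA : modc A <= s%:R / de.
  apply: le_trans (modc_sum _ _ _) _.
  apply: le_trans _ (_ : \sum_(j < s) de^-1 <= _); last first.
    by rewrite sumr_const card_ord mulr_natl.
  rewrite big_mkcond/=; apply: ler_sum => j _; case: ifP => [jl|_]; last by rewrite invr_ge0 ltW.
  have h : de <= modc (xi l - xi j) by apply: xi_sep; rewrite eq_sym.
  by rewrite modcV lef_pV2 ?posrE// (lt_le_trans de0).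
have hD : modc D <= s%:R / de.
  apply: le_trans (modc_sum _ _ _) _.
  apply: le_trans _ (_ : \sum_(n.+1 - s <= j < n) de^-1 <= _).
    by apply: ler_sum => j _; exact: trunc_inv_le.
  rewrite sumr_const_nat -[X in X <= _]mulr_natl ler_wpM2r ?invr_ge0 ?(ltW de0)// ler_nat.
  by rewrite leq_subLR addnC -leq_subLR; apply: leq_trans (leq_sub2r _ (leqnSn n)) _.
lra.
Qed.

Definition fluctuation_const (mu D a : R) : R :=
  mu ^+ 2 * D + a + 4 * a ^+ 2 / mu + 4 / mu + 3 + 2 * a ^+ 2.

(** [W] may be as large as a multiple of n, so no uniform O(n^-1/2) bound is to be had. The error is
    instead allowed to grow with |W|^2 / n, whose mean stays bounded. *)
Lemma fluctuation_approx (n : nat) (m S W z : R[i]) (D a : R) : (0 < n)%N -> m != 0 -> 0 <= a ->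
  modc (S - n%:R * m - W) <= a ->
  n%:R * modc m / 2 <= modc S ->
  modc (z + n.+1%:R^-1 * (n%:R / S)) <= D / n%:R ^+ 2 ->
  modc ((n%:R `^ (3%:R / 2%:R))%:C * m ^+ 2 * (z + n.+1%:R^-1 * m^-1) - (Num.sqrt n%:R)^-1%:C * W)
    <= fluctuation_const (modc m) D a * (Num.sqrt n%:R)^-1 * (1 + n%:R^-1 * modc W ^+ 2).
Proof.
move=> n0 m0 a0 hW hS hz.
have nR : (0 : R) < n%:R by rewrite ltr0n.
have n1 : (1 : R) <= n%:R by rewrite ler1n.
set q : R := Num.sqrt n%:R.
have q0 : 0 < q by rewrite sqrtr_gt0.
have qq : q ^+ 2 = n%:R by rewrite sqr_sqrtr// ltW.
have mu0 : 0 < modc m by rewrite modc_gt0.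
have S0 : 0 < modc S by apply: lt_le_trans hS; rewrite divr_gt0// mulr_gt0.
have -> : n%:R `^ (3%:R / 2%:R) = n%:R * q :> R.
  rewrite (_ : 3%:R / 2%:R = 1 + 2^-1 :> R); last by field.
  by rewrite powRD ?powRr1 ?powR12_sqrt ?(ltW nR)//; apply/implyP => _; rewrite gt_eqF.
set del := z + n.+1%:R^-1 * (n%:R / S) in hz.
set U := S - n%:R * m.
have hU : modc U <= modc W + a.
  have := modcD (U - W) W; rewrite subrK; rewrite -/U in hW; lra.
have Sn0 : S != 0 by rewrite -modc_gt0.
have qC0 : q%:C != 0 :> R[i] by rewrite -modc_gt0 modc_real gtr0_norm.
have nC : n%:R = q%:C ^+ 2 :> R[i] by rewrite -rmorphXn qq rmorph_nat.
have nC1 : n.+1%:R != 0 :> R[i] by rewrite -modc_gt0 modc_nat ltr0n.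
(* An exact identity: the fixed-point error, the passage from the true to the truncated centred sum,
   and the second-order term of the expansion of 1/S around 1/(n m). *)
have -> : (n%:R * q)%:C * m ^+ 2 * (z + n.+1%:R^-1 * m^-1) - q^-1%:C * W =
    (n%:R * q)%:C * m ^+ 2 * del + q^-1%:C * (U - W)
    - q^-1%:C * (U * (n%:R * U + S) / (n.+1%:R * S)).
  have e1 : (n%:R * q)%:C = n%:R * q%:C :> R[i] by rewrite rmorphM/= rmorph_nat.
  have e2 : q^-1%:C = (q%:C)^-1 :> R[i] by rewrite fmorphV.
  rewrite /del /U e1 e2 -natr1; rewrite -natr1 in nC1; rewrite nC in nC1 *.
  move: qC0 nC1; set Q := q%:C; move: (Q) => Q' Q0 nC1.
  by field; rewrite m0 Sn0 Q0 nC1.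
have hdel : modc ((n%:R * q)%:C * m ^+ 2 * del) <= q^-1 * (modc m ^+ 2 * D).
  rewrite modcM (modcM (n%:R * q)%:C) modcX modc_real ger0_norm ?mulr_ge0 ?(ltW nR) ?(ltW q0)//.
  apply: le_trans _ (_ : n%:R * q * modc m ^+ 2 * (D / n%:R ^+ 2) <= _).
    by rewrite ler_wpM2l// !mulr_ge0 ?exprn_ge0 ?modc_ge0 ?(ltW nR) ?(ltW q0).
  rewrite le_eqVlt; apply/orP; left; apply/eqP.
  by rewrite -qq; field; rewrite gt_eqF.
have hUW : modc (q^-1%:C * (U - W)) <= q^-1 * a.
  by rewrite modcM modc_real ger0_norm ?invr_ge0 ?(ltW q0)// ler_wpM2l ?invr_ge0 ?(ltW q0).
set u := modc W + a in hU.
have u0 : 0 <= modc U by exact: modc_ge0.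
have w0 : 0 <= modc W by exact: modc_ge0.
have hlast : modc (q^-1%:C * (U * (n%:R * U + S) / (n.+1%:R * S))) <=
    q^-1 * (2 * (n%:R^-1 * u ^+ 2) / modc m + n%:R^-1 * u).
  rewrite modcM modc_real ger0_norm ?invr_ge0 ?(ltW q0)// ler_wpM2l ?invr_ge0 ?(ltW q0)//.
  have n1C : (0 : R) < n.+1%:R by rewrite ltr0n.
  rewrite modcM modcV modcM (modcM n.+1%:R) modc_nat.
  have hs : modc (n%:R * U + S) <= n%:R * modc U + modc S.
    by apply: le_trans (modcD _ _) _; rewrite modcM modc_nat.
  apply: le_trans _ (_ : modc U * (n%:R * modc U + modc S) / (n.+1%:R * modc S) <= _).
    by rewrite ler_wpM2r ?invr_ge0 ?mulr_ge0 ?(ltW n1C) ?(ltW S0)// ler_wpM2l.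
  have -> : modc U * (n%:R * modc U + modc S) / (n.+1%:R * modc S) =
      (n%:R / n.+1%:R) * (modc U ^+ 2 / modc S) + modc U / n.+1%:R.
    by field; rewrite !gt_eqF.
  apply: lerD.
    have h1 : n%:R / n.+1%:R <= (1 : R) by rewrite ler_pdivrMr// mul1r ler_nat.
    apply: le_trans _ (_ : modc U ^+ 2 / modc S <= _).
      by rewrite ler_piMl// divr_ge0// ?sqr_ge0// ltW.
    rewrite ler_pdivrMr//; apply: le_trans _ (_ : u ^+ 2 <= _); first by rewrite ler_sqr ?nnegrE// (le_trans u0).
    have h2 : 1 <= 2 / (n%:R * modc m) * modc S.
      have := ler_wpM2l (_ : 0 <= 2 / (n%:R * modc m)) hS.
      have -> : 2 / (n%:R * modc m) * (n%:R * modc m / 2) = 1 by field; rewrite !gt_eqF.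
      by apply; rewrite divr_ge0// mulr_ge0// ltW.
    have -> : 2 * (n%:R^-1 * u ^+ 2) / modc m * modc S = u ^+ 2 * (2 / (n%:R * modc m) * modc S).
      by field; rewrite !gt_eqF.
    by rewrite ler_peMr// sqr_ge0.
  rewrite [X in X <= _]mulrC; apply: ler_pM; rewrite ?invr_ge0 ?(ltW n1C)//.
  by rewrite lef_pV2 ?posrE// ler_nat.
apply: le_trans (modcB _ _) _.
apply: le_trans (lerD (modcD _ _) (lexx _)) _.
apply: le_trans (lerD (lerD hdel hUW) hlast) _.
set v := n%:R^-1 * modc W ^+ 2.
rewrite -!(mulrDr q^-1) [X in _ <= X](_ : _ = q^-1 * (fluctuation_const (modc m) D a * (1 + v))).
  2: by ring.
rewrite ler_wpM2l ?invr_ge0 ?(ltW q0)//.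
have v0 : 0 <= v by apply: mulr_ge0; rewrite ?sqr_ge0 ?invr_ge0 ?(ltW nR).
have ni : n%:R^-1 <= (1 : R) by rewrite invf_le1.
have ni0 : (0 : R) <= n%:R^-1 by rewrite invr_ge0 ltW.
have hu2 : n%:R^-1 * u ^+ 2 <= 2 * v + 2 * a ^+ 2.
  have h : u ^+ 2 <= 2 * modc W ^+ 2 + 2 * a ^+ 2 by rewrite /u; have := sqr_ge0 (modc W - a); nra.
  apply: le_trans (ler_wpM2l ni0 h) _; rewrite /v.
  have := ler_wpM2r (sqr_ge0 a) ni; lra.
have hu1 : n%:R^-1 * u <= 1 + (2 * v + 2 * a ^+ 2).
  have h : u <= 1 + u ^+ 2 by have := sqr_ge0 (u - 1); have := sqr_ge0 u; nra.
  have := ler_wpM2l ni0 h; lra.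
have D0 : 0 <= D.
  have := le_trans (modc_ge0 _) hz; rewrite pmulr_lge0// invr_gt0; exact: exprn_gt0.
have hm : 2 * (n%:R^-1 * u ^+ 2) / modc m <= (4 * v + 4 * a ^+ 2) / modc m.
  by rewrite ler_wpM2r ?invr_ge0 ?(ltW mu0)//; lra.
rewrite /fluctuation_const.
have c1 : 0 <= modc m ^+ 2 * D * v by rewrite !mulr_ge0 ?exprn_ge0 ?modc_ge0.
have c2 : 0 <= a * v by rewrite mulr_ge0.
have c3 : 0 <= a ^+ 2 / modc m * v by rewrite !mulr_ge0 ?exprn_ge0 ?invr_ge0 ?(ltW mu0) ?modc_ge0.
have c4 : 0 <= (modc m)^-1 by rewrite invr_ge0 ltW.
have c5 : 0 <= a ^+ 2 * v by rewrite mulr_ge0 ?exprn_ge0.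
have c6 : 0 <= (modc m)^-1 * v by rewrite mulr_ge0.
move: hm c3 c4 c6 c1 c2 c5 hu1 v0; set p := (modc m)^-1.
move: (modc m ^+ 2 * D) (n%:R^-1 * u ^+ 2) (n%:R^-1 * u) => MD U2 U1 hm c3 c4 c6 c1 c2 c5 hu1 v0.
apply: le_trans (lerD (lexx _) (lerD hm hu1)) _; lra.
Qed.

End fluctuation.

Section good_configuration.
Context {R : realType} (mu : probability R[i] R) {s : nat} (xi : 'I_s -> R[i]) (de : R).
Hypothesis de0 : 0 < de.
Hypothesis mu_ball : forall l, mu [set y : R[i] | modc (y - xi l) < de] = 0%E.
Hypothesis xi_sep : forall l j, l != j -> de <= modc (xi l - xi j).
Let m (l : 'I_s) : R[i] := cauchy_stieltjes mu (xi l).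
Variable mu0 : R.
Hypothesis mu0_gt0 : 0 < mu0.
Hypothesis m_ge : forall l, mu0 <= modc (m l).
Variable K : R.
Hypothesis K1 : 1 <= K.
Hypothesis K72 : 72 <= de ^+ 2 * mu0 ^+ 2 * K.
Hypothesis K9 : 9 <= de * mu0 * K.
Hypothesis K8 : 8 * s%:R <= de * mu0 * K.
Variables (x : nat -> R[i]) (n : nat).
Hypothesis Kn : K <= n%:R.
Hypothesis sn : (s <= n.+1)%N.
Hypothesis x_sep : forall l (j : nat), (j < n.+1 - s)%N -> de <= modc (x j - xi l).
Hypothesis x_dev : forall i, `|\sum_(j < n) centered_poles mu xi de i (x j)| <= mu0 / 8 * n%:R.

Definition centered_pole_sum (l : 'I_s) : R[i] := \sum_(j < n) (trunc_inv (xi l) de (x j) - m l).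

Lemma centered_pole_sum_part b l :
  complex_part b (centered_pole_sum l) = \sum_(j < n) centered_poles mu xi de (l, b) (x j).
Proof.
rewrite complex_part_sum; apply: eq_bigr => j _.
by rewrite complex_partD complex_partN.
Qed.

Let nR : (0 : R) < n%:R. Proof. by have := K1; have := Kn; lra. Qed.

Let n0 : (0 < n)%N. Proof. by rewrite -(ltr0n R). Qed.

Let ml0 l : 0 < modc (m l). Proof. exact: lt_le_trans (m_ge l). Qed.

Let mn_ge (a : R) l : 0 <= a -> a * mu0 * K <= a * modc (m l) * n%:R.
Proof.
move=> a0; apply: ler_pM => //; last exact: ler_wpM2l.
  by rewrite mulr_ge0// ltW.
by have := K1; lra.
Qed.

Let m72 l : 72 <= de ^+ 2 * modc (m l) ^+ 2 * n%:R.
Proof.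
apply: le_trans K72 _; apply: ler_pM => //.
- by rewrite mulr_ge0// exprn_ge0// ltW.
- by have := K1; lra.
apply: ler_wpM2l; first by rewrite exprn_ge0// ltW.
by rewrite ler_sqr ?nnegrE// ltW.
Qed.

Let m9 l : 9 <= de * modc (m l) * n%:R.
Proof. by apply: le_trans K9 _; apply: mn_ge; exact: ltW. Qed.

(** The two coordinates of the centred sum contribute at most mu0 n/8 each, and [K8] bounds the O(s)
    discrepancy by |m_l| n/4; half of n |m_l| is left. *)
Lemma reciprocal_sum_large l : n%:R * modc (m l) / 2 <= modc (reciprocal_sum xi x n l).
Proof.
have h1 := reciprocal_sum_approx (m l) de0 sn xi_sep (x_sep l).
have h2 : modc (centered_pole_sum l) <= modc (m l) * n%:R / 4.
  apply: le_trans (modc_le_ReIm _) _.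
  have hR := x_dev (l, false); rewrite -centered_pole_sum_part in hR.
  have hI := x_dev (l, true); rewrite -centered_pole_sum_part in hI.
  apply: le_trans (lerD hR hI) _.
  by have := ler_wpM2r (ltW nR) (m_ge l); lra.
have h3 : 2 * s%:R / de <= modc (m l) * n%:R / 4.
  rewrite ler_pdivrMr//; have := mn_ge l (ltW de0); have := K8; nra.
rewrite -/(centered_pole_sum l) in h1.
set S := reciprocal_sum xi x n l in h1 *.
have h4 : modc (S - n%:R * m l) <= modc (m l) * n%:R / 2.
  have := modcD (S - n%:R * m l - centered_pole_sum l) (centered_pole_sum l).
  by rewrite subrK; lra.
have := modcB S (S - n%:R * m l); rewrite subKr modcM modc_nat; lra.
Qed.

Definition newton_const : R := 108 / (de ^+ 2 * mu0 ^+ 3) + 2 / mu0.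

Lemma newton_limit_error l :
  modc (newton_limit xi x n l - xi l + n.+1%:R^-1 * (n%:R / reciprocal_sum xi x n l))
    <= newton_const / n%:R ^+ 2.
Proof.
have := newton_limit_expansion n0 sn de0 xi_sep x_sep (l := l) (ml0 l) (m72 l) (m9 l).
rewrite pole_sum_xi => /(_ (reciprocal_sum_large l)) h; apply: le_trans h _.
apply: ler_wpM2r; first by rewrite invr_ge0 exprn_ge0// ltW.
apply: lerD.
  apply: ler_wpM2l => //; rewrite lef_pV2 ?posrE ?mulr_gt0 ?exprn_gt0//.
  apply: ler_wpM2l; first by rewrite exprn_ge0// ltW.
  by rewrite lerXn2r ?nnegrE// ltW.
by apply: ler_wpM2l => //; rewrite lef_pV2 ?posrE.
Qed.

Lemma newton_limit_paired (C' : R) : newton_const < C' ->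
  paired_critical_points xi x m C' n (newton_limit xi x n).
Proof.
move=> hC.
have disk l : modc (newton_limit xi x n l - xi l) <= 3 / (modc (m l) * n%:R).
  apply: (newton_limit_disk n0 sn de0 xi_sep x_sep (l := l) (ml0 l) (m72 l) (m9 l)).
  by rewrite pole_sum_xi reciprocal_sum_large.
have rE l : 3%:R / (`|m l| * n%:R) = (3 / (modc (m l) * n%:R))%:C :> R[i].
  by rewrite normE !(rmorphM, fmorphV)/= !rmorph_nat.
have crit l := critical_point_fixed n0 sn de0 xi_sep x_sep (l := l) (ml0 l) (m72 l) (m9 l)
  (reciprocal_sum_large l).
have fixed l := newton_limit_fixed n0 sn de0 xi_sep x_sep (l := l) (ml0 l) (m72 l) (m9 l)
  (reciprocal_sum_large l).
split=> [l j e|l].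
  apply/eqP; apply: contraT => lj; have := xi_sep lj.
  have rl := radius_le n0 (ml0 l) (m9 l); have rj := radius_le n0 (ml0 j) (m9 j).
  have := modcB (newton_limit xi x n l - xi j) (newton_limit xi x n l - xi l).
  rewrite opprB [X in modc X]addrACA [- _ + _]addrC -addrACA subrr add0r.
  have := disk l; have := disk j; rewrite e; have := de0; lra.
rewrite rE; split.
- split; last by rewrite normE lecR.
  by apply/(crit l); [exact: disk|exact: fixed].
- move=> z hz; rewrite normE lecR => dz.
  apply: (fixed_point_unique n0 sn de0 xi_sep x_sep (l := l) (ml0 l) (m72 l) (m9 l)
    (reciprocal_sum_large l) dz (disk l)) => //.
  exact/(crit l).
- split=> [j jn|].
    by rewrite -subr_eq0 -modc_gt0 (lt_le_trans de0)// x_sep.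
  rewrite -modc_gt0; apply: lt_le_trans (reciprocal_sum_large l).
  by rewrite divr_gt0// mulr_gt0.
rewrite normE ltcR; apply: le_lt_trans (newton_limit_error l) _.
by rewrite ltr_pM2r// invr_gt0 exprn_gt0.
Qed.

Lemma good_newton_iter_cvg l :
  cvgn (fun k => complex.Re (newton_iter xi x n l k)) /\
  cvgn (fun k => complex.Im (newton_iter xi x n l k)).
Proof.
exact: (newton_iter_cvg n0 sn de0 xi_sep x_sep (l := l) (ml0 l) (m72 l) (m9 l)
  (reciprocal_sum_large l)).
Qed.

Lemma newton_limit_fluctuation l :
  modc ((n%:R `^ (3%:R / 2%:R))%:C * m l ^+ 2 *
        (newton_limit xi x n l - xi l + n.+1%:R^-1 * (m l)^-1)
        - (Num.sqrt n%:R)^-1%:C * centered_pole_sum l) <=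
  fluctuation_const (modc (m l)) newton_const (2 * s%:R / de) * (Num.sqrt n%:R)^-1 *
  (1 + n%:R^-1 * modc (centered_pole_sum l) ^+ 2).
Proof.
apply: (fluctuation_approx n0 (S := reciprocal_sum xi x n l)).
- by rewrite -modc_gt0.
- by rewrite divr_ge0 ?mulr_ge0// ltW.
- exact: (reciprocal_sum_approx (m l) de0 sn xi_sep (x_sep l)).
- exact: reciprocal_sum_large.
exact: newton_limit_error.
Qed.

End good_configuration.

Section newton_limit_measurable.
Context {R : realType} {s : nat} (xi : 'I_s -> R[i]).
Context {d : measure_display} {T : measurableType d} (P : probability T R).
Variables (X : nat -> {RV P >-> R[i]}) (n : nat) (l : 'I_s).

Lemma measurable_newton_iter k :
  measurable_fun setT (fun t => newton_iter xi (fun j => X j t) n l k).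
Proof.
elim: k => [|k ih]; first exact: measurable_cst.
apply: measurable_complexB; first exact: measurable_cst.
apply: measurable_complexV; apply: measurable_complexD;
  apply: measurable_complex_sum => j; apply: measurable_complexV;
  apply: measurable_complexB => //.
Qed.

(** Convergence of the iteration is known on [E] only; with the value 0 elsewhere the function is a
    pointwise limit everywhere. *)
Lemma measurable_newton_limit (E : set T) : measurable E ->
  (forall t, E t -> cvgn (fun k => complex.Re (newton_iter xi (fun j => X j t) n l k)) /\
                    cvgn (fun k => complex.Im (newton_iter xi (fun j => X j t) n l k))) ->
  measurable_fun setT (fun t => if t \in E then newton_limit xi (fun j => X j t) n l else 0).
Proof.
move=> mE hE.
have mb : measurable_fun setT (fun t => t \in E).
  apply: (measurable_fun_bool true); rewrite (_ : _ `&` _ = E)//.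
  by apply/seteqP; split => [t [_ /set_mem]|t /mem_set].
pose f b k t : R := if t \in E then complex_part b (newton_iter xi (fun j => X j t) n l k) else 0.
have mf b k : measurable_fun setT (f b k).
  apply: measurable_fun_ifT => //.
  by apply: measurable_complex_part; exact: measurable_newton_iter.
apply: measurable_complex.
- apply: (measurable_fun_cvg (h := f false)) => // t _; rewrite /f.
  case: ifPn => [|_]; last exact: cvg_cst.
  by rewrite inE => /hE[].
apply: (measurable_fun_cvg (h := f true)) => // t _; rewrite /f.
case: ifPn => [|_]; last exact: cvg_cst.
by rewrite inE => /hE[].
Qed.

End newton_limit_measurable.

Lemma sqrt_rate_cvg {R : realType} (u : nat -> R) (l C K : R) :
  (forall n, K <= n%:R -> (0 < n)%N -> `|u n - l| <= C / Num.sqrt n%:R) ->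
  u n @[n --> \oo] --> l.
Proof.
move=> h; apply/cvgrPdist_le => e e0; near=> n.
have n0 : (0 < n)%N by near: n; exact: nbhs_infty_gt.
have nR : (0 : R) < n%:R by rewrite ltr0n.
have q0 : (0 : R) < Num.sqrt n%:R by rewrite sqrtr_gt0.
rewrite distrC; apply: le_trans (h n _ n0) _; first by near: n; exact: nbhs_infty_ger.
rewrite ler_pdivrMr// -ler_pdivrMl//.
apply: le_trans (ler_norm _) _; rewrite -sqrtr_sqr ler_sqrt ?(ltW nR)//.
by near: n; exact: nbhs_infty_ger.
Unshelve. all: by end_near.
Qed.

(** * Convergence in distribution of the rescaled critical points *)

Section perturbation.
Context {R : realType} {I : finType} {d : measure_display} {T : measurableType d}.
Context (P : probability T R).

(** Off [E] boundedness of [g] costs 2M times the probability of the complement; on [E] the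
    Lipschitz bound applies, with only the mean of [V] entering. *)
Lemma perturbation_bound (Z W : I -> T -> R) (g : (I -> R) -> R) (M L : R)
    (E : set T) (V : T -> R) (p A r : R) :
  (forall i, measurable_fun setT (Z i)) -> (forall i, measurable_fun setT (W i)) ->
  coord_measurable g -> (forall x, `|g x| <= M) -> 0 <= L ->
  (forall x y, `|g (fun i => x i + y i) - g x| <= L * \sum_i `|y i|) ->
  measurable E -> ((1 - p)%:E <= P E)%E ->
  measurable_fun setT V -> (forall t, 0 <= V t) -> (exists B : R, forall t, V t <= B) ->
  \int[P]_t V t <= A -> 0 <= r ->
  (forall t, E t -> \sum_i `|Z i t - W i t| <= r * (1 + V t)) ->
  `|\int[P]_t g (Z ^~ t) - \int[P]_t g (W ^~ t)| <= 2 * M * p + L * r * (1 + A).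
Proof.
move=> mZ mW mg gM L0 gL mE PE mV V0 [B VB] VA r0 ZW.
have M0 : 0 <= M by apply: le_trans (gM (fun=> 0)); exact: normr_ge0.
have mgZ : measurable_fun setT (fun t => g (Z ^~ t)) by exact: mg.
have mgW : measurable_fun setT (fun t => g (W ^~ t)) by exact: mg.
have igZ : P.-integrable setT (EFin \o (fun t => g (Z ^~ t))).
  by apply: bounded_integrable => //; exists M.
have igW : P.-integrable setT (EFin \o (fun t => g (W ^~ t))).
  by apply: bounded_integrable => //; exists M.
have iV : P.-integrable setT (EFin \o V).
  by apply: bounded_integrable => //; exists B => t; rewrite ger0_norm.
have i1 : P.-integrable setT (EFin \o (\1_(~` E) : T -> R)).
  apply: bounded_integrable; first by apply: measurable_indic; exact: measurableC.
  by exists 1 => t; rewrite indicE; case: (_ \in _); rewrite ?normr0 ?normr1.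
have ic : P.-integrable setT (EFin \o (fun=> 1 : R)).
  by apply: bounded_integrable; [exact: measurable_cst|exists 1 => t; rewrite normr1].
have i1V : P.-integrable setT (EFin \o (fun t => 1 + V t)).
  exact: (integrableD measurableT ic iV).
have iM1 : P.-integrable setT (EFin \o (fun t => 2 * M * \1_(~` E) t)).
  exact: (integrableZl measurableT (2 * M) i1).
have iLV : P.-integrable setT (EFin \o (fun t => L * r * (1 + V t))).
  exact: (integrableZl measurableT (L * r) i1V).
have iD : P.-integrable setT (EFin \o (fun t => g (Z ^~ t) - g (W ^~ t))).
  exact: (integrableB measurableT igZ igW).
rewrite -RintegralB//; apply: le_trans (le_normr_Rintegral _ iD) _ => //.
apply: le_trans _ (_ : \int[P]_t (2 * M * \1_(~` E) t + L * r * (1 + V t)) <= _).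
  apply: le_Rintegral => //.
  - by have := iD; move=> /integrable_abse.
  - exact: (integrableD measurableT iM1 iLV).
  move=> t _; rewrite indicE; case: (boolP (t \in ~` E)) => [_|].
    rewrite mulr1 ler_wpDr//; first by rewrite !mulr_ge0// addr_ge0.
    by apply: le_trans (ler_normB _ _) _; rewrite mulr2n mulrDl mul1r lerD.
  rewrite in_setC negbK => /set_mem Et; rewrite mulr0 add0r -mulrA.
  apply: le_trans (ler_wpM2l L0 (ZW t Et)).
  have -> : g (Z ^~ t) = g (fun i => W i t + (Z i t - W i t)).
    by congr g; apply/funext => i; rewrite addrC subrK.
  exact: gL.
rewrite RintegralD// !RintegralZ// RintegralD// Rintegral_cst1.
have P1 : \int[P]_t \1_(~` E) t <= p.
  rewrite -lee_fin (EFin_Rintegral i1) integral_indic//; last exact: measurableC.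
  rewrite setIT [X in (X <= _)%E](probability_setC P mE).
  rewrite leeBlDr ?fin_num_measure//; move: PE; rewrite EFinB leeBlDr// addeC.
  by [].
apply: lerD; first by rewrite ler_wpM2l// mulr_ge0.
by rewrite ler_wpM2l ?mulr_ge0// lerD2l.
Qed.

End perturbation.

Section fluctuation_limit.
Context {R : realType} (mu : probability R[i] R) {s : nat} (xi : 'I_s -> R[i]) (de : R).
Hypothesis de0 : 0 < de.
Hypothesis mu_ball : forall l, mu [set y : R[i] | modc (y - xi l) < de] = 0%E.
Hypothesis xi_sep : forall l j, l != j -> de <= modc (xi l - xi j).
Let m (l : 'I_s) : R[i] := cauchy_stieltjes mu (xi l).
Variable mu0 : R.
Hypothesis mu0_gt0 : 0 < mu0.
Hypothesis m_ge : forall l, mu0 <= modc (m l).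
Variable K : R.
Hypothesis K1 : 1 <= K.
Hypothesis K72 : 72 <= de ^+ 2 * mu0 ^+ 2 * K.
Hypothesis K9 : 9 <= de * mu0 * K.
Hypothesis K8 : 8 * s%:R <= de * mu0 * K.
Variable lam : R.
Hypothesis lam0 : 0 < lam.
Hypothesis lamB : lam * (2 / de) <= 2^-1.
Hypothesis lamB2 : 4 * lam * (2 / de) ^+ 2 <= mu0 / 8.
Context {d : measure_display} {T : measurableType d} (P : probability T R).
Variable X : nat -> {RV P >-> R[i]}.
Hypothesis iidX : iid_with_law mu X.
Local Notation E := (good_event mu xi de X (mu0 / 8) K).
Variable w : nat -> 'I_s -> {RV P >-> R[i]}.
Hypothesis wE : forall n l t, E n t -> w n l t = newton_limit xi (fun j => X j t) n l.
Context {d2 : measure_display} {T2 : measurableType d2} (P2 : probability T2 R).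
Variables (N : 'I_s * bool -> T2 -> R) (vs : seq ('I_s * bool -> R)).
Hypothesis HN : gaussian_vector_spec P2 N vs.
Hypothesis covN : forall i j, pole_covariance_matrix mu xi de i j = \sum_(v <- vs) v i * v j.

Definition rescaled_part (n : nat) (i : 'I_s * bool) (t : T) : R :=
  complex_part i.2 (rescaled_fluctuations xi m n (fun l => w n l t) 0 i.1).

Let pole_sums (n : nat) (i : 'I_s * bool) (t : T) : R :=
  \sum_(j < n) centered_poles mu xi de i (X j t).

Let W (n : nat) (i : 'I_s * bool) (t : T) : R := (Num.sqrt n%:R)^-1 * pole_sums n i t.

Let V (n : nat) (t : T) : R := \sum_i n%:R^-1 * pole_sums n i t ^+ 2.

Let B := 2 / de.

Let B0 : 0 <= B. Proof. by rewrite /B divr_ge0// ltW. Qed.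

Let msums n i : measurable_fun setT (pole_sums n i).
Proof.
apply: sumr_measurable => j; apply: (measurableT_comp (measurable_centered_poles mu xi de i)).
exact: measurable_funPT.
Qed.

Let sums_le n i t : `|pole_sums n i t| <= n%:R * B.
Proof.
apply: le_trans (ler_norm_sum _ _ _) _.
rewrite mulr_natl -[X in _ *+ X]card_ord -sumr_const.
by apply: ler_sum => j _; exact: centered_poles_le.
Qed.

Let sqr_measurable n i : measurable_fun setT (fun t => n%:R^-1 * pole_sums n i t ^+ 2).
Proof. by apply: measurable_funM; [exact: measurable_cst|exact: measurable_funX]. Qed.

Let sqr_bound n i t : `|n%:R^-1 * pole_sums n i t ^+ 2| <= n%:R^-1 * (n%:R * B) ^+ 2.
Proof.
rewrite normrM normrX ger0_norm ?invr_ge0//; apply: ler_wpM2l; first by rewrite invr_ge0.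
by rewrite ler_sqr ?nnegrE// mulr_ge0.
Qed.

Let V_modc n l t :
  n%:R^-1 * modc (centered_pole_sum mu xi de (fun j => X j t) n l) ^+ 2 <= V n t.
Proof.
rewrite modcE sqr_sqrtr ?addr_ge0 ?sqr_ge0//.
have hR := centered_pole_sum_part mu xi de (fun j => X j t) n false l.
have hI := centered_pole_sum_part mu xi de (fun j => X j t) n true l.
rewrite /complex_part in hR hI; rewrite hR hI mulrDr.
rewrite /V (bigD1 (l, false))//= (bigD1 (l, true)) /=; last by rewrite xpair_eqE andbF.
rewrite addrA lerDl.
by apply: sumr_ge0 => j _; rewrite mulr_ge0 ?invr_ge0// sqr_ge0.
Qed.

Let A : R := #|{: 'I_s * bool}|%:R * (8 * expR (2 * B ^+ 2)).

Let V_mean n : n%:R^-1 * B ^+ 2 <= 4^-1 -> \int[P]_t V n t <= A.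
Proof.
move=> hn; rewrite /V.
have iV i : P.-integrable setT (EFin \o (fun t => n%:R^-1 * pole_sums n i t ^+ 2)).
  by apply: bounded_integrable => //; exists (n%:R^-1 * (n%:R * B) ^+ 2) => t; exact: sqr_bound.
rewrite (Rintegral_sum _ iV).2 /A mulr_natl -sumr_const; apply: ler_sum => i _.
exact: (sum_sqr_moment iidX (measurable_centered_poles mu xi de i)
  (centered_poles_le de0 mu_ball i) (centered_poles_mean de0 mu_ball i)).
Qed.

Let fc l : R := fluctuation_const (modc (m l)) (newton_const de mu0) (2 * s%:R / de).

Let fc0 l : 0 <= fc l.
Proof.
have := modc_ge0 (m l); move=> h; rewrite /fc /fluctuation_const /newton_const.
have hd : 0 <= de := ltW de0; have hm := ltW mu0_gt0.
by rewrite !(addr_ge0, mulr_ge0, invr_ge0, exprn_ge0).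
Qed.

Let kappa : R := \sum_l fc l.

Let r n : R := #|{: 'I_s * bool}|%:R * (kappa / Num.sqrt n%:R).

Let rescaled_close n t : E n t ->
  \sum_i `|rescaled_part n i t - W n i t| <= r n * (1 + V n t).
Proof.
move=> Et; have [Kn sn] := good_event_large Et.
have q0 : (0 : R) <= (Num.sqrt n%:R)^-1 by rewrite invr_ge0 sqrtr_ge0.
have V0 : 0 <= 1 + V n t.
  by rewrite addr_ge0//; apply: sumr_ge0 => i _; rewrite mulr_ge0 ?invr_ge0// sqr_ge0.
rewrite /r -mulrA mulr_natl -sumr_const; apply: ler_sum => -[l b] _.
rewrite /rescaled_part mxE /= (wE _ Et).
rewrite /W /pole_sums -(centered_pole_sum_part mu xi de (fun j => X j t) n b l).
have partZ (a : R) (z : R[i]) : complex_part b (a%:C * z) = a * complex_part b z.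
  by case: (b) => /=; rewrite ?ImM ?ReM/= mul0r ?addr0 ?subr0.
rewrite -partZ -complex_partN -complex_partD; apply: le_trans (complex_part_le _ _) _.
have sepX := good_event_sep Et; have devX := good_event_dev Et.
apply: le_trans (newton_limit_fluctuation de0 xi_sep mu0_gt0 m_ge K1 K72 K9 K8 Kn sn sepX devX l) _.
apply: ler_pM.
- by apply: mulr_ge0 => //; exact: fc0.
- by rewrite addr_ge0// mulr_ge0 ?invr_ge0// sqr_ge0.
- apply: ler_wpM2r => //; rewrite /kappa (bigD1 l)//= lerDl; exact: sumr_ge0.
by rewrite lerD2l; exact: V_modc.
Qed.

Lemma measurable_rescaled_part n i : measurable_fun setT (rescaled_part n i).
Proof.
apply: measurable_complex_part; under eq_fun do rewrite mxE.
apply: measurable_complexM; first exact: measurable_cst.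
apply: measurable_complexD; last exact: measurable_cst.
by apply: measurable_complexB; [exact: measurable_funPT|exact: measurable_cst].
Qed.

(** Three errors of order n^(-1/2): the probability of the bad event, the distance to the normalised
    centred sum, and the rate in [clt_smooth]. *)
Lemma rescaled_part_cvg (g : ('I_s * bool -> R) -> R) : smooth_test g ->
  \int[P]_t g (fun i => rescaled_part n i t) @[n --> \oo] --> \int[P2]_t g (fun i => N i t).
Proof.
move=> gS; have [M gM] := smooth_test_bound gS.
have [L L0 gL] := smooth_test_lipschitz gS; have [C2 gT] := smooth_test_taylor2 gS.
have mg : coord_measurable g by case: gS.
have M0 : 0 <= M by apply: le_trans (gM (fun=> 0)); exact: normr_ge0.
pose C1 := C2 * (\sum_i \int[mu]_y `|centered_poles mu xi de i y| ^+ 3 + \sum_i \int[P2]_t `|N i t| ^+ 3).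
pose c := lam * (mu0 / 8) / 2.
have c0 : 0 < c by rewrite /c !mulr_gt0// invr_gt0.
apply: (@sqrt_rate_cvg _ _ _ (2 * M * (4 * s%:R / c) + L * (#|{: 'I_s * bool}|%:R * kappa) * (1 + A) + C1)
  (* The summands of this threshold serve the good event, the second-moment bound and the inequality
     s <= n + 1. *)
  (K + 4 * B ^+ 2 + s%:R)) => n hn n0.
have nR : (0 : R) < n%:R by rewrite ltr0n.
have sR : (0 : R) <= s%:R by [].
have B2 : 0 <= 4 * B ^+ 2 by rewrite mulr_ge0// sqr_ge0.
have Kn : K <= n%:R by lra.
have sn : (s <= n.+1)%N.
  apply: leqW; rewrite -(ler_nat R); have := K1; lra.
have Bn : n%:R^-1 * B ^+ 2 <= 4^-1.
  rewrite ler_pdivrMl//; have := K1; lra.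
have h1 := @clt_smooth _ _ _ _ _ _ _ _ _ _ _ iidX _ _ (measurable_centered_poles mu xi de)
  (centered_poles_le de0 mu_ball) (centered_poles_mean de0 mu_ball) _ _ _ HN covN
  _ _ _ mg gM gT _ n0.
have mE := measurable_good_event de0 mu_ball iidX K n lam0 lamB (divr_gt0 mu0_gt0 (ltr0n _ 8)) lamB2.
have PE := good_event_prob de0 mu_ball iidX lam0 lamB (divr_gt0 mu0_gt0 (ltr0n _ 8)) lamB2 Kn sn.
have q0 : (0 : R) < Num.sqrt n%:R by rewrite sqrtr_gt0.
have k0 : 0 <= kappa by apply: sumr_ge0.
have h2 : `|\int[P]_t g (fun i => rescaled_part n i t) - \int[P]_t g (fun i => W n i t)| <=
    2 * M * (4 * s%:R * expR (- (c * n%:R))) + L * r n * (1 + A).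
  apply: (@perturbation_bound _ _ _ _ P (rescaled_part n) (W n) g M L (E n) (V n)) => //.
  - exact: measurable_rescaled_part.
  - by move=> i; apply: measurable_funM => //; exact: measurable_cst.
  - by apply: sumr_measurable => i.
  - by move=> t; apply: sumr_ge0 => i _; rewrite mulr_ge0 ?invr_ge0// sqr_ge0.
  - exists (\sum_(i : 'I_s * bool) n%:R^-1 * (n%:R * B) ^+ 2) => t.
    by apply: ler_sum => i _; apply: le_trans (ler_norm _) _; exact: sqr_bound.
  - exact: V_mean.
  - by rewrite /r mulr_ge0// divr_ge0// ltW.
  - exact: rescaled_close.
have h3 : expR (- (c * n%:R)) <= c^-1 / Num.sqrt n%:R.
  rewrite expRN -invfM lef_pV2 ?posrE ?expR_gt0 ?mulr_gt0//.
  apply: le_trans _ (_ : c * n%:R <= _); last first.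
    by apply: le_trans (expR_ge1Dx _); rewrite lerDr.
  apply: ler_wpM2l; first exact: ltW.
  rewrite -[leRHS](sqr_sqrtr (ltW nR)) expr2 ler_peMl ?(ltW q0)//.
  by rewrite -[X in X <= _]sqrtr1 ler_sqrt// ler1n.
apply: le_trans (ler_distD (\int[P]_t g (fun i => W n i t)) _ _) _.
apply: le_trans (lerD h2 h1) _.
rewrite [leRHS]mulrDl lerD2r [leRHS]mulrDl; apply: lerD.
  move: h3; move: (expR _) => ex h3.
  rewrite -!mulrA; apply: ler_wpM2l => //; apply: ler_wpM2l => //.
  by apply: ler_wpM2l => //; apply: ler_wpM2l.
by rewrite /r le_eqVlt; apply/orP; left; apply/eqP; ring.
Qed.

End fluctuation_limit.

Section complex_row.
Context {R : realType} {s : nat}.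

Definition complex_row (x : 'I_s * bool -> R) : 'rV[R[i]]_s :=
  \row_l (x (l, false) +i* x (l, true)).

Lemma complex_row_parts (v : 'rV[R[i]]_s) :
  complex_row (fun i => complex_part i.2 (v 0 i.1)) = v.
Proof. by apply/rowP => l; rewrite mxE /complex_part/=; case: (v 0 l). Qed.

Lemma complex_row_continuous (f : 'rV[R[i]]_s -> R) : continuous f ->
  coordwise_continuous (fun x => f (complex_row x)).
Proof.
move=> cf x e e0.
have /cvgrPdist_lt/(_ e e0) [U hU sU] := cf (complex_row x).
have [|l r r' _ rr' h y hy|r r0 hr] := @finite_common_radius R _
  (fun l (r : R) => forall y, modc (y - complex_row x 0 l) < r -> U 0 l y).
- by move=> l; exact: ((nbhs_modc _ _).1 (hU 0 l)).
- by apply: h; exact: lt_le_trans hy rr'.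
(* Halved because the modulus is bounded by the sum of the two coordinates. *)
exists (r / 2) => [|y hy]; first by rewrite divr_gt0.
rewrite distrC; apply: sU => i l; rewrite (ord1 i); apply: hr; rewrite !mxE.
apply: le_lt_trans (modc_le_ReIm _) _; rewrite ReD ImD ReN ImN /=.
by have := hy (l, false); have := hy (l, true); lra.
Qed.

End complex_row.

Lemma random_variable_of {R : realType} {d d'} {T : measurableType d} {T' : measurableType d'}
    (P : probability T R) (f : T -> T') :
  measurable_fun setT f -> exists F : {RV P >-> T'}, forall t, F t = f t.
Proof.
move=> mf; pose F : {RV P >-> T'} := HB.pack f (isMeasurableFun.Build _ _ _ _ f mf).
by exists F.
Qed.

Lemma random_variables_of {R : realType} {d d'} {T : measurableType d} {T' : measurableType d'}
    {J : Type} (P : probability T R) (f : J -> T -> T') :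
  (forall j, measurable_fun setT (f j)) ->
  exists F : J -> {RV P >-> T'}, forall j t, F j t = f j t.
Proof.
by move=> mf; have [F hF] := choice (fun j => random_variable_of P (mf j)); exists F.
Qed.

Lemma cvg_in_distribution_parts {R : realType} {s : nat} {d d2 : measure_display}
    {T : measurableType d} {T2 : measurableType d2} (P : probability T R) (P2 : probability T2 R)
    (Z : nat -> T -> 'rV[R[i]]_s) (N : 'I_s * bool -> T2 -> R) :
  (forall n i, measurable_fun setT (fun t => complex_part i.2 (Z n t 0 i.1))) ->
  (forall i, measurable_fun setT (N i)) ->
  (forall g : ('I_s * bool -> R) -> R, smooth_test g ->
    \int[P]_t g (fun i => complex_part i.2 (Z n t 0 i.1)) @[n --> \oo] -->
    \int[P2]_t g (fun i => N i t)) ->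
  cvg_in_distribution P Z P2 (fun t => complex_row (fun i => N i t)).
Proof.
move=> mZ mN cvgS f cf [M fM].
have cF := complex_row_continuous cf.
have FM x : `|f (complex_row x)| <= M by [].
have mF := coordwise_continuous_measurable FM cF.
have h := portmanteau mZ mN cvgS FM cF.
have -> : (fun n => 'E_P[f \o Z n]%E) =
    (fun n => (\int[P]_t f (complex_row (fun i => complex_part i.2 (Z n t 0 i.1))))%:E).
  apply/funext => n; rewrite expectation.unlock EFin_Rintegral.
    by apply: eq_integral => t _ /=; rewrite complex_row_parts.
  apply: bounded_integrable; last by exists M.
  exact: (mF _ _ (fun i t => complex_part i.2 (Z n t 0 i.1)) (mZ n)).
have -> : ('E_P2[f \o (fun t => complex_row (fun i => N i t))])%E =
    (\int[P2]_t f (complex_row (fun i => N i t)))%:E.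
  rewrite expectation.unlock EFin_Rintegral//.
  apply: bounded_integrable; last by exists M.
  exact: (mF _ _ (fun i t => N i t) mN).
apply: cvg_EFin; last exact: h.
by near=> n.
Unshelve. all: by end_near.
Qed.

Lemma threshold_exists {R : realType} (de mu0 : R) (s : nat) : 0 < de -> 0 < mu0 ->
  exists lam K : R,
    [/\ 0 < lam, lam * (2 / de) <= 2^-1 & 4 * lam * (2 / de) ^+ 2 <= mu0 / 8] /\
    [/\ 1 <= K, 72 <= de ^+ 2 * mu0 ^+ 2 * K, 9 <= de * mu0 * K,
        8 * s%:R <= de * mu0 * K & 4 * s%:R <= lam * (mu0 / 8) / 2 * K].
Proof.
move=> de0 mu00; have B0 : 0 < 2 / de by rewrite divr_gt0.
pose lam := Num.min (2^-1 / (2 / de)) (mu0 / 8 / (4 * (2 / de) ^+ 2)).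
have lam0 : 0 < lam.
  by rewrite lt_min !divr_gt0 ?mulr_gt0 ?exprn_gt0 ?invr_gt0.
have c0 : 0 < lam * (mu0 / 8) / 2 by rewrite !(divr_gt0, mulr_gt0).
have a0 : 0 < de ^+ 2 * mu0 ^+ 2 by rewrite mulr_gt0// exprn_gt0.
have b0 : 0 < de * mu0 by rewrite mulr_gt0.
have sR : (0 : R) <= s%:R by [].
pose k1 : R := 72 / (de ^+ 2 * mu0 ^+ 2); pose k2 : R := 9 / (de * mu0).
pose k3 : R := 8 * s%:R / (de * mu0); pose k4 : R := 4 * s%:R / (lam * (mu0 / 8) / 2).
have [k10 k20] : 0 <= k1 /\ 0 <= k2 by split; rewrite divr_ge0// ltW.
have [k30 k40] : 0 <= k3 /\ 0 <= k4 by split; rewrite divr_ge0 ?mulr_ge0// ltW.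
exists lam, (1 + k1 + k2 + k3 + k4); split; split => //; first 2 last.
- by lra.
- by rewrite -ler_pdivrMl// [_^-1 * _]mulrC -/k1; lra.
- by rewrite -ler_pdivrMl// [_^-1 * _]mulrC -/k2; lra.
- by rewrite -ler_pdivrMl// [_^-1 * _]mulrC -/k3; lra.
- by rewrite -ler_pdivrMl// [_^-1 * _]mulrC -/k4; lra.
- by rewrite -ler_pdivlMr// ge_min lexx.
rewrite mulrAC mulrC -ler_pdivlMr ?mulr_gt0 ?exprn_gt0 ?invr_gt0//.
by rewrite ge_min lexx orbT.
Qed.

(** This makes the prefactor 2 universal. For n >= K, half of the exponent absorbs 4s, since 4s <=
    c' n <= 2 e^(c' n/2); for n < K, c n <= 1/2 makes the lower bound nonpositive. *)
Lemma exponential_threshold {R : realType} (c c' K : R) (s n : nat) : 1 <= K -> 0 < c' ->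
  4 * s%:R <= c' * K -> c <= c' / 2 -> c <= (2 * K)^-1 ->
  if K <= n%:R then 4 * s%:R * expR (- (c' * n%:R)) <= 2 * expR (- c * n%:R)
  else 1 - 2 * expR (- c * n%:R) <= 0.
Proof.
move=> K1 c'0 hs c1 c2; have K0 : 0 < K by lra.
have nR : (0 : R) <= n%:R by [].
case: leP => [Kn|nK].
  have -> : - (c' * n%:R) = - (c' / 2 * n%:R) + - (c' / 2 * n%:R) by field.
  rewrite expRD mulrA; apply: ler_pM; rewrite ?mulr_ge0 ?expR_ge0//.
    have h := expR_ge1Dx (c' / 2 * n%:R).
    have h' : c' * K <= c' * n%:R by rewrite ler_wpM2l// ltW.
    rewrite expRN ler_pdivrMr ?expR_gt0//.
    by have := expR_gt0 (c' / 2 * n%:R); lra.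
  rewrite ler_expR mulNr lerN2; exact: ler_wpM2r.
have h := expR_ge1Dx (- c * n%:R).
have h' : c * n%:R <= 2^-1.
  apply: le_trans (ler_wpM2r nR c2) _.
  rewrite ler_pdivrMl; last by rewrite mulr_gt0.
  lra.
lra.
Qed.

Theorem theorem2p10 (R : realType) :
  exists2 C : R, 0 < C &
  forall (s : nat) (mu : probability R[i] R) (xi : 'I_s -> R[i]),
    injective xi ->
    (forall l, ~ (measure_support mu `|` cauchy_stieltjes_zeros mu) (xi l)) ->
  let m (l : 'I_s) : R[i] := cauchy_stieltjes mu (xi l) in
  exists c C' : R, [/\ 0 < c, 0 < C' &
  forall (d : measure_display) (T : measurableType d) (P : probability T R)
      (X : nat -> {RV P >-> R[i]}),
    iid_with_law mu X ->
  exists (E : nat -> set T) (w : nat -> 'I_s -> {RV P >-> R[i]}),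
    [/\ forall n, measurable (E n),
        forall n, (0 < n)%N -> (s <= n.+1)%N ->
          ((1 - C * expR (- c * n%:R))%:E <= P (E n))%E /\
          forall t, E n t ->
            paired_critical_points xi (fun j => X j t) m C' n
              (fun l => w n l t)
      & exists (d' : measure_display) (T' : measurableType d')
          (P' : probability T' R) (N : 'I_s -> {RV P' >-> R[i]}),
        [/\ multivariate_normal P' (Re_Im_coordinates N),
            forall l, 'E_P'[fun t => complex.Re (N l t)]%E = 0%E /\
                      'E_P'[fun t => complex.Im (N l t)]%E = 0%E,
            forall j l,
              [/\ covariance P' (fun t => complex.Re (N j t))
                                (fun t => complex.Re (N l t)) =
                  covariance P (fun t => complex.Re (xi j - X 0%N t)^-1)
                               (fun t => complex.Re (xi l - X 0%N t)^-1),
                  covariance P' (fun t => complex.Im (N j t))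
                                (fun t => complex.Im (N l t)) =
                  covariance P (fun t => complex.Im (xi j - X 0%N t)^-1)
                               (fun t => complex.Im (xi l - X 0%N t)^-1)
                & covariance P' (fun t => complex.Re (N j t))
                                (fun t => complex.Im (N l t)) =
                  covariance P (fun t => complex.Re (xi j - X 0%N t)^-1)
                               (fun t => complex.Im (xi l - X 0%N t)^-1)]
          & forall w' : nat -> 'I_s -> {RV P >-> R[i]},
              (forall n l t, E n t -> w' n l t = w n l t) ->
              cvg_in_distribution P
                (fun n t => rescaled_fluctuations xi m n (fun l => w' n l t))
                P' (fun t => \row_l N l t)]]].
Proof.
(* The 2 of [exponential_threshold], independent of s, [mu] and [xi]. *)
exists 2 => // s mu xi xi_inj xi_out m.
have xi_off l : ~ measure_support mu (xi l) by move=> h; apply: (xi_out l); left.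
have [de de0 [xi_sep mu_ball]] := separation_radius xi_inj xi_off.
have m_neq0 l : m l != 0.
  by apply: cauchy_stieltjes_neq0 (mu_ball l) _ => // h; apply: (xi_out l); right.
have [l|l r r' _|mu0 mu00 m_ge] := @finite_common_radius R _ (fun l (r : R) => r <= modc (m l)).
- by exists (modc (m l)) => //; rewrite modc_gt0.
- exact: le_trans.
have [lam [K [[lam0 lamB lamB2] [K1 K72 K9 K8 K4]]]] := threshold_exists s de0 mu00.
have e0 : 0 < mu0 / 8 by rewrite divr_gt0.
have c'0 : 0 < lam * (mu0 / 8) / 2 by rewrite divr_gt0// mulr_gt0.
pose c := Num.min (lam * (mu0 / 8) / 2 / 2) (2 * K)^-1.
have nc0 : 0 <= newton_const de mu0.
  by rewrite addr_ge0 ?divr_ge0 ?mulr_ge0 ?exprn_ge0// ltW.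
exists c, (newton_const de mu0 + 1); split.
- by rewrite lt_min divr_gt0//= invr_gt0 mulr_gt0//; exact: lt_le_trans K1.
- by rewrite ltr_wpDl.
move=> d T P X iidX.
pose E := good_event mu xi de X (mu0 / 8) K.
have mE n : measurable (E n).
  by have := measurable_good_event de0 mu_ball iidX K n lam0 lamB e0 lamB2.
have paired n t : E n t ->
    paired_critical_points xi (fun j => X j t) m (newton_const de mu0 + 1) n
      (newton_limit xi (fun j => X j t) n).
  move=> Et; have [Kn sn] := good_event_large Et.
  apply: (newton_limit_paired de0 xi_sep mu00 m_ge K1 K72 K9 K8 Kn sn
    (good_event_sep Et) (good_event_dev Et)).
  by rewrite ltrDl.
pose w0 n l t := if t \in E n then newton_limit xi (fun j => X j t) n l else 0.
have mw n l : measurable_fun setT (w0 n l).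
  apply: measurable_newton_limit => // t Et; have [Kn sn] := good_event_large Et.
  exact: (good_newton_iter_cvg de0 xi_sep mu00 m_ge K1 K72 K9 K8 Kn sn
    (good_event_sep Et) (good_event_dev Et)).
have [w hw] := choice (fun n => random_variables_of P (mw n)).
have wE n l t : E n t -> w n l t = newton_limit xi (fun j => X j t) n l.
  by move=> Et; rewrite hw /w0 mem_set.
exists E, w; split => //.
- move=> n n0 sn; split; last first.
    by move=> t Et; rewrite (_ : (fun l => w n l t) = newton_limit xi (fun j => X j t) n);
      [exact: paired|apply/funext => l; exact: wE].
  have c1 : c <= lam * (mu0 / 8) / 2 / 2 by rewrite ge_min lexx.
  have c2 : c <= (2 * K)^-1 by rewrite ge_min lexx orbT.
  have := exponential_threshold n K1 c'0 K4 c1 c2; case: leP => [Kn h|_ h].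
    apply: le_trans (good_event_prob de0 mu_ball iidX lam0 lamB e0 lamB2 Kn sn).
    by rewrite lee_fin lerD2l lerN2.
  by apply: le_trans (measure_ge0 _ _); rewrite lee_fin.
have [d' [T' [P' [N [vs [HN covN]]]]]] := pole_gaussian_exists de0 mu_ball.
have mN i : measurable_fun setT (N i) by case: HN.
have [|N' hN'] := random_variables_of P' (f := fun l t => N (l, false) t +i* N (l, true) t).
  by move=> l; apply: measurable_complex => /=.
have NR l : (fun t => complex.Re (N' l t)) = N (l, false) by apply/funext => t; rewrite hN'.
have NI l : (fun t => complex.Im (N' l t)) = N (l, true) by apply/funext => t; rewrite hN'.
have mean0 i : ('E_P'[N i] = 0)%E.
  rewrite expectation.unlock -(EFin_Rintegral (gaussian_vector_integrable HN i)).
  by rewrite (gaussian_vector_mean HN).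
have cov i j : covariance P' (N i) (N j) =
    covariance P (fun t => complex_part i.2 (xi i.1 - X 0%N t)^-1)
                 (fun t => complex_part j.2 (xi j.1 - X 0%N t)^-1).
  rewrite (gaussian_vector_covarianceE HN) -covN.
  by rewrite (pole_covarianceE de0 mu_ball (X := X 0%N))//; exact: (iidX.2 0%N).
exists d', T', P', N'; split.
- have -> : Re_Im_coordinates N' = N.
    apply/funext => -[l b]; rewrite /Re_Im_coordinates/=.
    by case: b; apply/funext => t; rewrite hN'.
  exact: gaussian_vector_normal HN.
- by move=> l; rewrite NR NI !mean0.
- move=> j l; rewrite !NR !NI; split; first exact: (cov (j, false) (l, false)).
    exact: (cov (j, true) (l, true)).
  exact: (cov (j, false) (l, true)).
move=> w' hw'.
(* The fluctuation estimate uses the critical points on [E n] only, so any extension [w'] has the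
   same limit. *)
have w'E n l t : E n t -> w' n l t = newton_limit xi (fun j => X j t) n l.
  by move=> Et; rewrite hw'// wE.
have -> : (fun t => \row_l N' l t) = (fun t => complex_row (fun i => N i t)).
  by apply/funext => t; apply/rowP => l; rewrite !mxE hN'.
apply: cvg_in_distribution_parts => //.
- by move=> n i; exact: (measurable_rescaled_part mu xi w' n i).
exact: (rescaled_part_cvg de0 mu_ball xi_sep mu00 m_ge K1 K72 K9 K8 lam0 lamB lamB2 iidX w'E HN covN).
Qed.
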